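(* Let $c_0=\sqrt{2/\pi}$ and $T>0$. The forward-backward stochastic differential equation $$\begin{cases}dX(t)=-c_0\dfrac{Y(t)}{\|Y(t)\|_2}\,dt+dB(t),&X(0)=0,\\[2mm]dY(t)=Z(t)\,dB(t),&Y(T)=\dfrac{X(T)}{\|X(T)\|_2},\end{cases}\qquad0\le t\le T,$$ has a unique solution $(X,Y,Z)$, given for $0\le t\le T$ by $$X(t)=\int_0^t\frac{w(t)}{w(s)}\,dB(s),\qquad Y(t)=\int_0^tZ(s)\,dB(s),\qquad Z(t)=\frac{2c_0w(T)}{w(t)(1-w(T))},$$ where $w(t)=-W_0\big(-e^{-2c_0^2t-1}\big)\in(0,1]$ and $W_0$ is the principal branch of the Lambert $W$-function. Moreover, for $0<t\le T$, $$\|X(t)\|_2=\frac{1-w(t)}{2c_0},\qquad\frac{Y(t)}{\|Y(t)\|_2}=\frac{X(t)}{\|X(t)\|_2}.$$ Consequently, the process $\alpha(t)=-c_0\,X(t)/\|X(t)\|_2$, $0<t\le T$, is the unique optimal control for the problem $V_T^2$.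
   Context: Fix a complete probability space supporting a one-dimensional standard Brownian motion $B=(B(t))_{0\le t\le T}$ started at zero, with completed Brownian filtration $\mathbb{F}$. $\|\cdot\|_2$ is the $L^2$ norm of a random variable. The problem $V_T^2$ is $$V_T^2=\inf_\alpha\|X(T)\|_2,\qquad X(t)=\int_0^t\alpha(s)\,ds+B(t),\quad0\le t\le T,$$ with the infimum over $\mathbb{F}$-progressively measurable real processes $\alpha$ with $\|\alpha(t)\|_2\le c_0=\sqrt{2/\pi}$ for all $0\le t\le T$ (controls are identified up to $dt\otimes\mathbb{P}$-null sets). The principal branch $W_0:[-e^{-1},\infty)\to[-1,\infty)$ is the inverse of $w\mapsto we^w$ on $[-1,\infty)$. A solution of the system is a triple of $\mathbb{F}$-progressively measurable processes, where the second equation means that $Y$ is the $\mathbb{F}$-martingale $Y(t)=\mathbb{E}[Y(T)\,|\,\mathcal{F}(t)]$ with stochastic-integral representation having integrand $Z$; the drift in the first equation is only needed for a.e. $t$. *)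

(* Defs.v *)
(* MathComp-Analysis, over an abstract realType. *)
From HB Require Import structures.
From mathcomp Require Import all_boot all_order all_algebra.
From mathcomp Require Import all_classical all_reals all_analysis.

Set Implicit Arguments.
Unset Strict Implicit.
Unset Printing Implicit Defensive.

Import Order.TTheory GRing.Theory Num.Theory.
Import numFieldNormedType.Exports.

Local Open Scope classical_set_scope.
Local Open Scope ring_scope.

Definition c0 {R : realType} : R := Num.sqrt (2 / pi).

(* Principal branch of the Lambert function: the inverse of x |-> x * exp x
   restricted to [-1, +oo[. Outside the range [-1/e, +oo[ its value is junk. *)
Definition lambertW0 {R : realType} : R -> R :=
  'pinv_(fun=> 0) `[-1, +oo[ (fun x => x * expR x).

Definition wfun {R : realType} (t : R) : R :=
  - lambertW0 (- expR (- (2 * c0 ^+ 2 * t) - 1)).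

(* A process is a map R -> Omega -> R, of which only the values at times in
   [0, T] matter. *)
Section brownian.
Context {R : realType} {d : measure_display} {Omega : measurableType d}.
Context (P : probability Omega R).
Implicit Types (B X Y Z alpha : R -> Omega -> R) (t T : R).

Definition L2norm (f : Omega -> R) : \bar R := ('N[P]_2%:E [EFin \o f])%E.

Definition past_events B t : set (set Omega) :=
  \bigcup_(s in `[0, t]) preimage_set_system setT (B s) measurable.

(* Normalisation, almost sure continuity, and Gaussian increments independent
   of the past. *)
Definition brownian_motion T B : Prop :=
  [/\ forall t, 0 <= t <= T -> measurable_fun setT (B t),
      {ae P, forall omega, B 0 omega = 0},
      {ae P, forall omega, {within `[0, T], continuous (fun t => B t omega)}},
      forall s t, 0 <= s -> s < t -> t <= T ->
        forall A : set R, measurable A ->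
          P ((fun omega => B t omega - B s omega) @^-1` A) =
          normal_prob 0 (Num.sqrt (t - s)) A
    & forall s t, 0 <= s -> s < t -> t <= T ->
        forall (E : set Omega) (A : set R),
          <<s past_events B s >> E -> measurable A ->
          P (E `&` (fun omega => B t omega - B s omega) @^-1` A) =
          (P E * P ((fun omega => (B t omega - B s omega)%R) @^-1` A))%E].

(* The completed Brownian filtration: F(t) is the sigma-algebra generated by
   [filtration B t]. *)
Definition filtration B t : set (set Omega) :=
  past_events B t `|` P.-negligible.

Definition progressive B T X : Prop :=
  forall t, 0 <= t <= T ->
    measurable_fun (`[0, t] `*` setT)
      ((fun p => X p.1 p.2) : R * g_sigma_algebraType (filtration B t) -> R).

Definition cond_expectation B t (Y xi : Omega -> R) : Prop :=
  [/\ measurable_fun setT (Y : g_sigma_algebraType (filtration B t) -> R),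
      P.-integrable setT (EFin \o xi),
      P.-integrable setT (EFin \o Y)
    & forall A, <<s filtration B t >> A ->
        (\int[P]_(omega in A) (Y omega)%:E =
         \int[P]_(omega in A) (xi omega)%:E)%E].

(* The process \sum_(i < sp_size) sp_val i * 1_(]sp_time i, sp_time i.+1]). *)
Record simple_process := SimpleProcess {
  sp_size : nat ;
  sp_time : nat -> R ;
  sp_val : nat -> Omega -> R }.

Definition simple_predictable B t (H : simple_process) : Prop :=
  [/\ 0 <= sp_time H 0, sp_time H (sp_size H) <= t,
      forall i, (i < sp_size H)%N -> sp_time H i <= sp_time H i.+1
    & forall i, (i < sp_size H)%N ->
        measurable_fun setT
          (sp_val H i :
             g_sigma_algebraType (filtration B (sp_time H i)) -> R) /\
        exists M, forall omega, `|sp_val H i omega| <= M].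

Definition simple_eval (H : simple_process) t (omega : Omega) : R :=
  \sum_(i < sp_size H)
    sp_val H i omega * (t \in `]sp_time H i, sp_time H i.+1])%:R.

Definition simple_integral B (H : simple_process) (omega : Omega) : R :=
  \sum_(i < sp_size H)
    sp_val H i omega * (B (sp_time H i.+1) omega - B (sp_time H i) omega).

Definition L2dist2 t Z Z' : \bar R :=
  (\int[lebesgue_measure \x P]_(p in `[0%R, t] `*` setT)
     ((Z p.1 p.2 - Z' p.1 p.2) ^+ 2)%:E)%E.

(* [ito_integral B t Z I] means I = \int_0^t Z(s) dB(s) almost surely, for Z
   progressive and in L^2(dt x P): I is the L^2(P)-limit of the integrals of
   simple processes converging to Z in L^2([0, t] x Omega). *)
Definition ito_integral B t Z (I : Omega -> R) : Prop :=
  [/\ progressive B t Z,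
      (L2dist2 t Z (fun _ _ => 0%R) < +oo)%E,
      measurable_fun setT I
    & exists H : nat -> simple_process,
      [/\ forall n, simple_predictable B t (H n),
          L2dist2 t (simple_eval (H n)) Z @[n --> \oo] --> 0%E
        & (\int[P]_omega ((simple_integral B (H n) omega - I omega) ^+ 2)%:E)%E
            @[n --> \oo] --> 0%E]].

(* The controlled state X(t) = \int_0^t alpha(s) ds + B(t), the first integral
   being a pathwise Lebesgue integral. *)
Definition state B alpha t (omega : Omega) : R :=
  \int[lebesgue_measure]_(s in `[0, t]) alpha s omega + B t omega.

Definition indistinguishable T X Y : Prop :=
  {ae P, forall omega, forall t, 0 <= t <= T -> X t omega = Y t omega}.

Definition dtP_ae_eq T X Y : Prop :=
  {ae (lebesgue_measure \x P)%E,
    forall p : R * Omega, 0 <= p.1 <= T -> X p.1 p.2 = Y p.1 p.2}.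

(* As 0^-1 = 0 and fine +oo = 0, [normalized] is meaningful only where the norm
   is positive and finite. *)
Definition normalized X t (omega : Omega) : R :=
  X t omega / fine (L2norm (X t)).

Definition drift Y t (omega : Omega) : R := - c0 * normalized Y t omega.

(* Z is sought in L^2(dt x P), where the martingale representation theorem
   provides it since Y(T) is square-integrable, and Y is the continuous version
   of its martingale. *)
Definition fbsde_solution T B X Y Z : Prop :=
  [/\ [/\ progressive B T X, progressive B T Y & progressive B T Z],
      [/\ {ae lebesgue_measure, forall t, 0 <= t <= T ->
             (0 < L2norm (Y t) < +oo)%E},
          {ae P, forall omega, lebesgue_measure.-integrable `[0, T]
             (fun t => (drift Y t omega)%:E)}
        & indistinguishable T X (state B (drift Y))],
      [/\ {ae P, forall omega,
             {within `[0, T], continuous (fun t => Y t omega)}},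
          forall t, 0 <= t <= T -> cond_expectation B t (Y t) (Y T)
        & forall t, 0 <= t <= T ->
            ito_integral B t Z (fun omega => Y t omega - Y 0 omega)]
    & (0 < L2norm (X T) < +oo)%E /\
      {ae P, forall omega, Y T omega = normalized X T omega}].

Definition admissible T B alpha : Prop :=
  progressive B T alpha /\
  forall t, 0 <= t <= T -> (L2norm (alpha t) <= c0%:E)%E.

Definition cost T B alpha : \bar R := L2norm (state B alpha T).

Definition value T B : \bar R :=
  ereal_inf [set cost T B alpha | alpha in admissible T B].

Definition optimal T B alpha : Prop :=
  admissible T B alpha /\ cost T B alpha = value T B.

End brownian.

(* Main.v *)
(* Existence. By [w' = - 2 c0^2 w / (1 - w)], the function [1 / w] has derivative
   [2 c0^2 / (w (1 - w))], and integrating by parts path by path turns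
   [W t = \int_0^t 1 / w dB] into a Lebesgue integral of the path of [B]. Then
   [X = w W] solves [dX = - 2 c0^2 / (1 - w) X dt + dB], the isometry gives
   [||W t|| = (1 / w t - 1) / (2 c0)], so this drift is [- c0 X / ||X||], and
   [Y = K W], with [K] chosen so that [Y T = X T / ||X T||], is a martingale
   proportional to [X] at each time.

   Uniqueness and optimality. Let [(X, Y, Z)] be any solution, [a] its drift and
   [alpha] any admissible control with state [X^alpha]. As [||Y T|| = 1] and [Y] is
   a martingale, Cauchy-Schwarz and Fubini give
     [||X^alpha T|| - ||X T|| >= E (Y T) (X^alpha T - X T)
        = \int_0^T E (Y s) (alpha s - a s) ds
        >= \int_0^T ||Y s|| / (2 c0) * ||alpha s - a s||^2 ds],
   because [||alpha s|| <= c0] and [a s = - c0 Y s / ||Y s||]. Hence [a] is the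
   unique optimal control; two solutions have the same drift, so the same [X], the
   same terminal value of [Y], hence the same [Y], and the same [Z] by the
   isometry. *)
From HB Require Import structures.
From mathcomp Require Import all_boot all_order all_algebra.
From mathcomp Require Import all_classical all_reals all_analysis.
From mathcomp Require Import measurable_realfun ring lra.
Require Import Defs.

Set Implicit Arguments.
Unset Strict Implicit.
Unset Printing Implicit Defensive.

Import Order.TTheory GRing.Theory Num.Theory.
Import numFieldNormedType.Exports.

Local Open Scope classical_set_scope.
Local Open Scope ring_scope.


(** * The function w *)

Section lambert.
Context {R : realType}.
Implicit Types (t x y w : R).

(** Origin of w: if [dX = - c0 X / ||X|| dt + dB], then [x = ||X||] solves [(x^2)' = 1 - 2 c0 x].
    Writing [x = (1 - w) / (2 c0)] turns this into [w' (1 - w) / w = - 2 c0^2], and integrating from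
    [w = 1] at time 0 gives [w exp(-w) = exp(-2 c0^2 t - 1)], the Lambert equation for [-w]. The
    obstacle is time 0: [1 - w] vanishes there like the square root of [t], so the drift rate and
    the derivative of [1 / w] blow up, though integrably. Calculus is therefore done at positive
    times, with limits at 0. The stochastic integral is only a predicate about approximating simple
    processes. Defining [W] by parts gives a process that exists for every omega, is continuous, and
    is the limit of its Riemann sums path by path; the isometry for simple processes and Fatou's
    lemma then upgrade this to the L2 convergence that the predicate demands. *)

Definition theta : R := 2 * c0 ^+ 2.

Lemma c0_gt0 : 0 < c0 :> R.
Proof. by rewrite sqrtr_gt0 divr_gt0// pi_gt0. Qed.

Lemma theta_gt0 : 0 < theta.
Proof. by rewrite mulr_gt0// exprn_gt0// c0_gt0. Qed.

(** With [e = y - x] and after division by [expR (- y)] the claim is [(y - e) * expR e < y]. It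
    follows from [(1 - e) * expR e < 1] by subtracting [(1 - y) * expR e >= 1 - y]. *)
Lemma mul_expRN_lt x y : x < y -> y <= 1 -> x * expR (- x) < y * expR (- y).
Proof.
move=> xy y1; set e := y - x.
have e0 : 0 < e by rewrite subr_gt0.
have h : 1 - e < expR (- e).
  by apply: expR_gt1Dx; rewrite oppr_eq0 gt_eqF.
have h2 : 1 + e < expR e by apply: expR_gt1Dx; rewrite gt_eqF.
have ee : expR (- e) * expR e = 1 by rewrite -expRD addNr expR0.
have e1 : expR (- x) = expR (- y) * expR e by rewrite -expRD /e; congr expR; ring.
rewrite e1 mulrCA mulrC ltr_pM2r ?expR_gt0//.
have -> : x = y - e by rewrite /e; ring.
have := expR_gt0 e; nra.
Qed.

Lemma lambertW0P y : - expR (-1) <= y <= 0 ->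
  [/\ -1 <= lambertW0 y, lambertW0 y <= 0 & lambertW0 y * expR (lambertW0 y) = y].
Proof.
move=> /andP[y0 y1].
have cf : continuous (fun x : R => x * expR x).
  move=> x; apply: cvgM; [exact: cvg_id|exact: continuous_expR].
have [c] : exists2 c : R, c \in `[-1, 0] & c * expR c = y.
  apply: (@IVT _ (fun x => x * expR x)) => //.
    exact: continuous_subspaceT.
  rewrite mul0r mulN1r ge_min le_max y0 y1 /=.
  by rewrite orbT.
rewrite in_itv/= => /andP[c1 c2] cy.
have inj : {in (`[-1, +oo[%classic : set R) &, injective (fun x => x * expR x)}.
  (* Reflection of [mul_expRN_lt], applied to [- b < - a <= 1]. *)
  have lt (a b : R) : -1 <= a -> a < b -> a * expR a < b * expR b.
    move=> a1 ab.
    have : - b < - a by rewrite ltrN2.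
    by move/mul_expRN_lt; rewrite !opprK !mulNr !ltrN2; apply; lra.
  move=> a b; rewrite !inE/= !in_itv/= !andbT => a1 b1 ab.
  have [h|h|//] := ltgtP a b.
    by have := lt _ _ a1 h; rewrite ab ltxx.
  by have := lt _ _ b1 h; rewrite ab ltxx.
have cI : c \in (`[-1, +oo[%classic : set R) by rewrite inE/= in_itv/= andbT.
have -> : lambertW0 y = c by rewrite /lambertW0 -cy pinvKV.
by [].
Qed.

(** The implicit equation for [w]; every later property of [wfun] is drawn from it, not from the
    definition of the Lambert function. *)
Lemma wfunP t : 0 <= t ->
  [/\ 0 < wfun t, wfun t <= 1 & wfun t * expR (- wfun t) = expR (- (theta * t) - 1)].
Proof.
move=> t0; rewrite /wfun -/theta.
have [|h1 h2 h3] := @lambertW0P (- expR (- (theta * t) - 1)).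
  rewrite lerN2 ler_expR oppr_le0 expR_ge0 andbT.
  by have := mulr_ge0 (ltW theta_gt0) t0; lra.
set x := lambertW0 _ in h1 h2 h3 *.
rewrite opprK mulNr h3 opprK; split=> //; last by lra.
rewrite oppr_gt0 lt_neqAle h2 andbT; apply/eqP => x0.
move: h3; rewrite x0 mul0r => /esym/eqP; rewrite oppr_eq0 gt_eqF//.
exact: expR_gt0.
Qed.

(** The time at which [wfun] takes the value [w]: the logarithm of the implicit equation, solved for
    [t]. *)
Definition tfun w : R := (w - 1 - ln w) / theta.

Lemma wfunK t : 0 <= t -> tfun (wfun t) = t.
Proof.
move=> /wfunP[w0 w1 we]; rewrite /tfun.
have : ln (wfun t * expR (- wfun t)) = - (theta * t) - 1 by rewrite we expRK.
rewrite lnM ?posrE ?expR_gt0// expRK => h.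
have -> : ln (wfun t) = - (theta * t) - 1 + wfun t by lra.
by field; rewrite gt_eqF// theta_gt0.
Qed.

Lemma tfun_gt0 w : 0 < w -> w < 1 -> 0 < tfun w.
Proof.
move=> w0 w1; rewrite /tfun divr_gt0 ?theta_gt0//.
have lw : ln w != 0 by rewrite ln_eq0// lt_eqF.
have := expR_gt1Dx lw; rewrite lnK ?posrE//; lra.
Qed.

(** Both sides lie in []0, 1]] and have the same image under [x * expR (- x)], which is injective
    there. *)
Lemma tfunK w : 0 < w -> w <= 1 -> wfun (tfun w) = w.
Proof.
move=> w0 w1.
have t0 : 0 <= tfun w.
  move: w1; rewrite le_eqVlt => /predU1P[->|w1].
    by rewrite /tfun ln1 subrr sub0r oppr0 mul0r.
  exact/ltW/tfun_gt0.
have [v0 v1 ve] := wfunP t0.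
have e : wfun (tfun w) * expR (- wfun (tfun w)) = w * expR (- w).
  rewrite ve /tfun; have -> : - (theta * ((w - 1 - ln w) / theta)) - 1 = ln w - w.
    by field; rewrite gt_eqF// theta_gt0.
  by rewrite expRD lnK ?posrE.
have [h|h|//] := ltgtP (wfun (tfun w)) w.
  by have := mul_expRN_lt h w1; rewrite e ltxx.
by have := mul_expRN_lt h v1; rewrite e ltxx.
Qed.

Lemma wfun0 : wfun 0 = 1 :> R.
Proof.
have {1}-> : 0 = tfun 1 by rewrite /tfun ln1 subrr subr0 mul0r.
exact: tfunK.
Qed.

Lemma wfun_lt1 t : 0 < t -> wfun t < 1.
Proof.
move=> t0; have [w0 w1 we] := wfunP (ltW t0).
rewrite lt_neqAle w1 andbT; apply/eqP => e.
have := wfunK (ltW t0); rewrite e /tfun ln1 subrr subr0 mul0r => t00.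
by rewrite -t00 ltxx in t0.
Qed.

Lemma wfun_lt s t : 0 <= s -> s < t -> wfun t < wfun s.
Proof.
move=> s0 st; have t0 : 0 <= t by apply: le_trans s0 (ltW st).
have [ws0 ws1 wse] := wfunP s0; have [wt0 wt1 wte] := wfunP t0.
rewrite ltNge le_eqVlt; apply/negP => /predU1P[e|h].
  have := wfunK s0; rewrite e wfunK// => e'.
  by rewrite e' ltxx in st.
have := mul_expRN_lt h wt1; rewrite wse wte ltr_expR ltrD2r ltrN2.
by rewrite ltr_pM2l ?theta_gt0// ltNge (ltW st).
Qed.

(** The inverse function rule for [tfun]. Time 0 is excluded because the derivative of [tfun]
    vanishes at [w = 1]. *)
Lemma is_derive_wfun t : 0 < t ->
  is_derive t 1 wfun (- (theta * wfun t / (1 - wfun t))).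
Proof.
move=> t0; have [w0 w1 we] := wfunP (ltW t0).
have wlt1 := wfun_lt1 t0.
have wt := wfunK (ltW t0).
have dtf x : 0 < x -> is_derive x 1 tfun ((1 - x^-1) / theta).
  move=> x0; have := is_derive1_ln x0 => dl.
  rewrite /tfun; apply: is_derive_eq. rewrite /= /GRing.scale/=; by ring.
rewrite -[X in is_derive X]wt.
have -> : - (theta * wfun t / (1 - wfun t)) = ((1 - (wfun t)^-1) / theta)^-1.
  have a1 : wfun t != 0 by rewrite gt_eqF.
  have a2 : 1 - wfun t != 0 by rewrite gt_eqF// subr_gt0.
  have a3 : wfun t - 1 != 0 by rewrite lt_eqF// subr_lt0.
  have a4 : theta != 0 by rewrite gt_eqF// theta_gt0.
  by field; rewrite ?a1 ?a2 ?a3 ?a4.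
have nw : \forall x \near wfun t, 0 < x /\ x < 1.
  near=> x; split.
    near: x; exact: (lt_nbhsr w0).
  near: x; exact: (lt_nbhsl wlt1).
apply: is_derive_inverse.
- by near=> x; apply: tfunK; [|apply: ltW]; near: x; apply: filterS nw => ? [].
- near=> x. have x0 : 0 < x by near: x; apply: filterS nw => ? [].
  by apply/differentiable_continuous/derivable1_diffP; case: (dtf x x0).
- exact: dtf.
- rewrite mulf_neq0// ?invr_eq0 ?(gt_eqF theta_gt0)//.
  rewrite subr_eq0 eq_sym invr_eq1 lt_eqF//.
Unshelve. all: end_near.
Qed.

End lambert.


(** * The fundamental theorem of calculus with a singularity of the derivative at 0 *)

Section ftc_singular.
Context {R : realType}.
Notation mu := (@lebesgue_measure R).
Implicit Types (F f : R -> R) (a b x : R).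

Lemma FTC2_segment F f a b : 0 < a -> a < b ->
  (forall x, 0 < x -> is_derive x 1 F (f x)) ->
  (forall x, 0 < x -> {for x, continuous f}) ->
  (\int[mu]_(x in `[a, b]) (f x)%:E = (F b - F a)%:E)%E.
Proof.
move=> a0 ab dF cf.
have cF x : 0 < x -> {for x, continuous F}.
  move=> x0; apply/differentiable_continuous/derivable1_diffP.
  by case: (dF x x0).
have pos x : x \in `[a, b] -> 0 < x.
  by rewrite in_itv/= => /andP[ax _]; exact: lt_le_trans ax.
rewrite EFinB; apply: continuous_FTC2 => //.
- apply: continuous_in_subspaceT => x; rewrite inE/= => /pos; exact: cf.
- split.
  + move=> x xab; have /dF : 0 < x by apply: pos; exact: subset_itv_oo_cc xab.
    by case.
  + by apply: cvg_at_right_filter; apply: cF.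
  + by apply: cvg_at_left_filter; apply: cF; exact: lt_trans ab.
- move=> x xab; have /dF : 0 < x by apply: pos; exact: subset_itv_oo_cc xab.
  by rewrite derive1E => ?; apply: derive_val.
Qed.

Lemma measurable_fun_pos f b : (forall x, 0 < x -> {for x, continuous f}) ->
  measurable_fun (`]0, b]%classic : set R) f.
Proof.
move=> cf; have : measurable_fun (`]0, +oo[%classic : set R) f.
  apply: open_continuous_measurable_fun; first exact: interval_open.
  by move=> x; rewrite inE/= in_itv/= andbT; exact: cf.
by apply: measurable_funS => //; apply: subset_itvl; rewrite bnd_simp.
Qed.

Let seq_cvg0 b : 0 < b -> ((n.+2%:R^-1 : R) * b) @[n --> \oo] --> (0 : R).
Proof.
move=> b0; rewrite -[X in _ --> X](mul0r b); apply: cvgM; last exact: cvg_cst.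
have := @cvg_harmonic R; rewrite -(cvg_shiftn 1).
by apply: cvg_trans; apply: near_eq_cvg; near=> n; rewrite /= addn1.
Unshelve. all: end_near. Qed.

(** For a nonnegative derivative, monotone convergence along segments growing to []0, b]] yields the
    value of the integral, and with it integrability. *)
Lemma ge0_FTC2 F f b : 0 < b ->
  F x @[x --> 0^'+] --> F 0 ->
  (forall x, 0 < x -> is_derive x 1 F (f x)) ->
  (forall x, 0 < x -> {for x, continuous f}) ->
  (forall x, 0 < x -> 0 <= f x) ->
  (\int[mu]_(x in `[0%R, b]) (f x)%:E = (F b - F 0)%:E)%E.
Proof.
move=> b0 F0 dF cf f0.
have mf := measurable_fun_pos (b := b) cf.
rewrite -integral_itv_obnd_cbnd; last exact/measurable_EFinP.
(* With [n.+2] the left endpoint is strictly below [b] already for [n = 0], as [FTC2_segment]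
   requires. *)
pose A (n : nat) : set R := `[n.+2%:R^-1 * b, b]%classic.
have an0 (n : nat) : 0 < n.+2%:R^-1 * b by rewrite mulr_gt0// invr_gt0.
have anb (n : nat) : n.+2%:R^-1 * b < b.
  by rewrite gtr_pMl// invf_lt1// (ltr_nat _ 1).
have bA : \bigcup_n A n = `]0, b]%classic.
  apply/seteqP; split=> x /=.
    move=> [n _]; rewrite /A/= !in_itv/= => /andP[h ->]; rewrite andbT.
    exact: lt_le_trans h.
  rewrite in_itv/= => /andP[x0 xb].
  have /cvgrPdist_lt/(_ _ x0)[N _ /(_ N (leqnn _))]/= := seq_cvg0 b0.
  rewrite sub0r normrN gtr0_norm// => h; exists N => //.
  by rewrite /A/= in_itv/= xb (ltW h).
have Ai n : A n `<=` `]0, b] by rewrite -bA; exact: bigcup_sup.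
have c1 : (\int[mu]_(x in A n) (f x)%:E)%E @[n --> \oo] -->
    (\int[mu]_(x in `]0%R, b]) (f x)%:E)%E.
  rewrite -bA; apply: ge0_nondecreasing_set_cvg_integral.
  - move=> n m nm; apply/subsetPset => x; rewrite /A/= !in_itv/= => /andP[h ->].
    rewrite andbT; apply: le_trans h; rewrite ler_pM2r//.
    by rewrite lef_pV2 ?posrE// ler_nat !ltnS.
  - by move=> n; exact: measurable_itv.
  - move=> n; apply/measurable_EFinP; apply: measurable_funS mf => //.
  - move=> n x /Ai/=; rewrite in_itv/= lee_fin => /andP[x0 _]; exact: f0.
have c2 : (\int[mu]_(x in A n) (f x)%:E)%E @[n --> \oo] --> (F b - F 0)%:E.
  under eq_cvg do rewrite (FTC2_segment (an0 _) (anb _) dF cf).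
  apply: cvg_EFin; first exact: nearW.
  apply: cvgB; first exact: cvg_cst.
  have /cvg_at_rightP := F0; apply; split; first exact: an0.
  exact: seq_cvg0.
by apply: cvg_unique c1 c2; exact: ereal_hausdorff.
Qed.

Lemma ge0_FTC2_integrable F f b : 0 < b ->
  F x @[x --> 0^'+] --> F 0 ->
  (forall x, 0 < x -> is_derive x 1 F (f x)) ->
  (forall x, 0 < x -> {for x, continuous f}) ->
  (forall x, 0 < x -> 0 <= f x) ->
  mu.-integrable `[0, b] (EFin \o f).
Proof.
move=> b0 F0 dF cf f0; apply/integrableP; split.
  apply/measurable_EFinP; apply/measurable_fun_itv_obnd_cbndP.
  exact: measurable_fun_pos.
rewrite -integral_itv_obnd_cbnd; last first.
  by apply: measurableT_comp => //; apply/measurable_EFinP; exact: measurable_fun_pos.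
under eq_integral => x.
  rewrite inE/= in_itv/= => /andP[x0 _]; rewrite ger0_norm ?f0//; over.
rewrite integral_itv_obnd_cbnd; last first.
  by apply/measurable_EFinP; exact: measurable_fun_pos.
by rewrite (ge0_FTC2 b0 F0 dF cf f0) ltry.
Qed.

(** Without a sign, integrability is assumed instead: it makes the integral over [[0, x]] tend to 0
    with [x], so the identity on [[x, b]] passes to the limit. *)
Lemma FTC2_singular F f b : 0 < b ->
  F x @[x --> 0^'+] --> F 0 ->
  (forall x, 0 < x -> is_derive x 1 F (f x)) ->
  (forall x, 0 < x -> {for x, continuous f}) ->
  mu.-integrable `[0, b] (EFin \o f) ->
  \int[mu]_(x in `[0, b]) f x = F b - F 0.
Proof.
move=> b0 F0 dF cf fi.
pose I x := \int[mu]_(t in `[0, x]) f t.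
have key : \forall x \near 0^'+, I b - I x = F b - F x.
  near=> x.
  have x0 : 0 < x by near: x; exact: nbhs_right_gt.
  have xb : x < b by near: x; exact: nbhs_right_lt.
  rewrite /I Rintegral_itvB ?bnd_simp ?ltW//.
  rewrite Rintegral_itv_obnd_cbnd; last first.
    by apply: integrableS fi => // y /=; rewrite !in_itv/= => /andP[/ltW xy ->];
      rewrite andbT (le_trans _ xy)// ltW.
  by rewrite /Rintegral (FTC2_segment x0 xb dF cf).
have c1 : (I b - I x) @[x --> 0^'+] --> I b - 0.
  apply: cvgB; first exact: cvg_cst.
  by apply: cvg_at_right_filter; exact: (parameterized_integral_cvg_left b0 fi).
have c2 : (I b - I x) @[x --> 0^'+] --> F b - F 0.
  apply: cvg_trans (cvgB (cvg_cst (F b)) F0).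
  by apply: near_eq_cvg; near=> x; near: x; apply: filterS key => x ->.
have := cvg_unique (@norm_hausdorff _ R) c1 c2; rewrite subr0; exact.
Unshelve. all: end_near. Qed.

End ftc_singular.


(** * The weight 1/w, its derivative, and the pathwise solution of the state equation *)

Section weights.
Context {R : realType}.
Notation mu := (@lebesgue_measure R).
Implicit Types (a b s t x : R).

(* [wfun] takes junk values at negative times. *)
Definition wext t : R := wfun (Num.max 0 t).
Definition ginv t : R := (wext t)^-1.
(** The derivative of [ginv] at positive times, of order [t ^ (-1/2)] near 0. At nonpositive times
    [wext t = 1], and [0^-1 = 0] gives the value 0. *)
Definition gder t : R := theta / (wext t * (1 - wext t)).
(** The feedback rate [c0 / ||X t||]: the optimal drift is [- krate t * X t]. *)
Definition krate t : R := theta / (1 - wext t).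

Lemma wextE t : 0 <= t -> wext t = wfun t.
Proof. by move=> t0; rewrite /wext max_r. Qed.

Lemma wext_bnd t : 0 < wext t <= 1.
Proof. by have [] := @wfunP R (Num.max 0 t); rewrite ?le_max ?lexx// => -> ->. Qed.

Lemma wext_lt1 t : 0 < t -> wext t < 1.
Proof. by move=> t0; rewrite wextE ?ltW// wfun_lt1. Qed.

Lemma wext_le0 t : t <= 0 -> wext t = 1.
Proof. by move=> t0; rewrite /wext max_l// wfun0. Qed.

Lemma wext_le s t : s <= t -> wext t <= wext s.
Proof.
rewrite le_eqVlt => /predU1P[->//|st].
have [s0|s0] := leP s 0.
  by rewrite (wext_le0 s0); case/andP: (wext_bnd t).
by rewrite !wextE ?ltW// ?wfun_lt// ?ltW// (lt_trans s0).
Qed.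

Lemma is_derive_wext t : 0 < t ->
  is_derive t 1 wext (- (krate t * wext t)).
Proof.
move=> t0; have := is_derive_wfun t0.
rewrite /krate -mulrAC wextE ?ltW// => dw.
have e : \forall y \near t, wfun y = wext y.
  by near=> y; rewrite wextE// ltW//; near: y; exact: lt_nbhsr.
exact: near_eq_is_derive dw.
Unshelve. all: end_near. Qed.

Lemma continuous_wext : continuous wext.
Proof.
move=> t; have [t0|t0] := ltP 0 t.
  apply/differentiable_continuous/derivable1_diffP.
  by case: (is_derive_wext t0).
apply/cvgrPdist_lt => e e0; rewrite (wext_le0 t0).
(* At 0 the derivative is infinite, so continuity comes from the inverse: [wfun] stays above
   [1 - e1] up to the time [tfun (1 - e1)]. The cap 1/2 keeps [1 - e1] inside []0, 1[], where this
   time is positive. *)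
pose e1 := Num.min e 2^-1.
have e10 : 0 < e1 by rewrite lt_min e0 invr_gt0 ltr0n.
have e12 : e1 <= 2^-1 by rewrite ge_min lexx orbT.
have e1e : e1 <= e by rewrite ge_min lexx.
have h0 : 0 < tfun (1 - e1) by apply: tfun_gt0; lra.
near=> y.
have [y0|y0] := leP y 0; first by rewrite wext_le0// subrr normr0.
have yt : y < tfun (1 - e1).
  by near: y; apply: lt_nbhsl; exact: le_lt_trans h0.
have := wfun_lt (ltW y0) yt; rewrite tfunK; [|lra|lra].
rewrite wextE ?ltW// => h; have [_ h1 _] := wfunP (ltW y0).
by rewrite ger0_norm ?subr_ge0//; lra.
Unshelve. all: end_near. Qed.

Lemma ginv_ge1 t : 1 <= ginv t.
Proof. by have /andP[h1 h2] := wext_bnd t; rewrite invr_ge1// unitf_gt0. Qed.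

Lemma ginv_le s t : s <= t -> ginv s <= ginv t.
Proof.
move=> st; have /andP[h1 _] := wext_bnd t; have /andP[h2 _] := wext_bnd s.
by rewrite /ginv lef_pV2 ?posrE// wext_le.
Qed.

Lemma continuous_ginv : continuous ginv.
Proof.
move=> t; apply: cvgV; last exact: continuous_wext.
by have /andP[h1 _] := wext_bnd t; rewrite gt_eqF.
Qed.

Lemma gder_ge0 t : 0 <= gder t.
Proof.
have /andP[h1 h2] := wext_bnd t; rewrite /gder divr_ge0// ?(ltW theta_gt0)//.
by rewrite mulr_ge0 ?subr_ge0// ltW.
Qed.

Lemma krateE t : krate t = wext t * gder t.
Proof.
have /andP[h1 _] := wext_bnd t; rewrite /krate /gder invfM.
by rewrite mulrCA (mulrA (wext t)) divff ?mul1r ?gt_eqF.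
Qed.

Lemma krate_ge0 t : 0 <= krate t.
Proof. by rewrite krateE mulr_ge0 ?gder_ge0// ltW//; case/andP: (wext_bnd t). Qed.

Lemma krate_le t : krate t <= gder t.
Proof.
rewrite krateE -[leRHS]mul1r ler_wpM2r ?gder_ge0//.
by case/andP: (wext_bnd t).
Qed.

Lemma is_derive_ginv t : 0 < t -> is_derive t 1 ginv (gder t).
Proof.
move=> t0; have := is_derive_wext t0 => dw.
have /andP[h1 _] := wext_bnd t; have h2 := wext_lt1 t0.
have w0 : wext t != 0 by rewrite gt_eqF.
have w1 : 1 - wext t != 0 by rewrite gt_eqF// subr_gt0.
have := @is_deriveV R wext t _ 1 w0 dw; rewrite /GRing.scale/=.
suff -> : - wext t ^- 2 * - (krate t * wext t) = gder t by [].
by rewrite /krate /gder; field; rewrite w0 w1.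
Qed.

Lemma continuous_gder t : 0 < t -> {for t, continuous gder}.
Proof.
move=> t0; have /andP[h1 _] := wext_bnd t; have h2 := wext_lt1 t0.
apply: cvgM; first exact: cvg_cst.
apply: cvgV; first by rewrite mulf_neq0 ?gt_eqF// subr_gt0.
apply: cvgM; first exact: continuous_wext.
by apply: cvgB; [exact: cvg_cst|exact: continuous_wext].
Qed.

Lemma measurable_wext : measurable_fun setT wext.
Proof. by apply: continuous_measurable_fun; exact: continuous_wext. Qed.

Lemma measurable_ginv : measurable_fun setT ginv.
Proof. by apply: continuous_measurable_fun; exact: continuous_ginv. Qed.

Lemma measurable_gder : measurable_fun setT gder.
Proof.
rewrite (_ : setT = `]-oo, 0] `|` `]0, +oo[)%classic; last first.
  by rewrite -itv_bndbnd_setU// set_itvE.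
apply/measurable_funU => //; split.
  apply: eq_measurable_fun (measurable_cst (0 : R)) => x; rewrite inE/= in_itv/= => x0.
  by rewrite /gder wext_le0// subrr mulr0 invr0 mulr0.
apply: open_continuous_measurable_fun; first exact: interval_open.
by move=> x; rewrite inE/= in_itv/= andbT; exact: continuous_gder.
Qed.

(** The singularity at 0 is harmless because [gder] is nonnegative and its primitive [ginv] is
    continuous at 0. *)
Lemma integrable_gder t : mu.-integrable `[0, t] (EFin \o gder).
Proof.
have h a : 0 < a -> mu.-integrable `[0, a] (EFin \o gder).
  move=> a0; apply: (ge0_FTC2_integrable a0 (F := ginv)).
  - by apply: cvg_at_right_filter; exact: continuous_ginv.
  - exact: is_derive_ginv.
  - exact: continuous_gder.
  - by move=> *; exact: gder_ge0.
have [t0|t0] := ltP 0 t; first exact: h.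
apply: integrableS (h 1 ltr01) => // x /=; rewrite !in_itv/= => /andP[-> xt].
by rewrite (le_trans xt)// (le_trans t0).
Qed.

Lemma Rintegral_gder a b : 0 <= a -> a <= b ->
  \int[mu]_(x in `]a, b]) gder x = ginv b - ginv a.
Proof.
have h t : 0 <= t -> \int[mu]_(x in `[0, t]) gder x = ginv t - ginv 0.
  rewrite le_eqVlt => /predU1P[<-|t0].
    by rewrite set_itv1 Rintegral_set1 subrr.
  apply: FTC2_singular => //.
  - by apply: cvg_at_right_filter; exact: continuous_ginv.
  - exact: is_derive_ginv.
  - exact: continuous_gder.
  - exact: integrable_gder.
move=> a0 ab.
rewrite -(@Rintegral_itvB _ _ (BLeft 0))//; last exact: integrable_gder.
by rewrite !h//; [lra|exact: le_trans ab].
Qed.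


Definition Jint (b : R -> R) t : R := \int[mu]_(x in `[0, t]) (b x * gder x).
(** [wext t] times the integral by parts of [ginv] against [db]; the factor cancels the [ginv t] in
    front of [b t]. *)
Definition Xpath (b : R -> R) t : R := b t - wext t * Jint b t.

(** A continuous path is bounded on [[0, t]], so a multiple of [gder] dominates. In the uses, [h] is
    [gder] or [krate]. *)
Lemma integrable_mul_gder (b h : R -> R) t : continuous b ->
  measurable_fun setT h -> (forall x, `|h x| <= gder x) ->
  mu.-integrable `[0, t] (EFin \o (fun x => b x * h x)).
Proof.
move=> cb mh hg.
have [t0|t0] := leP 0 t; last first.
  rewrite set_itv_ge ?bnd_simp; first exact: integrable_set0.
  by rewrite -ltNge.
have cn : {within `[0, t], continuous (fun x => `|b x|)}.
  apply: continuous_subspaceT => x; apply: cvg_norm; exact: cb.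
have [c _ hc] := EVT_max t0 cn.
have ig : mu.-integrable `[0, t] (fun x => (`|b c|%:E * (gder x)%:E)%E).
  by apply: integrableZl => //; exact: integrable_gder.
apply: le_integrable ig => //.
  apply/measurable_EFinP/measurable_funTS; apply: measurable_funM => //.
  exact: continuous_measurable_fun.
move=> x xt; rewrite /= lee_fin normrM.
rewrite [leRHS]ger0_norm; last by apply: mulr_ge0; [|exact: gder_ge0].
by apply: ler_pM => //; exact: hc.
Qed.

Lemma Jint_le0 (b : R -> R) t : t <= 0 -> Jint b t = 0.
Proof.
rewrite le_eqVlt => /predU1P[->|t0]; rewrite /Jint.
  by rewrite set_itv1 Rintegral_set1.
by rewrite set_itv_ge ?Rintegral_set0// bnd_simp -ltNge.
Qed.

Lemma norm_gder x : `|gder x| <= gder x.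
Proof. by rewrite ger0_norm ?gder_ge0. Qed.

Lemma is_derive_Jint (b : R -> R) t : continuous b -> 0 < t ->
  is_derive t 1 (Jint b) (b t * gder t).
Proof.
move=> cb t0.
have i1 := integrable_mul_gder (t + 1) cb measurable_gder norm_gder.
have tt : t < t + 1 by rewrite ltrDl.
have [|d1 d2] := continuous_FTC1_closed tt i1 t0.
  by apply: cvgM; [exact: cb|exact: continuous_gder].
rewrite -d2 derive1E; exact: derivableP.
Qed.

Lemma continuous_Jint (b : R -> R) : continuous b -> continuous (Jint b).
Proof.
move=> cb t; have [t0|t0|->] := ltgtP t 0.
- rewrite /continuous_at Jint_le0 ?ltW//.
  apply: cvg_near_cst; near=> x.
  by rewrite Jint_le0// ltW//; near: x; exact: lt_nbhsl.
- apply/differentiable_continuous/derivable1_diffP.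
  by case: (is_derive_Jint cb t0).
- rewrite /continuous_at Jint_le0//.
  apply: (parameterized_integral_cvg_left ltr01).
  by apply: integrable_mul_gder => //; [exact: measurable_gder|exact: norm_gder].
Unshelve. all: end_near. Qed.

Lemma continuous_Xpath (b : R -> R) : continuous b -> continuous (Xpath b).
Proof.
move=> cb t; apply: cvgB; first exact: cb.
by apply: cvgM; [exact: continuous_wext|exact: continuous_Jint].
Qed.

Lemma measurable_krate : measurable_fun setT krate.
Proof.
rewrite (_ : krate = fun t => wext t * gder t); last exact/funext/krateE.
by apply: measurable_funM; [exact: measurable_wext|exact: measurable_gder].
Qed.

Lemma integrable_krate_Xpath (b : R -> R) t : continuous b ->
  mu.-integrable `[0, t] (EFin \o (fun x => Xpath b x * krate x)).
Proof.
move=> cb; apply: integrable_mul_gder.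
- exact: continuous_Xpath.
- exact: measurable_krate.
- by move=> x; rewrite ger0_norm ?krate_ge0// krate_le.
Qed.

(** The subtracted term [wext * Jint b] has derivative [- krate * wext * Jint b + wext * b * gder],
    which is [krate * Xpath b] because [krate = wext * gder]. *)
Lemma XpathE (b : R -> R) t : continuous b -> 0 <= t ->
  Xpath b t = b t - \int[mu]_(x in `[0, t]) (Xpath b x * krate x).
Proof.
move=> cb; rewrite le_eqVlt => /predU1P[<-|t0].
  by rewrite /Xpath Jint_le0// set_itv1 Rintegral_set1 mulr0.
pose F x := wext x * Jint b x.
have -> : \int[mu]_(x in `[0, t]) (Xpath b x * krate x) = F t - F 0.
  apply: FTC2_singular => //.
  - apply: cvg_at_right_filter.
    by apply: cvgM; [exact: continuous_wext|exact: continuous_Jint].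
  - move=> x x0; have dw := is_derive_wext x0; have dJ := is_derive_Jint cb x0.
    have := is_deriveM dw dJ; rewrite /GRing.scale/=.
    set D := (X in is_derive _ _ _ X); suff -> : D = Xpath b x * krate x by [].
    by rewrite /D /Xpath krateE; ring.
  - move=> x x0; apply: cvgM; first exact: continuous_Xpath.
    apply: cvgM; first exact: cvg_cst.
    have h2 := wext_lt1 x0.
    apply: cvgV; first by rewrite gt_eqF// subr_gt0.
    by apply: cvgB; [exact: cvg_cst|exact: continuous_wext].
  - exact: integrable_krate_Xpath.
by rewrite /F (Jint_le0 _ (lexx 0)) mulr0 subr0.
Qed.

End weights.


(** * Square-integrable functions *)

Section square_integrable.
Context d (T : measurableType d) (R : realType).
Variables (mu : {measure set T -> \bar R}) (D : set T).
Hypothesis mD : measurable D.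
Implicit Types f g h : T -> R.

(** Functions rather than classes, on a domain [D]: the same calculus then serves [P] on the sample
    space and [dt x P] on a strip. *)
Definition sqint f : Prop :=
  measurable_fun D f /\ mu.-integrable D (EFin \o (fun x => f x ^+ 2)).

Definition ip f g : R := \int[mu]_(x in D) (f x * g x).

Lemma sqint_mul f g : sqint f -> sqint g ->
  mu.-integrable D (EFin \o (fun x => f x * g x)).
Proof.
move=> [mf sf] [mg sg].
apply: (le_integrable mD _ _ (integrableD mD sf sg)).
  by apply/measurable_EFinP; exact: measurable_funM.
move=> x _ /=; rewrite lee_fin [leRHS]ger0_norm ?addr_ge0 ?sqr_ge0//.
rewrite ler_norml; apply/andP; split.
  have := sqr_ge0 (f x + g x); have := sqr_ge0 (f x); have := sqr_ge0 (g x); nra.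
have := sqr_ge0 (f x - g x); have := sqr_ge0 (f x); have := sqr_ge0 (g x); nra.
Qed.

Lemma sqint_le f g : measurable_fun D f -> sqint g ->
  (forall x, D x -> `|f x| <= `|g x|) -> sqint f.
Proof.
move=> mf [mg sg] fg; split => //; apply: (le_integrable mD _ _ sg).
  by apply/measurable_EFinP; exact: measurable_funX.
move=> x Dx /=; rewrite lee_fin !ger0_norm ?sqr_ge0// -real_normK ?num_real//.
rewrite -[leRHS]real_normK ?num_real// ler_sqr ?nnegrE//; exact: fg.
Qed.

Lemma sqintZ k f : sqint f -> sqint (fun x => k * f x).
Proof.
move=> [mf sf]; split; first exact: measurable_funM.
have -> : (EFin \o (fun x => (k * f x) ^+ 2)) =
    (fun x => (k ^+ 2)%:E * (f x ^+ 2)%:E)%E.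
  by apply/funext => x /=; rewrite -EFinM exprMn.
exact: integrableZl.
Qed.

Lemma sqintD f g : sqint f -> sqint g -> sqint (fun x => f x + g x).
Proof.
move=> hf hg; have fg := sqint_mul hf hg.
move: hf hg => [mf sf] [mg sg]; split; first exact: measurable_funD.
have -> : (EFin \o (fun x => (f x + g x) ^+ 2)) =
    ((fun x => (f x ^+ 2)%:E) \+
     ((fun x => (g x ^+ 2)%:E) \+ (fun x => 2%:E * (f x * g x)%:E)))%E.
  by apply/funext => x /=; rewrite -!EFinM -!EFinD; congr EFin; ring.
by do 2 apply: integrableD => //; exact: integrableZl.
Qed.

Lemma sqintN f : sqint f -> sqint (fun x => - f x).
Proof.
by move=> /(sqintZ (-1)); congr sqint; apply/funext => x; rewrite mulN1r.
Qed.

Lemma sqintB f g : sqint f -> sqint g -> sqint (fun x => f x - g x).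
Proof. by move=> hf /sqintN; exact: sqintD. Qed.

Lemma sqint0 : sqint (fun=> 0).
Proof.
split; first exact: measurable_cst.
by apply: (eq_integrable mD (cst 0)) => [x _ /=|]; [rewrite expr0n|exact: integrable0].
Qed.

Lemma sqint_sum (I : Type) (s : seq I) (f : I -> T -> R) :
  (forall i, sqint (f i)) -> sqint (fun x => \sum_(i <- s) f i x).
Proof.
move=> hf; elim: s => [|i s IH].
  by under eq_fun do rewrite big_nil; exact: sqint0.
by under eq_fun do rewrite big_cons; exact: sqintD.
Qed.

Lemma ipC f g : ip f g = ip g f.
Proof. by apply: eq_Rintegral => x _; rewrite mulrC. Qed.

Lemma ipDl f g h : sqint f -> sqint g -> sqint h ->
  ip (fun x => f x + g x) h = ip f h + ip g h.
Proof.
move=> hf hg hh; rewrite /ip -RintegralD//; try exact: sqint_mul.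
by apply: eq_Rintegral => x _; rewrite mulrDl.
Qed.

Lemma ipZl k f h : sqint f -> sqint h -> ip (fun x => k * f x) h = k * ip f h.
Proof.
move=> hf hh; rewrite /ip -RintegralZl//; try exact: sqint_mul.
by apply: eq_Rintegral => x _; rewrite mulrA.
Qed.

Lemma ipBl f g h : sqint f -> sqint g -> sqint h ->
  ip (fun x => f x - g x) h = ip f h - ip g h.
Proof.
move=> hf hg hh; rewrite /ip -RintegralB//; try exact: sqint_mul.
by apply: eq_Rintegral => x _; rewrite mulrBl.
Qed.

Lemma ip0l h : ip (fun=> 0) h = 0.
Proof.
rewrite /ip; under eq_Rintegral do rewrite mul0r.
by rewrite /Rintegral integral0.
Qed.

Lemma ip_suml (I : Type) (s : seq I) (f : I -> T -> R) h :
  (forall i, sqint (f i)) -> sqint h ->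
  ip (fun x => \sum_(i <- s) f i x) h = \sum_(i <- s) ip (f i) h.
Proof.
move=> hf hh; elim: s => [|i s IH].
  by under eq_fun do rewrite big_nil; rewrite ip0l big_nil.
under eq_fun do rewrite big_cons.
by rewrite ipDl ?IH ?big_cons//; exact: sqint_sum.
Qed.

Lemma ip_ge0 f : 0 <= ip f f.
Proof. by apply: Rintegral_ge0 => x _; rewrite -expr2 sqr_ge0. Qed.

Lemma ipBB f g : sqint f -> sqint g ->
  ip (fun x => f x - g x) (fun x => f x - g x) = ip f f - 2 * ip f g + ip g g.
Proof.
move=> hf hg; rewrite ipBl//; last exact: sqintB.
rewrite [ip f (fun=> _)]ipC [ip g (fun=> _)]ipC !ipBl//.
by rewrite (ipC g f); ring.
Qed.

Lemma Cauchy_Schwarz f g : sqint f -> sqint g -> ip f g ^+ 2 <= ip f f * ip g g.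
Proof.
move=> hf hg.
have q k : 0 <= ip f f - 2 * k * ip f g + k ^+ 2 * ip g g.
  have hk := sqintZ k hg.
  have := ip_ge0 (fun x => f x - k * g x); rewrite ipBB//.
  rewrite (ipC f (fun x => k * g x)) !ipZl// (ipC g (fun x => k * g x)) ipZl//.
  rewrite (ipC g f).
  by congr (_ <= _); ring.
have [g0|g0] := eqVneq (ip g g) 0.
  rewrite g0 mulr0; have [->|fg0] := eqVneq (ip f g) 0; first by rewrite expr0n.
  (* When [ip g g = 0] the quadratic is affine in [k] with nonzero slope; this [k] gives it the
     value -1. *)
  have := q ((ip f f + 1) / (2 * ip f g)); rewrite g0 mulr0 addr0.
  suff -> : ip f f - 2 * ((ip f f + 1) / (2 * ip f g)) * ip f g = -1 by lra.
  by field.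
have gp : 0 < ip g g by rewrite lt_neqAle eq_sym g0 ip_ge0.
have := q (ip f g / ip g g).
have -> : ip f f - 2 * (ip f g / ip g g) * ip f g + (ip f g / ip g g) ^+ 2 * ip g g =
  (ip f f * ip g g - ip f g ^+ 2) / ip g g by field.
by rewrite pmulr_lge0 ?invr_gt0// subr_ge0.
Qed.

Definition sqdist f g : \bar R := (\int[mu]_(x in D) ((f x - g x) ^+ 2)%:E)%E.

Lemma sqdistE f g : sqint f -> sqint g ->
  sqdist f g = (ip (fun x => f x - g x) (fun x => f x - g x))%:E.
Proof.
move=> hf hg; have [_ h] := sqintB hf hg.
rewrite /ip /Rintegral fineK; last exact: (integrable_fin_num mD (sqint_mul (sqintB hf hg) (sqintB hf hg))).
by apply: eq_integral => x _; rewrite expr2.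
Qed.

(** One index [N] with finite distance is enough: [f] is the difference of [f_ N] and [f_ N - f]. *)
Lemma sqint_lim (f_ : nat -> T -> R) f : (forall n, sqint (f_ n)) ->
  measurable_fun D f -> sqdist (f_ n) f @[n --> \oo] --> 0%E -> sqint f.
Proof.
move=> hf mf cf.
have /fine_cvgP[[N _ /(_ N (leqnn _))/= h] _] := cf.
have hd : sqint (fun x => f_ N x - f x).
  split; first by apply: measurable_funB => //; case: (hf N).
  apply/integrableP; split.
    apply/measurable_EFinP; apply: measurable_funX.
    by apply: measurable_funB => //; case: (hf N).
  under eq_integral do rewrite /= ger0_norm ?sqr_ge0//.
  by move: h; rewrite ge0_fin_numE//; apply: integral_ge0 => x _; rewrite lee_fin sqr_ge0.
have := sqintB (hf N) hd; congr sqint; apply/funext => x /=; lra.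
Qed.

Lemma ip_cvg (f_ : nat -> T -> R) f g : (forall n, sqint (f_ n)) ->
  sqint f -> sqint g -> sqdist (f_ n) f @[n --> \oo] --> 0%E ->
  ip (f_ n) g @[n --> \oo] --> ip f g.
Proof.
move=> hfn hf hg; under eq_cvg do rewrite sqdistE//.
move=> /fine_cvgP[_] /= cf.
have c0 : (ip (f_ n) g - ip f g) ^+ 2 @[n --> \oo] --> (0 : R).
  apply: (@squeeze_cvgr _ _ _ _ (fun=> 0)
    (fun n => ip (fun x => f_ n x - f x) (fun x => f_ n x - f x) * ip g g)).
  - apply: nearW => n; rewrite sqr_ge0/= -ipBl//.
    by apply: Cauchy_Schwarz => //; exact: sqintB.
  - exact: cvg_cst.
  - by rewrite -(mul0r (ip g g)); apply: cvgM => //; exact: cvg_cst.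
apply/cvgrPdist_lt => e e0.
move/cvgrPdist_lt : c0 => /(_ (e ^+ 2) (exprn_gt0 _ e0)); apply: filterS => n.
rewrite sub0r normrN ger0_norm ?sqr_ge0// => h; rewrite distrC.
by rewrite -ltr_sqr ?nnegrE// ?(ltW e0)// real_normK ?num_real.
Qed.

(** Expanding the squared distance writes [ip (f_ n) (f_ n)] as that distance plus
    [2 * ip (f_ n) f - ip f f], to which [ip_cvg] applies. *)
Lemma sqnorm_cvg (f_ : nat -> T -> R) f : (forall n, sqint (f_ n)) ->
  sqint f -> sqdist (f_ n) f @[n --> \oo] --> 0%E ->
  ip (f_ n) (f_ n) @[n --> \oo] --> ip f f.
Proof.
move=> hfn hf cf; have c1 := ip_cvg hfn hf hf cf.
have c2 : fine (sqdist (f_ n) f) @[n --> \oo] --> (0 : R).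
  by apply/fine_cvg; exact: cf.
have -> : (fun n => ip (f_ n) (f_ n)) =
    (fun n => fine (sqdist (f_ n) f) + (2 * ip (f_ n) f - ip f f)).
  by apply/funext => n; rewrite sqdistE//= ipBB//; ring.
have e : 0 + (2 * ip f f - ip f f) = ip f f by ring.
rewrite -[X in _ --> X]e; apply: cvgD => //; apply: cvgB; last exact: cvg_cst.
by apply: cvgM => //; exact: cvg_cst.
Qed.

End square_integrable.


(** * Independence and Gaussian moments *)

Section independence.
Context d (T : measurableType d) (R : realType) (P : probability T R).
Variables (X Y : T -> R).
Hypotheses (mX : measurable_fun setT X) (mY : measurable_fun setT Y).
Hypothesis indep : forall A B : set R, measurable A -> measurable B ->
  P (X @^-1` A `&` Y @^-1` B) = (P (X @^-1` A) * P (Y @^-1` B))%E.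

Let mX_mixin := isMeasurableFun.Build _ _ _ _ _ mX.
Let X' : {mfun T >-> R} := HB.pack X mX_mixin.
Let mY_mixin := isMeasurableFun.Build _ _ _ _ _ mY.
Let Y' : {mfun T >-> R} := HB.pack Y mY_mixin.
Let XY x := (X x, Y x).
Let mXY : measurable_fun setT XY.
Proof. exact: measurable_fun_pair. Qed.
Let mXY_mixin := isMeasurableFun.Build _ _ _ _ _ mXY.
Let XY' : {mfun T >-> (R * R)%type} := HB.pack XY mXY_mixin.

(** Independence says that the joint law and the product of the marginal laws agree on rectangles,
    which determine a product measure. Expectations of products are then a matter of Fubini. *)
Let law_eq (E : set (R * R)) : measurable E ->
  (distribution P X' \x distribution P Y')%E E = distribution P XY' E.
Proof. by move=> mE; apply: product_measure_unique => // A B; exact: indep. Qed.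

Hypotheses (iX : P.-integrable setT (EFin \o X))
  (iY : P.-integrable setT (EFin \o Y)).

Let mmul : measurable_fun setT (fun z : R * R => z.1 * z.2).
Proof. by apply: measurable_funM; [exact: measurable_fst|exact: measurable_snd]. Qed.

Lemma integrable_indep : P.-integrable setT (EFin \o (fun x => X x * Y x)).
Proof.
apply/integrableP; split; first exact/measurable_EFinP/measurable_funM.
have -> : (\int[P]_x `|(EFin \o (fun x => (X x * Y x)%R)) x| =
  \int[distribution P XY']_z `|(z.1 * z.2)%R%:E|)%E.
  by rewrite ge0_integral_distribution//; apply: measurableT_comp => //; exact/measurable_EFinP.
rewrite (eq_measure_integral (distribution P X' \x distribution P Y')%E); last first.
  by move=> A mA _; apply: esym; exact: law_eq.
rewrite fubini_tonelli1//; last by apply: measurableT_comp => //; exact/measurable_EFinP.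
rewrite /fubini_F/=.
have mn : measurable_fun setT (fun x : R => `|x|%:E).
  by apply/measurable_EFinP; exact: normr_measurable.
under eq_integral => x _.
  under eq_integral do rewrite normrM EFinM.
  rewrite ge0_integralZl//; over.
rewrite /= ge0_integralZr//; last exact: integral_ge0.
rewrite !ge0_integral_distribution//.
have [_ hx] := integrableP _ _ _ iX; have [_ hy] := integrableP _ _ _ iY.
have x0 : (0 <= \int[P]_x `|(EFin \o X) x|)%E by exact: integral_ge0.
by apply: lte_mul_pinfty => //; rewrite ge0_fin_numE.
Qed.

Lemma Rintegral_indep :
  \int[P]_x (X x * Y x) = \int[P]_x X x * \int[P]_x Y x.
Proof.
have i1 := integrable_indep.
have mf : measurable_fun setT (fun z : R * R => (z.1 * z.2)%R%:E).
  exact/measurable_EFinP.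
have ip : (distribution P X' \x distribution P Y')%E.-integrable setT (fun z : R * R => (z.1 * z.2)%R%:E).
  have : (distribution P XY').-integrable setT (fun z : R * R => (z.1 * z.2)%R%:E).
    exact: integrable_pushforward.
  move=> /integrableP[_ h]; apply/integrableP; split => //.
  by rewrite (eq_measure_integral (distribution P XY'))// => A mA _; exact: law_eq.
have e1 : (\int[P]_x (X x * Y x)%:E = \int[distribution P XY']_z (z.1 * z.2)%:E)%E.
  by rewrite integral_distribution.
have e2 : (\int[distribution P XY']_z (z.1 * z.2)%:E =
  \int[(distribution P X' \x distribution P Y')]_z (z.1 * z.2)%:E)%E.
  by apply: eq_measure_integral => A mA _; apply: esym; exact: law_eq.
have iX' : (distribution P X').-integrable setT EFin by exact: integrable_pushforward.
have iY' : (distribution P Y').-integrable setT EFin by exact: integrable_pushforward.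
have eX : (\int[distribution P X']_z z%:E = \int[P]_x (X x)%:E)%E.
  by rewrite integral_distribution.
have eY : (\int[distribution P Y']_z z%:E = \int[P]_x (Y x)%:E)%E.
  by rewrite integral_distribution.
rewrite /Rintegral e1 e2 -integral12_prod_meas1// /fubini_F/=.
under eq_integral => x _.
  under eq_integral do rewrite EFinM.
  rewrite integralZl// eY.
  over.
rewrite /=.
have fY : (\int[P]_x (Y x)%:E)%E \is a fin_num by exact: integrable_fin_num.
have fX : (\int[P]_x (X x)%:E)%E \is a fin_num by exact: integrable_fin_num.
rewrite -(fineK fY) integralZr// eX fineK// fineM//.
Qed.

End independence.

(** * From vanishing integrals over events to orthogonality against measurable functions *)

Section orthogonality.
Context d (T : measurableType d) (R : realType) (mu : {measure set T -> \bar R}).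
Variables (G : set (set T)) (D : T -> R).
Hypothesis mG : <<s G >> `<=` measurable.
Hypothesis iD : mu.-integrable setT (EFin \o D).
Hypothesis D0 : forall A, <<s G >> A -> (\int[mu]_(x in A) (D x)%:E = 0)%E.
Local Notation TG := (g_sigma_algebraType G).

Lemma sub_measurable_fun d' (U : measurableType d') (f : TG -> U) :
  measurable_fun setT f -> measurable_fun setT (f : T -> U).
Proof.
move=> mf _ Y mY; apply: mG; have := mf measurableT Y mY; exact.
Qed.

Import HBNNSimple.

(** The approximations of [f] by simple functions increase, so [f * D] dominates [h n * D] in
    absolute value whatever the sign of [D]. *)
Let ge0_orth (f : TG -> R) : measurable_fun setT f -> (forall x, 0 <= f x) ->
  mu.-integrable setT (EFin \o (fun x => f x * D x)) ->
  (\int[mu]_x (f x * D x)%:E = 0)%E.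
Proof.
move=> mf f0 ifD.
have mEf : measurable_fun setT (EFin \o f) by exact/measurable_EFinP.
(* The approximation is taken in the coarse structure [TG], so the level sets of [h n] are events on
   which [D0] applies. *)
pose h := nnsfun_approx (@measurableT _ TG) mEf.
have hf n x : h n x <= f x.
  have c := @cvg_nnsfun_approx _ _ _ _ (@measurableT _ TG) _ mEf (fun x _ => f0 x) x I.
  have c' : (fun n => h n x) n @[n --> \oo] --> f x by exact: (fine_cvg c).
  rewrite -(cvg_lim (@norm_hausdorff _ R) c').
  apply: (nondecreasing_cvgn_le (u_ := fun n => h n x)); last by apply/cvg_ex; exists (f x).
  by move=> m k mk; exact/lefP/nd_nnsfun_approx.
have mhn n : measurable_fun setT (h n : T -> R).
  by apply: sub_measurable_fun; exact: measurable_funP.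
have mD : measurable_fun setT D by apply/measurable_EFinP; case/integrableP: iD.
have zero n : (\int[mu]_x (h n x * D x)%:E = 0)%E.
  have [s hs] : exists s : seq R, forall x, h n x = \sum_(y <- s) y * \1_(h n @^-1` [set y]) x.
    exists (finmap.enum_fset (fset_set (range (h n)))) => x.
    by rewrite {1}(fimfunE (h n) x) fsbig_finite.
  have -> : (fun x => (h n x * D x)%:E) =
    (fun x => \sum_(y <- s) (y%:E * (\1_(h n @^-1` [set y]) x * D x)%:E))%E.
    apply/funext => x; rewrite hs mulr_suml -sumEFin; apply: eq_bigr => y _.
    by rewrite -EFinM mulrA.
  have mA y : measurable (h n @^-1` [set y] : set T).
    by rewrite -[_ @^-1` _]setTI; apply: mhn.
  have i1 y : mu.-integrable setT (fun x => (\1_(h n @^-1` [set y]) x * D x)%:E).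
    apply: (le_integrable measurableT _ _ iD).
      by apply/measurable_EFinP; apply: measurable_funM => //; exact: measurable_indic.
    move=> x _ /=; rewrite lee_fin normrM indicE.
    by case: (_ \in _); rewrite ?normr1 ?mul1r// normr0 mul0r.
  rewrite integral_sum//; last by move=> y; exact: integrableZl.
  apply: big1 => y _; rewrite integralZl//.
  suff -> : (\int[mu]_x (\1_(h n @^-1` [set y]) x * D x)%:E = 0)%E by rewrite mule0.
  rewrite -[RHS](D0 (A := h n @^-1` [set y])); last first.
    exact: (measurable_sfunP (h n) (measurable_set1 y)).
  rewrite [RHS]integral_mkcond; apply: eq_integral => x _.
  rewrite /patch indicE; case: (_ \in _); by rewrite ?mul1r ?mul0r.
have mf' : measurable_fun setT (f : T -> R) by exact: sub_measurable_fun.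
have mhD n : measurable_fun setT (fun x : T => (h n x * D x)%:E).
  by apply/measurable_EFinP; exact: measurable_funM.
have mfD : measurable_fun setT (fun x : T => (f x * D x)%:E).
  by apply/measurable_EFinP; exact: measurable_funM.
have cv (x : T) : (h n x * D x)%:E @[n --> \oo] --> (f x * D x)%:E.
  have c := @cvg_nnsfun_approx _ _ _ _ (@measurableT _ TG) _ mEf (fun x _ => f0 x) x I.
  apply: cvg_EFin; first exact: nearW.
  by apply: cvgM; [exact: (fine_cvg c)|exact: cvg_cst].
have dom (x : T) n : (`|(h n x * D x)%:E| <= `|(f x * D x)%:E|)%E.
  rewrite lee_fin !normrM ler_wpM2r// !ger0_norm//.
have [_ _] := dominated_convergence measurableT mhD mfD
  (@nearW _ _ _ _ (fun x _ => cv x)) (integrable_abse ifD) (@nearW _ _ _ _ (fun x n _ => dom x n)).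
have -> : [sequence (\int[mu]_x (h n x * D x)%:E)%E]_n = (fun=> 0)%E.
  by apply/funext => n; exact: zero.
by move=> c; apply: (cvg_unique _ c (cvg_cst _)); exact: ereal_hausdorff.
Qed.

(** In the uses [D] is the difference between a terminal value and its conditional expectation, or
    between two conditional expectations. Integrability of [f * D] replaces boundedness of [f]. *)
Lemma orth (f : TG -> R) : measurable_fun setT f ->
  mu.-integrable setT (EFin \o (fun x => f x * D x)) ->
  \int[mu]_x (f x * D x) = 0.
Proof.
move=> mf ifD.
have mf' : measurable_fun setT (f : T -> R) by exact: sub_measurable_fun.
have mD : measurable_fun setT D by apply/measurable_EFinP; case/integrableP: iD.
have ip : mu.-integrable setT (EFin \o (fun x : T => Num.max (f x) 0 * D x)).
  apply: (le_integrable measurableT _ _ ifD).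
    apply/measurable_EFinP; apply: measurable_funM => //.
    exact: measurable_maxr.
  move=> x _ /=; rewrite lee_fin !normrM ler_wpM2r//.
  by rewrite [`|Num.max _ _|]ger0_norm ?le_max ?lexx ?orbT// ge_max ler_norm normr_ge0.
have im : mu.-integrable setT (EFin \o (fun x : T => Num.max (- f x) 0 * D x)).
  apply: (le_integrable measurableT _ _ ifD).
    apply/measurable_EFinP; apply: measurable_funM => //.
    by apply: measurable_maxr => //; exact: measurableT_comp.
  move=> x _ /=; rewrite lee_fin !normrM ler_wpM2r//.
  by rewrite [`|Num.max _ _|]ger0_norm ?le_max ?lexx ?orbT// ge_max ler_normr lexx orbT normr_ge0.
transitivity (\int[mu]_x (Num.max (f x) 0 * D x) - \int[mu]_x (Num.max (- f x) 0 * D x)).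
  rewrite -RintegralB//; apply: eq_Rintegral => x _; rewrite -mulrBl; congr (_ * _).
  by rewrite /Num.max; case: ifPn => h1; case: ifPn => h2; lra.
rewrite /Rintegral !ge0_orth ?subrr//.
- by apply: measurable_maxr => //; exact: measurableT_comp.
- by move=> x; rewrite le_max lexx orbT.
- by apply: measurable_maxr.
- by move=> x; rewrite le_max lexx orbT.
Qed.

End orthogonality.


(** * Mean and variance of the centred normal law *)

Section normal_moments.
Context {R : realType}.
Notation mu := (@lebesgue_measure R).
Implicit Types (s x : R).

(** The Radon-Nikodym density agrees almost everywhere with [normal_pdf], since both have integral
    [normal_prob m s E] over every measurable [E]. *)
Lemma ge0_integral_normal_prob m s (f : R -> \bar R) : measurable_fun setT f ->
  (forall x, 0 <= f x)%E ->
  (\int[normal_prob m s]_x f x = \int[mu]_x (f x * (normal_pdf m s x)%:E))%E.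
Proof.
move=> mf f0; have dom := @normal_prob_dominates R m s.
rewrite -(Radon_Nikodym_SigmaFinite.change_of_variables dom f0)//.
have mpdf : measurable_fun setT (fun x => (normal_pdf m s x)%:E).
  by apply/measurable_EFinP; exact: measurable_normal_pdf.
have iRN := @Radon_Nikodym_SigmaFinite.f_integrable _ _ R (normal_prob m s) mu dom.
apply: ae_eq_integral => //.
- by apply: emeasurable_funM => //; exact: measurable_int iRN.
- exact: emeasurable_funM.
- apply: ae_eqe_mul2l; apply: integral_ae_eq => //.
  by move=> E _ mE; rewrite -Radon_Nikodym_SigmaFinite.f_integral.
Qed.

Variable s : R.
Hypothesis s0 : 0 < s.
Let pdf := normal_pdf 0 s.

Let pdfE x : pdf x = normal_peak s * expR (- x ^+ 2 / (s ^+ 2 *+ 2)).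
Proof. by rewrite /pdf normal_pdfE ?gt_eqF// /normal_fun subr0. Qed.

Let is_derive_pdf x : is_derive x 1 pdf (- (x / s ^+ 2) * pdf x).
Proof.
have -> : pdf = fun x => normal_peak s * expR (- x ^+ 2 / (s ^+ 2 *+ 2)).
  by apply/funext => y; rewrite pdfE.
have s2 : s != 0 by rewrite gt_eqF.
have h : is_derive x 1 (fun x : R => - x ^+ 2 / (s ^+ 2 *+ 2)) (- (x / s ^+ 2)).
  apply: is_derive_eq; rewrite /GRing.scale/= -mulr_natr; by field.
pose g (y : R) := - y ^+ 2 / (s ^+ 2 *+ 2).
have h2 : is_derive x 1 (fun y : R => expR (g y)) (expR (g x) * - (x / s ^+ 2)).
  exact: (is_derive1_comp (g := g) (is_derive_expR (g x)) h).
rewrite -/(g x).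
apply: is_derive_eq; rewrite /GRing.scale/=; by ring.
Qed.

Let continuous_pdf : continuous pdf.
Proof. by apply: continuous_normal_pdf; rewrite gt_eqF. Qed.

Let pdf_ge0 x : 0 <= pdf x.
Proof. exact: normal_pdf_ge0. Qed.

Let I (n : nat) : set R := `[- n.+1%:R, n.+1%:R]%classic.

Let FTC_pdf (F f : R -> R) (n : nat) : (forall x, is_derive x 1 F (f x)) ->
  continuous f ->
  (\int[mu]_(x in I n) (f x)%:E = (F n.+1%:R - F (- n.+1%:R))%:E)%E.
Proof.
move=> dF cf; have n0 : - n.+1%:R < n.+1%:R :> R by rewrite gtrN.
have cF x : {for x, continuous F}.
  by apply/differentiable_continuous/derivable1_diffP; case: (dF x).
rewrite EFinB; apply: continuous_FTC2 => //.
- exact: continuous_subspaceT.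
- by split; [move=> x _; case: (dF x)|apply: cvg_at_right_filter; exact: cF|apply: cvg_at_left_filter; exact: cF].
- by move=> x _; rewrite derive1E; have := dF x => ?; exact: derive_val.
Qed.

Let bigcupI : \bigcup_n I n = setT.
Proof.
apply/seteqP; split=> // x _; exists (Num.truncn `|x|) => //.
rewrite /I/= in_itv/= -ler_norml; apply: ltW.
exact: truncnS_gt.
Qed.

Let ndI : {homo I : n m / (n <= m)%N >-> (n <= m)%O}.
Proof.
move=> n m nm; apply/subsetPset => x; rewrite /I/= !in_itv/= -!ler_norml => h.
by apply: le_trans h _; rewrite ler_nat.
Qed.

Let cvg_int (f : R -> R) : continuous f -> (forall x, 0 <= f x) ->
  (\int[mu]_(x in I n) (f x)%:E)%E @[n --> \oo] --> (\int[mu]_x (f x)%:E)%E.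
Proof.
move=> cf f0; rewrite -bigcupI; apply: ge0_nondecreasing_set_cvg_integral => //.
- by move=> n; exact: measurable_itv.
- by move=> n; apply/measurable_EFinP/measurable_funTS; exact: continuous_measurable_fun.
- by move=> n x _; rewrite lee_fin.
Qed.

(** The boundary term of the integration by parts. [expR (- z) <= z^-1] bounds it by a multiple of
    [1 / n.+1]. *)
Let n_pdf_cvg0 : (n.+1%:R * pdf n.+1%:R) @[n --> \oo] --> (0 : R).
Proof.
have s2 : s != 0 by rewrite gt_eqF.
apply: (@squeeze_cvgr _ _ _ _ (fun=> 0)
   (fun n : nat => (normal_peak s * (s ^+ 2 *+ 2)) * n.+1%:R^-1)).
- apply: nearW => n; rewrite mulr_ge0//=.
  have N0 : 0 < n.+1%:R :> R by [].
  move: N0; set N := n.+1%:R => N0.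
  rewrite pdfE mulrCA -mulrA ler_wpM2l ?normal_peak_ge0//.
  have c0 : 0 < s ^+ 2 *+ 2 by rewrite pmulrn_rgt0// exprn_gt0.
  set z := N ^+ 2 / (s ^+ 2 *+ 2).
  have z0 : 0 < z by rewrite divr_gt0// exprn_gt0.
  have hz : expR (- z) <= z^-1.
    rewrite expRN lef_pV2 ?posrE ?expR_gt0//.
    by have := expR_ge1Dx z; lra.
  rewrite mulNr -/z; apply: le_trans (ler_wpM2l (ltW N0) hz) _.
  rewrite le_eqVlt; apply/orP; left; apply/eqP; rewrite /z.
  by field; rewrite !gt_eqF.
- exact: cvg_cst.
- rewrite -[X in _ --> X](mulr0 (normal_peak s * (s ^+ 2 *+ 2))).
  by apply: cvgM; [exact: cvg_cst|exact: cvg_harmonic].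
Qed.

(** Integration by parts on [I n]: the derivative of [x * pdf x] is
    [pdf x - x ^+ 2 * pdf x / s ^+ 2]. Monotone convergence handles both integrals as [n] grows. *)
Lemma normal_second_moment :
  (\int[normal_prob 0 s]_x (x ^+ 2)%:E = (s ^+ 2)%:E)%E.
Proof.
have s2 : s != 0 by rewrite gt_eqF.
rewrite ge0_integral_normal_prob; [|by apply/measurable_EFinP; exact: measurable_funX|].
  2: by move=> x; rewrite lee_fin sqr_ge0.
under eq_integral do rewrite -EFinM.
have c2pdf : continuous (fun x => x ^+ 2 * pdf x).
  by move=> x; apply: cvgM; [exact: sqr_continuous|exact: continuous_pdf].
have c1 := cvg_int c2pdf (fun x => mulr_ge0 (sqr_ge0 x) (pdf_ge0 x)).
have c2 := cvg_int continuous_pdf pdf_ge0.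
have e1 : (\int[mu]_x (pdf x)%:E = 1)%E by exact: integral_normal_pdf.
rewrite e1 in c2.
have key n : (\int[mu]_(x in I n) (x ^+ 2 * pdf x)%:E =
   (s ^+ 2)%:E * (\int[mu]_(x in I n) (pdf x)%:E) - (s ^+ 2 * (2 * (n.+1%:R * pdf n.+1%:R)))%:E)%E.
  have ipdf : mu.-integrable (I n) (EFin \o pdf).
    apply: continuous_compact_integrable; first exact: segment_compact.
    exact: continuous_subspaceT.
  have i2 : mu.-integrable (I n) (EFin \o (fun x => x ^+ 2 * pdf x)).
    apply: continuous_compact_integrable; first exact: segment_compact.
    exact: continuous_subspaceT.
  have := @FTC_pdf (fun x => x * pdf x) (fun x => pdf x - (s ^+ 2)^-1 * (x ^+ 2 * pdf x)) n.
  have pN : pdf (- n.+1%:R) = pdf n.+1%:R by rewrite !pdfE sqrrN.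
  rewrite pN => h.
  have {h} : (\int[mu]_(x in I n) (pdf x)%:E - ((s ^+ 2)^-1)%:E * \int[mu]_(x in I n) (x ^+ 2 * pdf x)%:E = (2 * (n.+1%:R * pdf n.+1%:R))%:E)%E.
    rewrite -integralZl//; last exact: measurable_itv.
    rewrite -integralB//; [|exact: measurable_itv|]; last first.
      by apply: integrableZl => //; exact: measurable_itv.
    have -> : 2 * (n.+1%:R * pdf n.+1%:R) = n.+1%:R * pdf n.+1%:R - - n.+1%:R * pdf n.+1%:R by ring.
    apply: etrans; last apply: h; first by apply: eq_integral => x _; rewrite -EFinM -EFinB.
      move=> x; have dp := is_derive_pdf x.
      apply: is_derive_eq; rewrite /GRing.scale/=; by field.
    move=> x; apply: cvgB; first exact: continuous_pdf.
    by apply: cvgM; [exact: cvg_cst|exact: c2pdf].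
  rewrite -(fineK (integrable_fin_num _ ipdf))//; last exact: measurable_itv.
  rewrite -(fineK (integrable_fin_num _ i2))//; last exact: measurable_itv.
  rewrite -!EFinM -!EFinB => -[h]; congr EFin; rewrite -h; by field.
have c3 : (\int[mu]_(x in I n) (x ^+ 2 * pdf x)%:E)%E @[n --> \oo] --> (s ^+ 2)%:E.
  have e : ((s ^+ 2)%:E * 1 - (s ^+ 2 * (2 * 0))%:E)%E = (s ^+ 2)%:E.
    by rewrite mule1 !mulr0 sube0.
  rewrite -[X in _ --> X]e (funext key).
  apply: cvgeB => //; first exact: cvgeZl.
  apply: cvg_EFin; first exact: nearW.
  apply: cvgM; first exact: cvg_cst.
  by apply: cvgM; first exact: cvg_cst.
by apply: cvg_unique c1 c3; exact: ereal_hausdorff.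
Qed.

Let integral_oppr (f : R -> \bar R) : measurable_fun setT f ->
  (forall x, 0 <= f x)%E -> (\int[mu]_x f (- x)%R = \int[mu]_x f x)%E.
Proof.
move=> mf f0.
have -> : (\int[mu]_x f (- x)%R =
    \int[mu]_(x in (-%R : _ -> measurableTypeR R) @^-1` setT) (f \o -%R) x)%E.
  by rewrite preimage_setT.
rewrite -ge0_integral_pushforward//=.
by apply: eq_measure_integral => A mA _; exact: lebesgue_measureN.
Qed.

(** Integrability follows from [|x| <= 1 + x ^+ 2]; the mean vanishes because the density is even
    and so the positive and negative parts of [x] have equal integrals. *)
Lemma normal_first_moment : (normal_prob 0 s).-integrable setT (EFin : R -> \bar R) /\
  \int[normal_prob 0 s]_x x = 0.
Proof.
have m2 : measurable_fun setT (fun x : R => (x ^+ 2)%:E).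
  by apply/measurable_EFinP; exact: measurable_funX.
have i2 : (normal_prob 0 s).-integrable setT (fun x : R => (x ^+ 2)%:E).
  apply/integrableP; split => //.
  under eq_integral do rewrite gee0_abs ?lee_fin ?sqr_ge0//.
  by rewrite normal_second_moment ltry.
have i1 : (normal_prob 0 s).-integrable setT (EFin : R -> \bar R).
  have i3 : (normal_prob 0 s).-integrable setT (fun x : R => (1 + x ^+ 2)%:E).
    under eq_fun do rewrite EFinD.
    by apply: integrableD => //; exact: finite_measure_integrable_cst.
  apply: (le_integrable measurableT _ _ i3) => //.
  move=> x _ /=; rewrite lee_fin [leRHS]ger0_norm ?addr_ge0 ?sqr_ge0//.
  by rewrite ler_norml; apply/andP; split; nra.
split => //.
have mp : measurable_fun setT (fun x : R => (Num.max x 0)%:E).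
  by apply/measurable_EFinP; exact: measurable_maxr.
have mm : measurable_fun setT (fun x : R => (Num.max (- x) 0)%:E).
  by apply/measurable_EFinP; apply: measurable_maxr.
have ip : (normal_prob 0 s).-integrable setT (EFin \o (fun x : R => Num.max x 0)).
  apply: (le_integrable measurableT _ _ i1) => // x _ /=; rewrite lee_fin.
  by rewrite ger0_norm ?le_max ?lexx ?orbT// ge_max ler_norm normr_ge0.
have im : (normal_prob 0 s).-integrable setT (EFin \o (fun x : R => Num.max (- x) 0)).
  apply: (le_integrable measurableT _ _ i1) => // x _ /=; rewrite lee_fin.
  by rewrite ger0_norm ?le_max ?lexx ?orbT// ge_max ler_normr lexx orbT normr_ge0.
transitivity (\int[normal_prob 0 s]_x (Num.max x 0) - \int[normal_prob 0 s]_x (Num.max (- x) 0)).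
  rewrite -RintegralB//; apply: eq_Rintegral => x _.
  by rewrite /Num.max; case: ifPn => h1; case: ifPn => h2; lra.
apply/eqP; rewrite subr_eq0; apply/eqP; congr fine.
rewrite !ge0_integral_normal_prob//; try by move=> x; rewrite lee_fin le_max lexx orbT.
rewrite -integral_oppr; first by apply: eq_integral => x _; rewrite -!/(pdf _) !pdfE sqrrN.
- by apply: emeasurable_funM => //; apply/measurable_EFinP; exact: measurable_normal_pdf.
- by move=> x; rewrite mule_ge0 ?lee_fin ?le_max ?lexx ?orbT//; exact: pdf_ge0.
Qed.

End normal_moments.


(** * Brownian increments and the completed filtration *)

Section brownian_increments.
Context {R : realType} {d : measure_display} {Omega : measurableType d}.
Context (P : probability Omega R) (hP : measure_is_complete P).
Context (T : R) (B : R -> Omega -> R) (hB : brownian_motion P T B).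
Implicit Types (s t : R) (E A : set Omega).
Local Notation F t := (filtration P B t).
Local Notation FT t := (g_sigma_algebraType (filtration P B t)).

Lemma measurable_brownian t : 0 <= t <= T -> measurable_fun setT (B t).
Proof. by case: hB => h _ _ _ _; exact: h. Qed.

Lemma past_measurable t : t <= T -> <<s past_events B t >> `<=` measurable.
Proof.
move=> tT; apply: smallest_sub; first exact: sigma_algebra_measurable.
move=> E [s /=]; rewrite in_itv/= => /andP[s0 st] [A mA <-].
by apply: measurable_brownian => //; rewrite s0 (le_trans st).
Qed.

(** Completeness of [P] is what makes the added negligible sets measurable. *)
Lemma filtration_measurable t : t <= T -> <<s F t >> `<=` measurable.
Proof.
move=> tT; apply: smallest_sub; first exact: sigma_algebra_measurable.
move=> E [h|h]; last exact: hP.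
by apply: (past_measurable tT); exact: sub_sigma_algebra.
Qed.

Lemma filtration_le s t : s <= t -> <<s F s >> `<=` <<s F t >>.
Proof.
move=> st; apply: sub_smallest2r; first exact: smallest_sigma_algebra.
move=> E [[r /= rs hE]|h]; last by right.
left; exists r => //=.
by move: rs; rewrite !in_itv/= => /andP[-> /le_trans]; exact.
Qed.

Lemma filtration_le_fun s t (U : sigmaRingType default_measure_display) (f : Omega -> U) : s <= t ->
  measurable_fun setT (f : FT s -> U) -> measurable_fun setT (f : FT t -> U).
Proof. by move=> st mf _ Y mY; apply: (filtration_le st); exact: mf. Qed.

Lemma brownian_adapted s t : 0 <= s -> s <= t ->
  measurable_fun setT (B s : FT t -> R).
Proof.
move=> s0 st _ Y mY; apply: sub_sigma_algebra; left; exists s; last by exists Y.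
by rewrite /= in_itv/= s0 st.
Qed.

Lemma negligible_filtration t E : P.-negligible E -> <<s F t >> E.
Proof. by move=> nE; apply: sub_sigma_algebra; right. Qed.

(** Sets that coincide with a past event off a negligible set form a sigma-algebra containing the
    generators. This carries independence from the raw past, as in [brownian_motion], over to the
    completed filtration. *)
Lemma filtrationE t E : <<s F t >> E -> exists E' N,
  [/\ <<s past_events B t >> E', P.-negligible N & forall x, ~ N x -> E x <-> E' x].
Proof.
pose C := [set E | exists E' N, [/\ <<s past_events B t >> E', P.-negligible N
  & forall x, ~ N x -> E x <-> E' x]].
suff : <<s F t >> `<=` C by move=> h /h.
have sp : sigma_algebra setT <<s past_events B t >> by exact: smallest_sigma_algebra.
apply: smallest_sub.
- split.
  + exists set0, set0; split => //; first by case: sp.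
    exact: negligible_set0.
  + move=> A [A' [N [hA' hN h]]]; exists (setT `\` A'), N; split => //.
      by case: sp => _ + _; apply.
    by move=> x Nx; rewrite /setD/=; have := h x Nx; tauto.
  + move=> A hA; pose A' i := projT1 (cid (hA i)).
    have hA' i : exists N, [/\ <<s past_events B t >> (A' i), P.-negligible N
       & forall x, ~ N x -> A i x <-> A' i x] by rewrite /A'; case: cid.
    pose N i := projT1 (cid (hA' i)).
    have hN i : [/\ <<s past_events B t >> (A' i), P.-negligible (N i)
       & forall x, ~ N i x -> A i x <-> A' i x] by rewrite /N; case: cid.
    exists (\bigcup_i A' i), (\bigcup_i N i); split.
    * by case: sp => _ _; apply => i; case: (hN i).
    * by apply: negligible_bigcup => i; case: (hN i).
    * move=> x Nx; split=> -[i _ hi]; exists i => //;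
      case: (hN i) => _ _ /(_ x) h; apply/h => // hi'; apply: Nx; exists i => //.
- move=> E' [h|h].
  + exists E', set0; split => //; last exact: negligible_set0.
    exact: sub_sigma_algebra.
  + exists set0, E'; split => //; first by case: sp.
Qed.

Lemma measure_eq_off N A A' : measurable A -> measurable A' -> P.-negligible N ->
  (forall x, ~ N x -> A x <-> A' x) -> P A = P A'.
Proof.
move=> mA mA' [M [mM M0 NM]] h.
have le C C' : measurable C -> measurable C' -> (forall x, ~ N x -> C x <-> C' x) -> (P C <= P C')%E.
  move=> mC mC' hC; rewrite -(measureU0 mC' mM M0); apply: le_measure.
  - by rewrite inE.
  - by rewrite inE; exact: measurableU.
  - move=> x Cx; have [Mx|Mx] := pselect (M x); [by right|left].
    by apply/(hC x) => // /NM.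
by apply/eqP; rewrite eq_le !le// => x /h; tauto.
Qed.

Definition incr s t (x : Omega) : R := B t x - B s x.

Lemma filtration_indep s t E (A : set R) : 0 <= s -> s < t -> t <= T ->
  <<s F s >> E -> measurable A ->
  P (E `&` incr s t @^-1` A) = (P E * P (incr s t @^-1` A))%E.
Proof.
move=> s0 st tT hE mA; have [E' [N [hE' hN h]]] := filtrationE hE.
have sT : s <= T by rewrite (le_trans (ltW st)).
have mE := filtration_measurable sT hE.
have mE' := past_measurable sT hE'.
have mD : measurable (incr s t @^-1` A).
  rewrite -[_ @^-1` _]setTI; apply: measurable_funB => //; apply: measurable_brownian.
    by rewrite tT (le_trans s0 (ltW st)).
  by rewrite s0.
rewrite (measure_eq_off mE mE' hN h).
rewrite (@measure_eq_off N (E `&` _) (E' `&` incr s t @^-1` A)) => //.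
- by case: hB => _ _ _ _; exact.
- exact: measurableI.
- exact: measurableI.
- by move=> x /h; rewrite /setI/=; tauto.
Qed.

Section increment.
Variables (s t : R).
Hypotheses (s0 : 0 <= s) (st : s < t) (tT : t <= T).

Lemma measurable_incr : measurable_fun setT (incr s t).
Proof.
apply: measurable_funB => //; apply: measurable_brownian.
  by rewrite tT (le_trans s0 (ltW st)).
by rewrite s0 (le_trans (ltW st)).
Qed.

Let mI_mixin := isMeasurableFun.Build _ _ Omega (measurableTypeR R) _ measurable_incr.
Let I' : {mfun Omega >-> measurableTypeR R} := HB.pack (incr s t) mI_mixin.

Let law (A : set R) : measurable A ->
  distribution P I' A = normal_prob 0 (Num.sqrt (t - s)) A.
Proof. by move=> mA; case: hB => _ _ _ h _; exact: h. Qed.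

Let sq0 : 0 < Num.sqrt (t - s).
Proof. by rewrite sqrtr_gt0 subr_gt0. Qed.

Let sq2 : Num.sqrt (t - s) ^+ 2 = t - s.
Proof. by rewrite sqr_sqrtr// subr_ge0 ltW. Qed.

Lemma incr_sqint : sqint P setT (incr s t).
Proof.
split; first exact: measurable_incr.
have m2 : measurable_fun setT (fun x : R => (x ^+ 2)%:E).
  by apply/measurable_EFinP; exact: measurable_funX.
apply/integrableP; split.
  by apply/measurable_EFinP; apply: measurable_funX; exact: measurable_incr.
under eq_integral do rewrite gee0_abs ?lee_fin ?sqr_ge0//.
have := @ge0_integral_distribution _ _ _ (measurableTypeR R) _ P I' (fun x : R => (x ^+ 2)%:E) m2.
move=> /(_ (fun x => sqr_ge0 x)) /= <-.
rewrite (eq_measure_integral (normal_prob 0 (Num.sqrt (t - s)))); last by move=> A mA _; exact: law.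
by rewrite normal_second_moment// ltry.
Qed.

Lemma Rintegral_incr2 : \int[P]_x (incr s t x ^+ 2) = t - s.
Proof.
have m2 : measurable_fun setT (fun x : R => (x ^+ 2)%:E).
  by apply/measurable_EFinP; exact: measurable_funX.
have := @ge0_integral_distribution _ _ _ (measurableTypeR R) _ P I' (fun x : R => (x ^+ 2)%:E) m2.
move=> /(_ (fun x => sqr_ge0 x)) /= h; rewrite /Rintegral -h.
rewrite (eq_measure_integral (normal_prob 0 (Num.sqrt (t - s)))); last by move=> A mA _; exact: law.
by rewrite normal_second_moment//= sq2.
Qed.

Lemma integrable_incr : P.-integrable setT (EFin \o incr s t).
Proof.
have one : sqint P setT (fun=> 1 : R).
  split; first exact: measurable_cst.
  exact: finite_measure_integrable_cst.
have := sqint_mul measurableT incr_sqint one.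
by congr (_.-integrable); apply/funext => x /=; rewrite mulr1.
Qed.

Lemma Rintegral_incr : \int[P]_x incr s t x = 0.
Proof.
have e : (\int[distribution P I']_y y%:E = \int[P]_x (incr s t x)%:E)%E.
  by rewrite integral_distribution//; exact: integrable_incr.
rewrite /Rintegral -e.
rewrite (eq_measure_integral (normal_prob 0 (Num.sqrt (t - s)))); last by move=> A mA _; exact: law.
by have [_] := normal_first_moment sq0.
Qed.

Variable X : Omega -> R.
Hypotheses (mX : measurable_fun setT (X : FT s -> R)).
Hypothesis iX : P.-integrable setT (EFin \o X).

Let sT : s <= T. Proof. by rewrite (le_trans (ltW st)). Qed.

Let mX' : measurable_fun setT X.
Proof. by apply: (sub_measurable_fun (filtration_measurable sT)). Qed.

(** Stated for a function of the increment so as to cover both the increment and its square. *)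
Let indepX (f : R -> R) : measurable_fun setT f -> forall A C : set R, measurable A -> measurable C ->
  P (X @^-1` A `&` (f \o incr s t) @^-1` C) = (P (X @^-1` A) * P ((f \o incr s t) @^-1` C))%E.
Proof.
move=> mf A C mA mC; rewrite comp_preimage; apply: filtration_indep => //.
  by rewrite -[_ @^-1` _]setTI; exact: mX.
by rewrite -[_ @^-1` _]setTI; exact: mf.
Qed.

Lemma Rintegral_mul_incr : \int[P]_x (X x * incr s t x) = 0.
Proof.
rewrite Rintegral_indep ?Rintegral_incr ?mulr0//; [exact: measurable_incr| |exact: integrable_incr].
exact: (indepX (@measurable_id _ _ setT)).
Qed.

Lemma Rintegral_mul_incr2 :
  \int[P]_x (X x * incr s t x ^+ 2) = (t - s) * \int[P]_x X x.
Proof.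
have m2 : measurable_fun setT (fun x : R => x ^+ 2) by exact: measurable_funX.
rewrite (@Rintegral_indep _ _ _ P X (fun x => incr s t x ^+ 2))//.
- by rewrite Rintegral_incr2 mulrC.
- by apply: measurable_funX; exact: measurable_incr.
- exact: (indepX m2).
- by case: incr_sqint.
Qed.

End increment.
End brownian_increments.


(** * Tonelli and Fubini on the strip [0, t] x Omega *)

Section strip.
Context {R : realType} {d : measure_display} {Omega : measurableType d}.
Context (P : probability Omega R).
Implicit Types (t : R).
Notation leb := (@lebesgue_measure R).

Local Notation TR := (measurableTypeR R).

Definition strip t : set (TR * Omega) := `[0, t]%classic `*` setT.

Lemma measurable_strip t : measurable (strip t).
Proof. by apply: measurableX => //; exact: measurable_itv. Qed.

Lemma strip_restrict t (f : TR * Omega -> \bar R) s x :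
  (f \_ (strip t)) (s, x) = if s \in `[0, t]%classic then f (s, x) else 0%E.
Proof.
rewrite patchE; congr (if _ then _ else _); apply/idP/idP; rewrite !inE /strip/=.
  by case.
by [].
Qed.

Section tonelli.
Variables (t : R) (f : TR * Omega -> \bar R).
Hypothesis mf : measurable_fun (strip t) f.
Hypothesis f0 : forall p, strip t p -> (0 <= f p)%E.

(** Extension by zero: its sections vanish at times outside [[0, t]], which turns integrals over the
    strip into iterated integrals on the whole product. *)
Let g := f \_ (strip t).
Let mg : measurable_fun setT g.
Proof. by apply/(measurable_restrictT _ (measurable_strip t)). Qed.
Let g0 p : (0 <= g p)%E.
Proof. by rewrite /g patchE; case: ifPn => // /set_mem /f0. Qed.

Let gF (s : TR) : fubini_F P g s = ((fun s => (\int[P]_x f (s, x))%E) \_ (`[0, t]%classic : set TR)) s.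
Proof.
rewrite /fubini_F patchE /g; under eq_integral do rewrite strip_restrict.
by case: ifPn => // _; rewrite integral0.
Qed.

Let gG x : fubini_G leb g x = (\int[leb]_(s in `[0%R, t]) f (s, x))%E.
Proof.
rewrite /fubini_G /g [RHS]integral_mkcond; apply: eq_integral => s _.
by rewrite strip_restrict patchE.
Qed.

Lemma tonelli_strip1 : (\int[leb \x P]_(p in strip t) f p =
  \int[leb]_(s in `[0%R, t]) \int[P]_x f (s, x))%E.
Proof.
transitivity (\int[leb \x P]_z g z)%E; first by rewrite integral_mkcond.
rewrite [RHS]integral_mkcond; rewrite (@fubini_tonelli1 _ _ TR Omega R leb P g mg g0).
by apply: eq_integral => s _; rewrite gF.
Qed.

Lemma tonelli_strip2 : (\int[leb \x P]_(p in strip t) f p =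
  \int[P]_x \int[leb]_(s in `[0%R, t]) f (s, x))%E.
Proof.
transitivity (\int[leb \x P]_z g z)%E; first by rewrite integral_mkcond.
rewrite (@fubini_tonelli2 _ _ TR Omega R leb P g mg g0).
by apply: eq_integral => s _; rewrite gG.
Qed.

Lemma measurable_strip_integral1 :
  measurable_fun (`[0, t]%classic : set TR) (fun s => \int[P]_x f (s, x))%E.
Proof.
have := @measurable_fun_fubini_tonelli_F _ _ _ _ _ P g mg g0.
rewrite (funext gF).
by move/(measurable_restrictT _ (measurable_itv _)).
Qed.

Lemma measurable_strip_integral2 :
  measurable_fun setT (fun x => \int[leb]_(s in `[0%R, t]) f (s, x))%E.
Proof.
have := @measurable_fun_fubini_tonelli_G _ _ _ _ _ leb g mg g0.
by rewrite (funext gG).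
Qed.

End tonelli.

Section fubini.
Variables (t : R) (f : TR * Omega -> R).
Hypothesis fi : (leb \x P)%E.-integrable (strip t) (EFin \o f).

Let g := (EFin \o f) \_ (strip t).
Let ig : (leb \x P)%E.-integrable setT g.
Proof. by apply/(integrable_mkcond _ (measurable_strip t)). Qed.

Lemma fubini_strip1 : (\int[leb \x P]_(p in strip t) (f p)%:E =
  \int[leb]_(s in `[0%R, t]) \int[P]_x (f (s, x))%:E)%E.
Proof.
rewrite integral_mkcond [RHS]integral_mkcond -(integral12_prod_meas1 ig).
apply: eq_integral => s _; rewrite /fubini_F patchE /g.
under eq_integral do rewrite strip_restrict.
by case: ifPn => // _; rewrite integral0.
Qed.

Lemma fubini_strip2 : (\int[leb \x P]_(p in strip t) (f p)%:E =
  \int[P]_x \int[leb]_(s in `[0%R, t]) (f (s, x))%:E)%E.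
Proof.
rewrite integral_mkcond -(integral21_prod_meas1 ig).
apply: eq_integral => x _; rewrite /fubini_G /g [RHS]integral_mkcond.
by apply: eq_integral => s _; rewrite strip_restrict patchE.
Qed.

Lemma ae_integrable_strip :
  {ae P, forall x, leb.-integrable `[0, t] (fun s => (f (s, x))%:E)}.
Proof.
have := ae_integrable2 ig; apply: filterS => x.
have -> : (fun s => g (s, x)) = ((fun s : TR => (f (s, x))%:E) \_ (`[0, t]%classic : set TR)).
  by apply/funext => s; rewrite /g strip_restrict patchE.
by move=> h; apply/integrable_mkcond.
Qed.

End fubini.

Lemma leb_segment t : 0 <= t -> (leb `[0%R, t] = t%:E)%E.
Proof.
rewrite lebesgue_measure_itv/= lte_fin oppr0 adde0.
by rewrite le_eqVlt => /predU1P[<-|->//]; rewrite ltxx.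
Qed.

Lemma strip_measure t : 0 <= t -> ((leb \x P) (strip t) = t%:E)%E.
Proof.
move=> t0; rewrite /strip product_measure1E//.
rewrite [X in (_ * X)%E](_ : _ = 1%E); last exact: probability_setT.
by rewrite mule1 [LHS]leb_segment.
Qed.

Lemma bounded_sqint_strip t (f : TR * Omega -> R) (M : R) : 0 <= t ->
  measurable_fun (strip t) f ->
  (forall p, strip t p -> `|f p| <= M) ->
  sqint (leb \x P)%E (strip t) f.
Proof.
move=> t0 mf fM; split => //.
apply: measurable_bounded_integrable; first exact: measurable_strip.
- by apply: le_lt_trans (ltry t); rewrite [leLHS]strip_measure.
- exact: measurable_funX.
- exists (M ^+ 2); split; first exact: num_real.
  move=> y My p Dp; apply: le_trans (ltW My).
  rewrite /= ger0_norm ?sqr_ge0// -(real_normK (num_real (f p))) ler_sqr ?nnegrE//.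
    exact: fM.
  by apply: le_trans (fM _ Dp).
Qed.

(** The time side of the isometry for a single pair of steps: [J] will be the overlap of their two
    intervals and [Z] the product of their values. *)
Lemma ip_strip_prod t (J : set TR) (Z : Omega -> R) (M : R) : 0 <= t -> J `<=` `[0, t] ->
  measurable J -> measurable_fun setT Z -> (forall x, `|Z x| <= M) ->
  \int[(leb \x P)%E]_(p in strip t) ((\1_J p.1 : R) * Z p.2) =
  fine (leb J) * \int[P]_x Z x.
Proof.
move=> t0 Jt mJ mZ ZM.
have mf : measurable_fun setT (fun p : TR * Omega => (\1_J p.1 : R) * Z p.2).
  apply: measurable_funM.
    have m1 : measurable_fun setT (\1_J : TR -> R) by exact: measurable_indic.
    exact: (measurableT_comp m1 measurable_fst).
  exact: (measurableT_comp mZ measurable_snd).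
have iZ : P.-integrable setT (EFin \o Z).
  apply: (@measurable_bounded_integrable _ _ _ P Z setT) => //.
    by apply: le_lt_trans (ltry 1); exact: probability_le1.
  by exists M; split; [exact: num_real|move=> y My x _; apply: le_trans (ZM x) (ltW My)].
have fi : (leb \x P)%E.-integrable (strip t) (EFin \o (fun p => (\1_J p.1 : R) * Z p.2)).
  have hs : sqint (leb \x P)%E (strip t) (fun p => (\1_J p.1 : R) * Z p.2).
    apply: (bounded_sqint_strip (M := M) t0); first exact: measurable_funTS.
    move=> p _; rewrite normrM indicE; case: (_ \in _); rewrite ?normr1 ?mul1r//.
    by rewrite normr0 mul0r; apply: le_trans (ZM p.2).
  have h1 : sqint (leb \x P)%E (strip t) (fun=> 1).
    by apply: (bounded_sqint_strip (M := 1) t0) => // p _; rewrite normr1.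
  have := sqint_mul (measurable_strip t) hs h1.
  by congr (_.-integrable); apply/funext => p /=; rewrite mulr1.
rewrite {1}/Rintegral fubini_strip1//.
have fZ : (\int[P]_x (Z x)%:E)%E \is a fin_num by exact: integrable_fin_num.
have inner (s : TR) : (\int[P]_x ((\1_J s : R) * Z x)%:E =
    ((\1_J s : R) * \int[P]_x Z x)%:E)%E.
  under eq_integral do rewrite EFinM.
  by rewrite integralZl//= EFinM /Rintegral fineK.
rewrite (eq_integral (fun s : TR => ((\1_J s : R) * \int[P]_x Z x)%:E)); last first.
  by move=> s _; exact: inner.
have lJ : leb J \is a fin_num.
  rewrite ge0_fin_numE//; apply: (@le_lt_trans _ _ (leb `[0, t])).
    by apply: le_measure => //; rewrite inE//; exact: measurable_itv.
  by rewrite lebesgue_measure_itv/=; case: ifP => _; rewrite ?ltry// -EFinB ltry.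
under eq_integral do rewrite EFinM.
have iJ : leb.-integrable `[0, t] (EFin \o (\1_J : TR -> R)).
  apply: measurable_bounded_integrable; first exact: measurable_itv.
  - by apply: le_lt_trans (ltry t); rewrite [leLHS]leb_segment.
  - by apply: measurable_funTS; exact: measurable_indic.
  - exists 1; split; first exact: num_real.
    move=> y My s _; apply: le_trans (ltW My).
    by rewrite indicE; case: (_ \in _); rewrite ?normr1 ?normr0.
rewrite integralZr//.
by rewrite integral_indic// (setIidl Jt) fineM//.
Qed.

End strip.


(** * Ito isometry and uniqueness of the integrand *)

Section isometry.
Context {R : realType} {d : measure_display} {Omega : measurableType d}.
Context (P : probability Omega R) (hP : measure_is_complete P).
Context (T : R) (B : R -> Omega -> R) (hB : brownian_motion P T B).
Implicit Types (s t a b : R).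
Local Notation F t := (filtration P B t).
Local Notation FT t := (g_sigma_algebraType (filtration P B t)).
Notation leb := (@lebesgue_measure R).
Local Notation TR := (measurableTypeR R).
Local Notation incr := (incr B).

Definition bounded_adapted t (X : Omega -> R) : Prop :=
  measurable_fun setT (X : FT t -> R) /\ exists M : R, forall x, `|X x| <= M.

Lemma adapted_measurable t (X : Omega -> R) : t <= T ->
  measurable_fun setT (X : FT t -> R) -> measurable_fun setT X.
Proof.
by move=> tT; apply: (sub_measurable_fun (filtration_measurable hP hB tT)).
Qed.

Lemma bounded_adapted_le s t X : s <= t -> bounded_adapted s X -> bounded_adapted t X.
Proof. by move=> st [mX hX]; split => //; exact: filtration_le_fun st mX. Qed.

Lemma bounded_adaptedM t X Y : bounded_adapted t X -> bounded_adapted t Y ->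
  bounded_adapted t (fun x => X x * Y x).
Proof.
move=> [mX [M hM]] [mY [N hN]]; split; first exact: measurable_funM.
exists (M * N) => x; rewrite normrM; exact: ler_pM.
Qed.

Lemma bounded_sqint t X (f : Omega -> R) : t <= T -> bounded_adapted t X ->
  sqint P setT f -> sqint P setT (fun x => X x * f x).
Proof.
move=> tT [mX [M hM]] sf; have mX' := adapted_measurable tT mX.
apply: (sqint_le measurableT _ (sqintZ measurableT M sf)).
  by apply: measurable_funM => //; case: sf.
move=> x _; rewrite !normrM ler_wpM2r//; apply: le_trans (hM x) _; exact: ler_norm.
Qed.

Lemma sqint_cst (c : R) : sqint P setT (fun=> c).
Proof. by split; [exact: measurable_cst|exact: finite_measure_integrable_cst]. Qed.

Lemma sqint_integrable f : sqint P setT f -> P.-integrable setT (EFin \o f).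
Proof.
move=> sf; have := sqint_mul measurableT sf (sqint_cst 1).
by congr (_.-integrable); apply/funext => x /=; rewrite mulr1.
Qed.

Lemma incrSS s : incr s s = (fun=> 0).
Proof. by apply/funext => x; rewrite /incr subrr. Qed.

Lemma incrD s t a x : incr s a x = incr s t x + incr t a x.
Proof. by rewrite /incr; ring. Qed.

Lemma sqint_incr s t : 0 <= s -> s <= t -> t <= T -> sqint P setT (incr s t).
Proof.
move=> s0; rewrite le_eqVlt => /predU1P[->|st] tT; last exact: (incr_sqint hB).
by rewrite incrSS; exact: sqint_cst.
Qed.

Lemma measurable_incr_adapted s t a : 0 <= s -> s <= t -> t <= a ->
  measurable_fun setT (incr s t : FT a -> R).
Proof.
move=> s0 st ta; apply: measurable_funB; apply: brownian_adapted => //.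
  by rewrite (le_trans s0).
by rewrite (le_trans st).
Qed.

Lemma mean_mul_incr s t X : 0 <= s -> s <= t -> t <= T ->
  measurable_fun setT (X : FT s -> R) -> P.-integrable setT (EFin \o X) ->
  \int[P]_x (X x * incr s t x) = 0.
Proof.
move=> s0; rewrite le_eqVlt => /predU1P[->|st] tT mX iX.
  by rewrite incrSS; under eq_Rintegral do rewrite mulr0; rewrite /Rintegral integral0.
exact: (Rintegral_mul_incr hP hB).
Qed.

Lemma mean_mul_incr2 s t X : 0 <= s -> s <= t -> t <= T ->
  measurable_fun setT (X : FT s -> R) -> P.-integrable setT (EFin \o X) ->
  \int[P]_x (X x * incr s t x ^+ 2) = (t - s) * \int[P]_x X x.
Proof.
move=> s0; rewrite le_eqVlt => /predU1P[->|st] tT mX iX.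
  rewrite incrSS subrr mul0r.
  by under eq_Rintegral do rewrite expr0n mulr0; rewrite /Rintegral integral0.
exact: (Rintegral_mul_incr2 hP hB).
Qed.

(** Cross terms vanish: the factor before [incr u v] is known at time [u]. It is not bounded, whence
    the detour through square-integrability. *)
Lemma mean_bounded_mul_incr s t u v X :
  0 <= s -> s <= t -> t <= u -> u <= v -> v <= T -> bounded_adapted u X ->
  \int[P]_x (X x * incr s t x * incr u v x) = 0.
Proof.
move=> s0 st tu uv vT bX.
have uT : u <= T by rewrite (le_trans uv).
have tT : t <= T by rewrite (le_trans tu).
apply: mean_mul_incr => //.
- by rewrite (le_trans s0)// (le_trans st).
- apply: measurable_funM; first by case: bX.
  exact: measurable_incr_adapted.
- apply: sqint_integrable; apply: bounded_sqint uT bX _; exact: sqint_incr.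
Qed.

(** The factor in front is the length of the overlap of the two time intervals. Cutting the
    increments at the ends of the overlap leaves one squared increment, whose conditional mean is
    that length, and products of increments over disjoint intervals, whose means vanish. *)
Lemma ip_incr_le a b u v X Y : 0 <= a -> a <= b -> b <= T -> a <= u -> u <= v -> v <= T ->
  bounded_adapted a X -> bounded_adapted u Y ->
  ip P setT (fun x => X x * incr a b x) (fun x => Y x * incr u v x) =
  Num.max 0 (Num.min b v - u) * \int[P]_x (X x * Y x).
Proof.
move=> a0 ab bT au uv vT bX bY.
have u0 : 0 <= u by rewrite (le_trans a0).
have uT : u <= T by rewrite (le_trans uv).
pose Z x := X x * Y x.
have bZ : bounded_adapted u Z by apply: bounded_adaptedM => //; exact: bounded_adapted_le bX.
have iZ : P.-integrable setT (EFin \o Z).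
  have := bounded_sqint uT bZ (sqint_cst 1) => /sqint_integrable.
  by congr (_.-integrable); apply/funext => x /=; rewrite mulr1.
have i3 r s p q : 0 <= r -> r <= s -> s <= T -> 0 <= p -> p <= q -> q <= T ->
   P.-integrable setT (EFin \o (fun x => Z x * incr r s x * incr p q x)).
  move=> *; apply: sqint_mul => //; last exact: sqint_incr.
  by apply: bounded_sqint uT bZ _; exact: sqint_incr.
have [bu|ub] := leP b u.
  rewrite max_l; last by rewrite subr_le0 ge_min bu.
  rewrite mul0r /ip -[RHS](mean_bounded_mul_incr a0 ab bu uv vT bZ).
  by apply: eq_Rintegral => x _; rewrite /Z; ring.
have [bv|vb] := leP b v.
  rewrite max_r; last by rewrite subr_ge0 ltW.
  rewrite /ip -(mean_mul_incr2 u0 (ltW ub) bT _ iZ); last by case: bZ.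
  (* The overlap is []u, b]]: the first increment is cut at [u], the second at [b]. *)
  have e x : X x * incr a b x * (Y x * incr u v x) =
    Z x * incr a u x * incr u b x + Z x * incr u b x ^+ 2 + Z x * incr a b x * incr b v x.
    by rewrite /Z (incrD a u b) (incrD u b v); ring.
  under eq_Rintegral do rewrite e.
  have i2 : P.-integrable setT (EFin \o (fun x => Z x * incr u b x ^+ 2)).
    have := i3 u b u b u0 (ltW ub) bT u0 (ltW ub) bT.
    by congr (_.-integrable); apply/funext => x /=; rewrite -mulrA -expr2.
  have i1 := i3 a u u b a0 au uT u0 (ltW ub) bT.
  have b0 : 0 <= b by exact: le_trans ab.
  rewrite RintegralD//; last 2 first.
  - exact: (integrableD measurableT i1 i2).
  - exact: i3.
  rewrite RintegralD// (mean_bounded_mul_incr a0 ab (lexx b) bv vT); last first.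
    exact: bounded_adapted_le (ltW ub) bZ.
  by rewrite (mean_bounded_mul_incr a0 au (lexx u) (ltW ub) bT bZ) add0r addr0.
have vb' := ltW vb.
rewrite max_r; last by rewrite subr_ge0.
rewrite /ip -(mean_mul_incr2 u0 uv vT _ iZ); last by case: bZ.
(* Here []u, v]] lies inside []a, b]], so the first increment is cut at both [u] and [v]. *)
have e x : X x * incr a b x * (Y x * incr u v x) =
  Z x * incr a u x * incr u v x + Z x * incr u v x ^+ 2 + Z x * incr u v x * incr v b x.
  by rewrite /Z (incrD a u b) (incrD u v b); ring.
under eq_Rintegral do rewrite e.
have i2 : P.-integrable setT (EFin \o (fun x => Z x * incr u v x ^+ 2)).
  have := i3 u v u v u0 uv vT u0 uv vT.
  by congr (_.-integrable); apply/funext => x /=; rewrite -mulrA -expr2.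
have i1 := i3 a u u v a0 au uT u0 uv vT.
have v0 : 0 <= v by exact: le_trans uv.
rewrite RintegralD//; last 2 first.
- exact: (integrableD measurableT i1 i2).
- exact: i3.
rewrite RintegralD// (mean_bounded_mul_incr u0 uv (lexx v) vb' bT); last first.
  exact: bounded_adapted_le uv bZ.
by rewrite (mean_bounded_mul_incr a0 au (lexx u) uv vT bZ) add0r addr0.
Qed.

(** A single term of a simple process. A family of steps may overlap and be in any order, so the
    isometry extends to a difference of two simple processes without a common refinement of their
    partitions. *)
Record step := Step { st_l : R ; st_r : R ; st_val : Omega -> R }.

Definition step_ok t (e : step) : Prop :=
  [/\ 0 <= st_l e, st_l e <= st_r e, st_r e <= t & bounded_adapted (st_l e) (st_val e)].

Definition step_eval (e : step) (p : TR * Omega) : R :=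
  \1_(`]st_l e, st_r e]%classic : set R) p.1 * st_val e p.2.

Definition step_int (e : step) x : R := st_val e x * incr (st_l e) (st_r e) x.

Section fixed_horizon.
Variable t : R.
Hypothesis tT : t <= T.

Lemma step_int_sqint e : step_ok t e -> sqint P setT (step_int e).
Proof.
move=> [l0 lr rt bX]; apply: bounded_sqint bX _; first by rewrite (le_trans lr)// (le_trans rt).
by apply: sqint_incr => //; exact: le_trans tT.
Qed.

Lemma step_eval_sqint e : step_ok t e -> sqint (leb \x P)%E (strip t) (step_eval e).
Proof.
move=> [l0 lr rt [mX [M hM]]].
have lt : st_l e <= t by exact: le_trans rt.
have mX' := adapted_measurable (le_trans lt tT) mX.
apply: (@bounded_sqint_strip _ _ _ P t _ M); first exact: le_trans lt.
  apply: measurable_funTS; apply: measurable_funM.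
    have m1 : measurable_fun setT (\1_(`]st_l e, st_r e]%classic : set R) : TR -> R).
      by apply: measurable_indic; exact: measurable_itv.
    exact: (measurableT_comp m1 measurable_fst).
  exact: (measurableT_comp mX' measurable_snd).
move=> p _; rewrite /step_eval normrM indicE; case: (_ \in _); rewrite ?normr1 ?mul1r//.
by rewrite normr0 mul0r; apply: le_trans (hM p.2).
Qed.

Let ip_step_le e f : step_ok t e -> step_ok t f -> st_l e <= st_l f ->
  ip P setT (step_int e) (step_int f) =
  ip (leb \x P)%E (strip t) (step_eval e) (step_eval f).
Proof.
move=> [l0 lr rt bX] [l0' lr' rt' bY] ll.
rewrite [LHS]ip_incr_le//; [|exact: le_trans tT|exact: le_trans tT].
pose J : set TR := `]st_l f, Num.min (st_r e) (st_r f)]%classic.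
pose Z x := st_val e x * st_val f x.
have bZ : bounded_adapted (st_l f) Z.
  by apply: bounded_adaptedM => //; exact: bounded_adapted_le bX.
have lft : st_l f <= t by exact: le_trans rt'.
have [mZ [M hM]] := bZ.
have mZ' := adapted_measurable (le_trans lft tT) mZ.
have Jt : J `<=` `[0, t].
  move=> s; rewrite /J/= !in_itv/= le_min => /andP[h1 /andP[_ h2]].
  by rewrite (le_trans l0' (ltW h1)) (le_trans h2).
have := ip_strip_prod P (le_trans l0' lft) Jt (measurable_itv _) mZ' hM.
rewrite /ip => h.
transitivity (fine (leb J) * \int[P]_x Z x).
  congr (_ * _); rewrite /J lebesgue_measure_itv/= lte_fin.
  case: ltP => h1; first by rewrite max_r//= subr_ge0 ltW.
  by rewrite max_l// subr_le0.
rewrite -h; apply: eq_Rintegral => p _; rewrite /step_eval mulrACA; congr (_ * _).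
rewrite !indicE -natrM mulnb; congr (_%:R); congr nat_of_bool.
apply/idP/andP; rewrite !inE /J/= !in_itv/= le_min.
  move=> /andP[h1 /andP[h2 h3]]; split; rewrite ?h1//.
  by rewrite (le_lt_trans ll h1).
by move=> [/andP[h1 h2] /andP[h3 h4]]; rewrite h3 h2 h4.
Qed.

Lemma ip_step e f : step_ok t e -> step_ok t f ->
  ip P setT (step_int e) (step_int f) =
  ip (leb \x P)%E (strip t) (step_eval e) (step_eval f).
Proof.
move=> he hf; have [h|/ltW h] := leP (st_l e) (st_l f); first exact: ip_step_le.
by rewrite ipC [RHS]ipC; exact: ip_step_le.
Qed.

(** By bilinearity both sides are double sums over pairs of steps, equal term by term. *)
Lemma step_isometry (I : Type) (r : seq I) (e : I -> step) : (forall i, step_ok t (e i)) ->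
  ip P setT (fun x => \sum_(i <- r) step_int (e i) x) (fun x => \sum_(i <- r) step_int (e i) x) =
  ip (leb \x P)%E (strip t) (fun p => \sum_(i <- r) step_eval (e i) p)
    (fun p => \sum_(i <- r) step_eval (e i) p).
Proof.
move=> he.
have h1 i := step_int_sqint (he i); have h2 i := step_eval_sqint (he i).
have mS := measurable_strip (Omega := Omega) t.
rewrite ip_suml//; last exact: sqint_sum.
rewrite [RHS]ip_suml//; last exact: sqint_sum.
apply: eq_bigr => i _; rewrite ipC ip_suml// [RHS]ipC ip_suml//.
by apply: eq_bigr => j _; exact: ip_step.
Qed.

End fixed_horizon.
End isometry.


Section square_integrable_limits.
Context d (T : measurableType d) (R : realType).
Variables (mu : {measure set T -> \bar R}) (D : set T).
Hypothesis mD : measurable D.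
Implicit Types f g h : T -> R.

Lemma ip_parallelogram a b : sqint mu D a -> sqint mu D b ->
  ip mu D (fun x => a x - b x) (fun x => a x - b x) <= 2 * (ip mu D a a + ip mu D b b).
Proof.
move=> ha hb; have := ip_ge0 mu D (fun x => a x + b x).
rewrite ipBB// ipDl//; last exact: sqintD.
rewrite (ipC mu D a (fun x => a x + b x)) (ipC mu D b (fun x => a x + b x)) !ipDl//.
by rewrite (ipC mu D b a); lra.
Qed.

Lemma sqdist_cvgB (f_ g_ : nat -> T -> R) f g :
  (forall n, sqint mu D (f_ n)) -> (forall n, sqint mu D (g_ n)) ->
  sqint mu D f -> sqint mu D g ->
  sqdist mu D (f_ n) f @[n --> \oo] --> 0%E -> sqdist mu D (g_ n) g @[n --> \oo] --> 0%E ->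
  sqdist mu D (fun x => f_ n x - g_ n x) (fun x => f x - g x) @[n --> \oo] --> 0%E.
Proof.
move=> hfn hgn hf hg /fine_cvg cf /fine_cvg cg.
have hd n : sqint mu D (fun x => f_ n x - g_ n x) by exact: sqintB.
have hd' : sqint mu D (fun x => f x - g x) by exact: sqintB.
rewrite (funext (fun n => sqdistE mD (hd n) hd')).
apply: cvg_EFin; first exact: nearW.
apply: (@squeeze_cvgr _ _ _ _ (fun=> 0)
  (fun n => 2 * (fine (sqdist mu D (f_ n) f) + fine (sqdist mu D (g_ n) g)))).
- apply: nearW => n; rewrite /= ip_ge0/= !sqdistE//=.
  have ha := sqintB mD (hfn n) hf; have hb := sqintB mD (hgn n) hg.
  apply: le_trans (ip_parallelogram ha hb); rewrite le_eqVlt; apply/orP; left.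
  by apply/eqP; congr ip; apply/funext => x; ring.
- exact: cvg_cst.
- rewrite -[X in _ --> X](mulr0 (2 : R)) -[X in 2 * X](addr0 (0 : R)).
  by apply: cvgM; [exact: cvg_cst|exact: cvgD].
Qed.

(** Turns a vanishing norm back into an almost everywhere statement, where the isometry and the
    optimality gap both end. *)
Lemma ip0_ae h : sqint mu D h -> ip mu D h h = 0 -> {ae mu, forall x, D x -> h x = 0}.
Proof.
move=> [mh ih] h0.
have fin := integrable_fin_num mD ih.
have z : (\int[mu]_(x in D) `|(h x ^+ 2)%:E| = 0)%E.
  under eq_integral do rewrite gee0_abs ?lee_fin ?sqr_ge0//.
  rewrite -[RHS]/(0%:E) -h0 /ip /Rintegral.
  under [in RHS]eq_integral do rewrite -expr2.
  by rewrite fineK.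
have m2 : measurable_fun D (fun x => (h x ^+ 2)%:E).
  by apply/measurable_EFinP; exact: measurable_funX.
have := (ae_eq_integral_abs mu mD m2).1 z.
by apply: filterS => x hx Dx; have := hx Dx => -[] /eqP; rewrite sqrf_eq0 => /eqP.
Qed.

Lemma ae_ip0 h : sqint mu D h -> {ae mu, forall x, D x -> h x = 0} -> ip mu D h h = 0.
Proof.
move=> [mh ih] h0.
rewrite /ip /Rintegral.
suff -> : (\int[mu]_(x in D) (h x * h x)%:E = 0)%E by [].
rewrite -(integral0 mu D); apply: ae_eq_integral => //.
- by apply/measurable_EFinP; exact: measurable_funM.
- by apply: filterS h0 => x hx Dx; rewrite hx// mul0r.
Qed.

End square_integrable_limits.

(** * Passage of the isometry to limits: the integrand is determined by the integral *)

Section ito_uniqueness.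
Context {R : realType} {d : measure_display} {Omega : measurableType d}.
Context (P : probability Omega R) (hP : measure_is_complete P).
Context (T : R) (B : R -> Omega -> R) (hB : brownian_motion P T B).
Implicit Types (s t a b : R).
Local Notation F t := (filtration P B t).
Local Notation FT t := (g_sigma_algebraType (filtration P B t)).
Notation leb := (@lebesgue_measure R).
Local Notation TR := (measurableTypeR R).

Lemma progressive_measurable T' t X : t <= T -> 0 <= t <= T' -> progressive P B T' X ->
  measurable_fun (strip t : set (TR * Omega)) (fun p => X p.1 p.2).
Proof.
move=> tT tT' /(_ t tT') mX.
have m1 : measurable_fun setT (fst : TR * Omega -> R) by exact: measurable_fst.
have m2 : measurable_fun setT (snd : TR * Omega -> FT t).
  by move=> _ A mA; apply: measurable_snd => //; exact: (filtration_measurable hP hB tT).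
have mid := measurable_fun_pair m1 m2.
have mid' : measurable_fun (strip t) (fun p : TR * Omega => (p.1, p.2) : R * FT t).
  exact: measurable_funTS.
apply: (measurable_comp (F := `[0, t]%classic `*` setT) _ _ mX mid').
- by apply: measurableX => //; exact: measurable_itv.
- by move=> p [q hq <-].
Qed.

Lemma progressive_adapted T' t X : 0 <= t <= T' -> progressive P B T' X ->
  measurable_fun setT (X t : FT t -> R).
Proof.
move=> tT' /(_ t tT') mX; have /andP[t0 _] := tT'.
have mid : measurable_fun setT ((fun x => (t, x)) : FT t -> R * FT t).
  exact: measurable_fun_pair.
apply: (measurable_comp (F := `[0, t]%classic `*` setT) _ _ mX mid).
- by apply: measurableX => //; exact: measurable_itv.
- by move=> p [q hq <-] /=; split => //=; rewrite in_itv/= t0 lexx.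
Qed.

Section simple.
Variables (t : R) (H : @simple_process R d Omega).
Hypotheses (tT : t <= T) (hH : simple_predictable P B t H).

(** The scalar [c] is 1 or -1 in the uses, so that a difference of simple processes becomes a sum of
    steps. *)
Definition step_of (c : R) (i : nat) : @step R d Omega :=
  Step (sp_time H i) (sp_time H i.+1) (fun x => c * sp_val H i x).

Lemma step_of_ok c i : (i < sp_size H)%N -> step_ok P B t (step_of c i).
Proof.
case: hH => h0 ht hmon hval isz.
have mono j k : (j + k <= sp_size H)%N -> sp_time H j <= sp_time H (j + k).
  elim: k => [|k IH]; first by rewrite addn0.
  rewrite addnS => jk; apply: le_trans (IH (ltnW jk)) _; exact: hmon.
have [mv [M hM]] := hval i isz.
split; rewrite /step_of/=.
- by apply: le_trans h0 _; have := mono 0%N i; rewrite add0n; apply; exact: ltnW.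
- exact: hmon.
- apply: le_trans ht; have := mono i.+1 (sp_size H - i.+1)%N.
  by rewrite subnKC//; apply.
- split; first exact: measurable_funM.
  by exists (`|c| * M) => x; rewrite normrM ler_wpM2l.
Qed.

Lemma simple_evalE c p : c * simple_eval H p.1 p.2 =
  \sum_(i < sp_size H) step_eval (step_of c i) p.
Proof.
rewrite mulr_sumr; apply: eq_bigr => i _; rewrite /step_eval/= mulrA mulrC.
by congr (_ * _); rewrite indicE; congr (_%:R); congr nat_of_bool;
  apply/idP/idP; rewrite inE.
Qed.

Lemma simple_integralE c x : c * simple_integral B H x =
  \sum_(i < sp_size H) step_int B (step_of c i) x.
Proof. by rewrite mulr_sumr; apply: eq_bigr => i _; rewrite /step_int/= mulrA. Qed.

Lemma simple_eval_sqint : sqint (leb \x P)%E (strip t) (fun p => simple_eval H p.1 p.2).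
Proof.
rewrite (_ : (fun p => _) = fun p => \sum_(i < sp_size H) step_eval (step_of 1 i) p).
  apply: sqint_sum; first exact: measurable_strip.
  by move=> i; apply: (step_eval_sqint hP hB tT); exact: step_of_ok.
by apply/funext => p; rewrite -simple_evalE mul1r.
Qed.

Lemma simple_integral_sqint : sqint P setT (simple_integral B H).
Proof.
rewrite (_ : simple_integral B H = fun x => \sum_(i < sp_size H) step_int B (step_of 1 i) x).
  apply: sqint_sum => // i; apply: (step_int_sqint hP hB tT); exact: step_of_ok.
by apply/funext => p; rewrite -simple_integralE mul1r.
Qed.

End simple.

Lemma simple_isometry t H K : t <= T ->
  simple_predictable P B t H -> simple_predictable P B t K ->
  ip P setT (fun x => simple_integral B H x - simple_integral B K x)
     (fun x => simple_integral B H x - simple_integral B K x) =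
  ip (leb \x P)%E (strip t) (fun p => simple_eval H p.1 p.2 - simple_eval K p.1 p.2)
     (fun p => simple_eval H p.1 p.2 - simple_eval K p.1 p.2).
Proof.
move=> tT hH hK.
(* The terms of [H] with sign 1 and those of [K] with sign -1, listed over the disjoint union of the
   index sets. *)
pose e (i : 'I_(sp_size H) + 'I_(sp_size K)) :=
  match i with inl i => step_of H 1 i | inr j => step_of K (-1) j end.
have := @step_isometry _ _ _ P hP T B hB t tT _ (index_enum _) e.
have -> : (fun p => \sum_i step_eval (e i) p) =
    (fun p => simple_eval H p.1 p.2 - simple_eval K p.1 p.2).
  by apply/funext => p; rewrite big_sumType/= -!simple_evalE mul1r mulN1r.
have -> : (fun p => \sum_i step_int B (e i) p) =
    (fun p => simple_integral B H p - simple_integral B K p).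
  by apply/funext => p; rewrite big_sumType/= -!simple_integralE mul1r mulN1r.
by apply; case=> i; exact: step_of_ok.
Qed.

Lemma simple_isometry1 t H : t <= T -> simple_predictable P B t H ->
  ip P setT (simple_integral B H) (simple_integral B H) =
  ip (leb \x P)%E (strip t) (fun p => simple_eval H p.1 p.2) (fun p => simple_eval H p.1 p.2).
Proof.
move=> tT hH.
have := @step_isometry _ _ _ P hP T B hB t tT _ (index_enum 'I_(sp_size H)) (fun i => step_of H 1 i).
have -> : (fun p => \sum_(i < sp_size H) step_eval (step_of H 1 i) p) =
    (fun p => simple_eval H p.1 p.2).
  by apply/funext => p; rewrite -!simple_evalE mul1r.
have -> : (fun p => \sum_(i < sp_size H) step_int B (step_of H 1 i) p) =
    (fun p => simple_integral B H p).
  by apply/funext => p; rewrite -!simple_integralE mul1r.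
by apply; move=> i; exact: step_of_ok.
Qed.

Lemma ito_sqint t Z I : 0 <= t <= T -> ito_integral P B t Z I ->
  sqint (leb \x P)%E (strip t) (fun p => Z p.1 p.2) /\ sqint P setT I.
Proof.
move=> /andP[t0 tT] [pZ fZ mI [H [hH cH cI]]]; split.
  have mZ := progressive_measurable tT (introT andP (conj t0 (lexx t))) pZ.
  split => //; apply/integrableP; split.
    by apply/measurable_EFinP; exact: measurable_funX.
  move: fZ; rewrite /L2dist2; congr (_ < _)%E; apply: eq_integral => p _.
  by rewrite subr0 gee0_abs// lee_fin sqr_ge0.
apply: (sqint_lim measurableT _ mI cI) => n; exact: simple_integral_sqint tT (hH n).
Qed.

(** The isometry for [H n - K n] passes to the limit on both sides, so the norm of [Z - Z'] on the
    strip equals that of [I - I'], which is 0. *)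
Lemma ito_unique t Z Z' I I' : 0 <= t <= T ->
  ito_integral P B t Z I -> ito_integral P B t Z' I' ->
  {ae P, forall x, I x = I' x} ->
  {ae (leb \x P)%E, forall p, 0 <= p.1 <= t -> Z p.1 p.2 = Z' p.1 p.2}.
Proof.
move=> t0T hI hI' II'; have /andP[t0 tT] := t0T.
have [sZ sI] := ito_sqint t0T hI; have [sZ' sI'] := ito_sqint t0T hI'.
case: hI => [_ _ _ [H [hH cH cI]]]; case: hI' => [_ _ _ [K [hK cK cI']]].
have mS := measurable_strip (Omega := Omega) t.
have sH n := simple_eval_sqint tT (hH n); have sK n := simple_eval_sqint tT (hK n).
have siH n := simple_integral_sqint tT (hH n); have siK n := simple_integral_sqint tT (hK n).
have c1 := sqnorm_cvg mS (fun n => sqintB mS (sH n) (sK n)) (sqintB mS sZ sZ')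
  (sqdist_cvgB mS sH sK sZ sZ' cH cK).
have c2 := sqnorm_cvg measurableT (fun n => sqintB measurableT (siH n) (siK n))
  (sqintB measurableT sI sI') (sqdist_cvgB measurableT siH siK sI sI' cI cI').
have e n := simple_isometry tT (hH n) (hK n).
rewrite (funext e) in c2.
have e0 := cvg_unique (@norm_hausdorff _ R) c1 c2.
have z : ip P setT (fun x => I x - I' x) (fun x => I x - I' x) = 0.
  apply: ae_ip0 => //; first exact: sqintB.
  by apply: filterS II' => x -> _; rewrite subrr.
rewrite z in e0.
suff : {ae (leb \x P)%E, forall p, strip t p -> Z p.1 p.2 - Z' p.1 p.2 = 0}.
  apply: filterS => p hp p0; apply/eqP; rewrite -subr_eq0; apply/eqP; apply: hp.
  by split => //=; rewrite in_itv.
by apply: (ip0_ae mS (sqintB mS sZ sZ')); apply: e0.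
Qed.

End ito_uniqueness.


(** * The Wiener integral of 1/w, path by path *)

Section riemann_sums.
Context {R : realType}.
Notation leb := (@lebesgue_measure R).
Implicit Types (f b : R -> R) (s t u v x y : R).

(** Uniform continuity with only [x] confined to the segment. Compactness enters in its
    near-covering form: a radius that works near each point, for all small values, works on the
    whole segment. *)
Lemma Heine f u v : continuous f -> forall e : R, 0 < e ->
  exists2 de : R, 0 < de & forall x y, x \in `[u, v] -> `|x - y| < de -> `|f x - f y| < e.
Proof.
move=> cf e e0.
have /compact_near_coveringP cover := @segment_compact R u v.
have := cover R (0^'+) (fun de x => forall y, `|x - y| < de -> `|f x - f y| < e) _.
case.
  move=> x _.
  have e2 : 0 < e / 2 by rewrite divr_gt0.
  have /cvgrPdist_lt/(_ _ e2)[r /= r0 hr] := cf x.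
  have r2 : 0 < r / 2 by rewrite divr_gt0.
  exists (ball x (r / 2), [set de : R | de < r / 2]); first split => /=.
  - exact: nbhsx_ballx.
  - exact: nbhs_right_lt.
  - move=> [z de] /= [xz dr] y zy.
    have h1 : `|f x - f z| < e / 2.
      by apply: hr => /=; apply: lt_trans xz _; rewrite ltr_pdivrMr// ltr_pMr// ltr1n.
    have h2 : `|f x - f y| < e / 2.
      apply: hr => /=; rewrite (splitr r) (_ : x - y = (x - z) + (z - y)); last by ring.
      by apply: le_lt_trans (ler_normD _ _) _; apply: ltrD => //; exact: lt_trans zy dr.
    rewrite (splitr e) (_ : f z - f y = (f x - f y) - (f x - f z)); last by ring.
    by apply: le_lt_trans (ler_normB _ _) _; exact: ltrD.
move=> r /= r0 hr; exists (r / 2); first by rewrite divr_gt0.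
move=> x y xuv xy; apply: (hr (r / 2)) => //=.
- by rewrite sub0r normrN gtr0_norm ?divr_gt0// ltr_pdivrMr// ltr_pMr// ltr1n.
- by rewrite divr_gt0.
Qed.

(* [b |-> ginv t * b t - Jint b t] is, by parts, the integral of [ginv] against [db]. *)
Definition Wpath b t : R := ginv t * b t - Jint b t.

Lemma XpathW b t : Xpath b t = wext t * Wpath b t.
Proof.
have /andP[w0 _] := wext_bnd t.
rewrite /Xpath /Wpath /ginv mulrBr mulrA mulfV ?mul1r// gt_eqF//.
Qed.

(** The error of one left-endpoint term is the integral over []u, v]] of [(b v - b s) * gder s],
    because [gder] has mass [ginv v - ginv u] there. *)
Lemma Wpath_step b u v (e : R) : continuous b -> 0 <= u -> u <= v ->
  (forall s, u <= s -> s <= v -> `|b v - b s| <= e) ->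
  `|Wpath b v - Wpath b u - ginv u * (b v - b u)| <= e * (ginv v - ginv u).
Proof.
move=> cb u0 uv he.
have v0 : 0 <= v by exact: le_trans uv.
have sub : `]u, v] `<=` `[0, v].
  by move=> s /=; rewrite !in_itv/= => /andP[/ltW us ->]; rewrite (le_trans u0).
have mI : measurable (`]u, v]%classic : set (measurableTypeR R)) by exact: measurable_itv.
have iJ := integrable_mul_gder v cb measurable_gder norm_gder.
have i1 : leb.-integrable `]u, v] (EFin \o (fun x => b x * gder x)) by exact: integrableS iJ.
have i2 : leb.-integrable `]u, v] (EFin \o gder).
  by apply: integrableS (integrable_gder v).
have iZ k : leb.-integrable `]u, v] (EFin \o (fun x => k * gder x)).
  have -> : (EFin \o (fun x => k * gder x)) = (fun x => k%:E * (gder x)%:E)%E by [].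
  exact: integrableZl.
have J : Jint b v - Jint b u = \int[leb]_(x in `]u, v]) (b x * gder x).
  by rewrite /Jint Rintegral_itvB.
have bv : \int[leb]_(x in `]u, v]) (b v * gder x) = b v * (ginv v - ginv u).
  by rewrite RintegralZl// Rintegral_gder.
have -> : Wpath b v - Wpath b u - ginv u * (b v - b u) =
    \int[leb]_(x in `]u, v]) (b v * gder x - b x * gder x).
  rewrite (RintegralB mI (iZ (b v)) i1).
  by rewrite bv -J /Wpath; ring.
have i3 : leb.-integrable `]u, v] (EFin \o (fun x => b v * gder x - b x * gder x)).
  exact: (integrableB mI (iZ (b v)) i1).
apply: le_trans (le_normr_Rintegral mI i3) _.
rewrite -(Rintegral_gder u0 uv) -RintegralZl//.
apply: le_Rintegral => //; first exact: integrable_norm.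
move=> s; rewrite /= in_itv/= => /andP[us sv].
rewrite -mulrBl normrM (ger0_norm (gder_ge0 s)) ler_wpM2r ?gder_ge0//.
by apply: he => //; exact: ltW.
Qed.

Definition part_pt u v (n i : nat) : R := u + (v - u) * i%:R / n.+1%:R.

Lemma part_pt0 u v n : part_pt u v n 0 = u.
Proof. by rewrite /part_pt mulr0 mul0r addr0. Qed.

Lemma part_ptn u v n : part_pt u v n n.+1 = v.
Proof. by rewrite /part_pt mulfK ?pnatr_eq0// addrC subrK. Qed.

Lemma part_pt_le u v n i j : u <= v -> (i <= j)%N -> part_pt u v n i <= part_pt u v n j.
Proof.
move=> uv ij; rewrite /part_pt lerD2l ler_wpM2r ?invr_ge0//.
by rewrite ler_wpM2l ?subr_ge0// ler_nat.
Qed.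

Lemma part_ptS u v n i : part_pt u v n i.+1 - part_pt u v n i = (v - u) / n.+1%:R.
Proof. by rewrite /part_pt -natr1; ring. Qed.

Lemma mesh_lt u v (de : R) : u <= v -> 0 < de ->
  \forall n \near \oo, (v - u) / n.+1%:R < de.
Proof.
move=> uv de0.
have c : ((v - u) * n.+1%:R^-1) @[n --> \oo] --> (0 : R).
  rewrite -[X in _ --> X](mulr0 (v - u)); apply: cvgM; first exact: cvg_cst.
  exact: cvg_harmonic.
move/cvgrPdist_lt : c => /(_ _ de0); apply: filterS => n.
by rewrite sub0r normrN ger0_norm// divr_ge0// subr_ge0.
Qed.

(** Both endpoints are compared: the right one serves [Wpath_step], the left one serves
    [part_sum_close]. *)
Lemma osc_part f u v (e : R) : continuous f -> u <= v -> 0 < e ->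
  \forall n \near \oo, forall i s, (i <= n)%N ->
    part_pt u v n i <= s -> s <= part_pt u v n i.+1 ->
    `|f (part_pt u v n i.+1) - f s| < e /\ `|f (part_pt u v n i) - f s| < e.
Proof.
move=> cf uv e0; have [de de0 hde] := @Heine f u v cf e e0.
have := mesh_lt uv de0; apply: filterS => n hn i s ni h1 h2.
rewrite -(part_ptS u v n i) in hn.
have a1 : u <= part_pt u v n i by rewrite -[leLHS](part_pt0 u v n) part_pt_le.
have a2 : part_pt u v n i.+1 <= v by rewrite -[leRHS](part_ptn u v n) part_pt_le.
split; apply: hde; rewrite ?in_itv/=.
- by apply/andP; split; lra.
- by rewrite ger0_norm ?subr_ge0//; lra.
- by apply/andP; split; lra.
- by rewrite ler0_norm ?subr_le0//; lra.
Qed.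

Definition Wsum b u v n : R := \sum_(i < n.+1)
  ginv (part_pt u v n i) * (b (part_pt u v n i.+1) - b (part_pt u v n i)).

Lemma Wsum_cvg b u v : continuous b -> 0 <= u -> u <= v ->
  Wsum b u v n @[n --> \oo] --> Wpath b v - Wpath b u.
Proof.
move=> cb u0 uv; apply/cvgrPdist_le => e e0.
(* The step errors add up to at most [ginv v - ginv u] times the oscillation; the added 1 keeps [D]
   positive when [u = v]. *)
pose D := ginv v - ginv u + 1.
have D0 : 0 < D by rewrite /D; have := ginv_le uv; lra.
have e1 : 0 < e / D by rewrite divr_gt0.
have := osc_part cb uv e1; apply: filterS => n hn.
have tel (F : R -> R) : F v - F u = \sum_(i < n.+1) (F (part_pt u v n i.+1) - F (part_pt u v n i)).
  rewrite -(big_mkord xpredT (fun i => F (part_pt u v n i.+1) - F (part_pt u v n i))).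
  by rewrite telescope_sumr// part_pt0 part_ptn.
rewrite (tel (Wpath b)) /Wsum -sumrB.
apply: le_trans (ler_norm_sum _ _ _) _.
have -> : e = e / D * D by rewrite divfK// gt_eqF.
apply: (@le_trans _ _ (e / D * (ginv v - ginv u))); last first.
  by rewrite ler_wpM2l ?ltW// /D; lra.
rewrite (tel ginv) mulr_sumr; apply: ler_sum => i _.
apply: Wpath_step => //.
- by apply: le_trans u0 _; rewrite -[leLHS](part_pt0 u v n) part_pt_le.
- exact: part_pt_le.
- move=> s h1 h2; apply/ltW.
  by have [] := hn i s (ltn_ord i) h1 h2.
Qed.

Lemma sum_part_indic u v n s : u <= v ->
  \sum_(i < n.+1) (s \in `]part_pt u v n i, part_pt u v n i.+1])%:R =
  (s \in `]u, v])%:R :> R.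
Proof.
move=> uv.
(* As a difference of two truth values the indicator of []x, y]] telescopes along the partition. *)
have ind x y : x <= y -> (s \in `]x, y])%:R = (s <= y)%R%:R - (s <= x)%R%:R :> R.
  move=> xy; rewrite in_itv/=; case: (leP s x) => sx /=; last by rewrite subr0.
  by rewrite (le_trans sx xy) subrr.
under eq_bigr => i _ do rewrite ind ?part_pt_le//.
rewrite -(big_mkord xpredT (fun i => (s <= part_pt u v n i.+1)%R%:R - (s <= part_pt u v n i)%R%:R)).
by rewrite (telescope_sumr (fun i => (s <= part_pt u v n i)%R%:R))// part_pt0 part_ptn ind.
Qed.

(** Uniform in [s]. It yields both progressive measurability of continuous adapted processes and the
    convergence of the simple integrands. *)
Lemma part_sum_close f u v (e : R) : continuous f -> u <= v -> 0 < e ->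
  \forall n \near \oo, forall s,
  `|\sum_(i < n.+1) f (part_pt u v n i) * (s \in `]part_pt u v n i, part_pt u v n i.+1])%:R
    - f s * (s \in `]u, v])%:R| <= e.
Proof.
move=> cf uv e0; have := osc_part cf uv e0; apply: filterS => n hn s.
rewrite -(sum_part_indic n s uv) mulr_sumr -sumrB.
apply: le_trans (ler_norm_sum _ _ _) _.
apply: (@le_trans _ _ (e * \sum_(i < n.+1) (s \in `]part_pt u v n i, part_pt u v n i.+1])%:R)).
  rewrite mulr_sumr; apply: ler_sum => i _.
  rewrite -mulrBl normrM (ger0_norm (ler0n _ _)).
  case: (boolP (s \in _)) => [|_]; last by rewrite !mulr0.
  rewrite in_itv/= !mulr1 => /andP[h1 h2].
  by have [_ /ltW] := hn i s (ltn_ord i) (ltW h1) h2.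
rewrite sum_part_indic//; case: (_ \in _); rewrite ?mulr1// mulr0 ltW//.
Qed.

End riemann_sums.


(** * A version with continuous paths, and measurability with respect to the filtration *)

Section regular_version.
Context {R : realType} {d : measure_display} {Omega : measurableType d}.
Context (P : probability Omega R) (hP : measure_is_complete P).
Context (T : R) (hT : 0 < T) (B : R -> Omega -> R) (hB : brownian_motion P T B).
Implicit Types (s t a b : R).
Local Notation F t := (filtration P B t).
Local Notation FT t := (g_sigma_algebraType (filtration P B t)).

Definition clamp t : R := Num.min (Num.max 0 t) T.

Definition regular_path (x : Omega) : Prop :=
  B 0 x = 0 /\ {within `[0, T], continuous (fun t => B t x)}.

(* A version of [B] all of whose paths are continuous on the whole line. *)
Definition bm t (x : Omega) : R :=
  if pselect (regular_path x) then B (clamp t) x else 0.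

Lemma clamp_itv t : 0 <= clamp t <= T.
Proof. by rewrite /clamp le_min ge_min le_max !lexx (ltW hT) orbT. Qed.

Lemma clampE t : 0 <= t <= T -> clamp t = t.
Proof. by move=> /andP[t0 tT]; rewrite /clamp max_r// min_l. Qed.

Lemma continuous_clamp : continuous clamp.
Proof.
move=> t; apply: continuous_min; last exact: cvg_cst.
by apply: continuous_max; [exact: cvg_cst|exact: cvg_id].
Qed.

Lemma continuous_bm x : continuous (bm^~ x).
Proof.
have [h|h] := pselect (regular_path x); last first.
  have -> : bm^~ x = fun=> 0 by apply/funext => t; rewrite /bm; case: pselect.
  by move=> t; exact: cvg_cst.
have -> : bm^~ x = fun t => B (clamp t) x.
  by apply/funext => t; rewrite /bm; case: pselect.
case: h => [_ /subspace_continuousP c] t.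
have ct : `[0, T]%classic (clamp t) by rewrite /= in_itv/= clamp_itv.
have := c _ ct; apply: cvg_comp => A; rewrite /within/= => hA.
have h : nbhs t [set s | `[0, T]%classic (clamp s) -> A (clamp s)] := continuous_clamp hA.
apply: (@filterS _ (nbhs t) _ _ _ _ h) => s /= hs; apply: hs.
by have := clamp_itv s; rewrite /= in_itv.
Qed.

Lemma bm0 x : bm 0 x = 0.
Proof. by rewrite /bm; case: pselect => //= -[b0 _]; rewrite clampE ?lexx ?ltW. Qed.

Lemma bm_ae : {ae P, forall x, forall t, 0 <= t <= T -> bm t x = B t x}.
Proof.
case: hB => _ h0 hc _ _.
apply: filterS2 h0 hc => x b0 bc t t0T; rewrite /bm clampE//.
by case: pselect => // -[]; split.
Qed.

(** The completed filtration contains every subset of a null set, so altering an adapted variable on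
    a null set keeps it adapted. *)
Lemma adapted_ae t (f g : Omega -> R) : measurable_fun setT (f : FT t -> R) ->
  {ae P, forall x, f x = g x} -> measurable_fun setT (g : FT t -> R).
Proof.
move=> mf [N [mN N0 hN]] _ Y mY.
have nN : P.-negligible N by exists N; split.
have mFN : (@measurable _ (FT t)) N by exact: negligible_filtration.
have -> : setT `&` (g : FT t -> R) @^-1` Y =
    (((f : FT t -> R) @^-1` Y) `\` N) `|` ((g : FT t -> R) @^-1` Y `&` N).
  apply/seteqP; split => [x [_ gY]|x].
    have [Nx|Nx] := pselect (N x); [by right|left; split => //=].
    have -> : f x = g x by apply: contrapT => h; apply: Nx; exact: hN.
    by [].
  move=> [[fY Nx]|[gY _]]; split => //=.
  have <- : f x = g x by apply: contrapT => h; apply: Nx; exact: hN.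
  by [].
apply: measurableU.
  by apply: measurableD => //; rewrite -[_ @^-1` _]setTI; exact: mf.
apply: negligible_filtration; apply: negligibleS nN; exact: subIsetr.
Qed.

Lemma bm_adapted s t : 0 <= s -> s <= t -> s <= T -> measurable_fun setT (bm s : FT t -> R).
Proof.
move=> s0 st sT; have h : {ae P, forall x, B s x = bm s x}.
  by apply: filterS bm_ae => x /(_ s) ->//; rewrite s0.
exact: adapted_ae (brownian_adapted s0 st) h.
Qed.

Lemma continuous_adapted_progressive (X : R -> Omega -> R) :
  (forall x, continuous (X^~ x)) ->
  (forall t, 0 <= t <= T -> measurable_fun setT (X t : FT t -> R)) ->
  progressive P B T X.
Proof.
move=> cX aX t /andP[t0 tT].
pose tp := part_pt 0 t.
have tp0 n i : 0 <= tp n i.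
  by rewrite -[leLHS](part_pt0 0 t n) part_pt_le.
(* Left-endpoint step processes on half-open intervals miss time 0, which the last summand
   restores. *)
pose h n (p : R * FT t) : R := \sum_(i < n.+1) X (tp n i) p.2 *
  (p.1 \in `]tp n i, tp n i.+1])%:R + X 0 p.2 * (p.1 \in `]-oo, 0])%:R.
have mX s : 0 <= s -> s <= t -> measurable_fun setT (fun p : R * FT t => X s p.2).
  move=> s0 st; have m1 : measurable_fun setT (X s : FT t -> R).
    by apply: (filtration_le_fun st); apply: aX; rewrite s0 (le_trans st).
  exact: (measurableT_comp m1 measurable_snd).
have mI (i : interval R) : measurable_fun setT (fun p : R * FT t => (p.1 \in i)%:R : R).
  have -> : (fun p : R * FT t => (p.1 \in i)%:R : R) = (\1_[set` i] : R -> R) \o fst.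
    by apply/funext => p /=; rewrite indicE mem_setE.
  have m1 : measurable_fun setT (\1_[set` i] : R -> R).
    by apply: measurable_indic; exact: measurable_itv.
  exact: (measurableT_comp m1 measurable_fst).
apply: (@measurable_fun_cvg _ _ _ _ h).
- move=> n; apply: measurable_funTS; apply: measurable_funD; last first.
    by apply: measurable_funM; [exact: mX|exact: mI].
  apply: measurable_sum => i; apply: measurable_funM; last exact: mI.
  apply: mX => //; rewrite -[leRHS](part_ptn 0 t n) /tp part_pt_le//.
  exact: ltnW.
- move=> [s x] [/= s0t _]; move: s0t; rewrite in_itv/= => /andP[s0 st].
  apply/cvgrPdist_le => e e0.
  have := part_sum_close (cX x) t0 e0; apply: filterS => n /(_ s) hn.
  rewrite /h /= distrC; apply: le_trans hn.
  rewrite le_eqVlt; apply/orP; left; apply/eqP; congr (`|_|).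
  rewrite !in_itv/= st andbT; case: (leP s 0) => [s0'|s0'].
    have -> : s = 0 by apply/eqP; rewrite eq_le s0'.
    by rewrite !mulr1 !mulr0; ring.
  by rewrite !mulr0 !mulr1; ring.
Qed.

(** The integral of [ginv] against [dB], defined for every outcome and continuous in time. *)
Definition wiener t (x : Omega) : R := Wpath (bm^~ x) t.

Lemma wiener0 x : wiener 0 x = 0.
Proof. by rewrite /wiener /Wpath bm0 Jint_le0// mulr0 subr0. Qed.

Lemma continuous_wiener x : continuous (wiener^~ x).
Proof.
move=> t; apply: cvgB; last by apply: continuous_Jint; exact: continuous_bm.
by apply: cvgM; [exact: continuous_ginv|exact: continuous_bm].
Qed.

(** [Wpath] contains a time integral of the path; adaptedness is read off instead from the Riemann
    sums, which involve finitely many values of [bm]. *)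
Lemma wiener_adapted t : 0 <= t <= T -> measurable_fun setT (wiener t : FT t -> R).
Proof.
move=> /andP[t0 tT].
apply: (@measurable_fun_cvg _ _ _ _ (fun n (x : FT t) => Wsum (bm^~ x) 0 t n)).
- move=> n; rewrite /Wsum; apply: measurable_sum => i.
  have h j : (j <= n.+1)%N -> measurable_fun setT (bm (part_pt 0 t n j) : FT t -> R).
    move=> jn; apply: bm_adapted.
    + by rewrite -[leLHS](part_pt0 0 t n) part_pt_le.
    + by rewrite -[leRHS](part_ptn 0 t n) part_pt_le.
    + by rewrite (le_trans _ tT)// -[leRHS](part_ptn 0 t n) part_pt_le.
  by apply: measurable_funM => //; apply: measurable_funB; apply: h => //; exact: ltnW.
- move=> x _; have := Wsum_cvg (@continuous_bm x) (lexx 0) t0.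
  by rewrite -[Wpath _ 0]/(wiener 0 x) wiener0 subr0.
Qed.

Lemma scaled_wiener_progressive (k : R -> R) : continuous k ->
  progressive P B T (fun t x => k t * wiener t x).
Proof.
move=> ck; apply: continuous_adapted_progressive.
  by move=> x t; apply: cvgM; [exact: ck|exact: continuous_wiener].
by move=> t t0T; apply: measurable_funM => //; exact: wiener_adapted.
Qed.

Lemma deterministic_progressive (k : R -> R) : measurable_fun setT k ->
  progressive P B T (fun t _ => k t).
Proof.
move=> mk t _; apply: measurable_funTS.
exact: (measurableT_comp (f := k) mk measurable_fst).
Qed.

End regular_version.


(** * From pathwise to mean-square convergence of the Riemann sums *)

Section fatou_square.
Context d (T : measurableType d) (R : realType).
Variables (mu : {measure set T -> \bar R}).
Implicit Types f g h : T -> R.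

Lemma fatou_sqdist (f_ : nat -> T -> R) f g (c : \bar R) :
  (forall n, measurable_fun setT (f_ n)) -> measurable_fun setT f -> measurable_fun setT g ->
  {ae mu, forall x, f_ n x @[n --> \oo] --> f x} ->
  (\forall n \near \oo, (sqdist mu setT (f_ n) g <= c)%E) ->
  (sqdist mu setT f g <= c)%E.
Proof.
move=> mfn mf mg cf [N _ hN].
(* Shifting by [N] makes the eventual bound hold at every index. *)
pose h n x := (((f_ (n + N)%N x - g x) ^+ 2)%:E).
have mh n : measurable_fun setT (h n).
  by apply/measurable_EFinP; apply: measurable_funX; exact: measurable_funB.
have h0 n x : setT x -> (0 <= h n x)%E by rewrite lee_fin sqr_ge0.
have e : (sqdist mu setT f g = \int[mu]_x limn_einf (h^~ x))%E.
  apply: ae_eq_integral => //.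
  - by apply/measurable_EFinP; apply: measurable_funX; exact: measurable_funB.
  - rewrite /limn_einf; apply: measurableT_comp => //.
    apply: measurable_fun_limn_esup => n; exact: measurableT_comp.
  - apply: filterS cf => x cx _; have c2 : h n x @[n --> \oo] --> ((f x - g x) ^+ 2)%:E.
      apply: cvg_EFin; first exact: nearW.
      have c3 : (f_ (n + N)%N x) @[n --> \oo] --> f x by rewrite (cvg_shiftn N (f_^~ x)).
      rewrite expr2; under eq_cvg do rewrite /= expr2.
      by apply: cvgM; apply: cvgB => //; exact: cvg_cst.
    by case: (cvg_limn_einf_sup c2).
rewrite e; apply: le_trans (fatou mu measurableT mh h0) _.
apply: le_trans (limn_einf_sup _) _.
rewrite limn_esup_lim; apply: lime_le; first exact: is_cvg_esups.
apply: nearW => n; apply: ge_ereal_sup => _ [k /= nk <-].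
by apply: hN; rewrite /= leq_addl.
Qed.

End fatou_square.

Section wiener_integral.
Context {R : realType} {d : measure_display} {Omega : measurableType d}.
Context (P : probability Omega R) (hP : measure_is_complete P).
Context (T : R) (hT : 0 < T) (B : R -> Omega -> R) (hB : brownian_motion P T B).
Implicit Types (s t u v c : R).
Local Notation F t := (filtration P B t).
Local Notation FT t := (g_sigma_algebraType (filtration P B t)).
Notation leb := (@lebesgue_measure R).
Local Notation TR := (measurableTypeR R).
Local Notation W := (wiener T B).

Lemma ip_strip_le t (h : TR * Omega -> R) (M : R) : 0 <= t -> 0 <= M ->
  sqint (leb \x P)%E (strip t) h -> (forall p, strip t p -> `|h p| <= M) ->
  ip (leb \x P)%E (strip t) h h <= M ^+ 2 * t.
Proof.
move=> t0 M0 sh hM; have mS := measurable_strip (Omega := Omega) t.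
have s1 : sqint (leb \x P)%E (strip t) (fun=> M).
  by apply: (@bounded_sqint_strip _ _ _ P t _ M) => // p _; rewrite ger0_norm.
have -> : M ^+ 2 * t = ip (leb \x P)%E (strip t) (fun=> M) (fun=> M).
  rewrite /ip Rintegral_cst// expr2; congr (_ * _).
  by rewrite [X in fine X](_ : _ = t%:E)//; exact: strip_measure.
apply: le_Rintegral => //; [exact: sqint_mul|exact: sqint_mul|].
move=> p Sp; rewrite -!expr2 -(real_normK (num_real (h p))) ler_sqr ?nnegrE//; exact: hM.
Qed.

Section approximation.
Variables (c u v : R).
Hypotheses (u0 : 0 <= u) (uv : u <= v) (vT : v <= T).

Definition part_process n : @simple_process R d Omega :=
  SimpleProcess n.+1 (part_pt u v n) (fun i _ => c * ginv (part_pt u v n i)).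

Lemma part_process_predictable t n : v <= t -> simple_predictable P B t (part_process n).
Proof.
move=> vt; split => /=.
- by rewrite part_pt0.
- by rewrite part_ptn.
- by move=> i _; exact: part_pt_le.
- move=> i _; split; first exact: measurable_cst.
  by exists `|c * ginv (part_pt u v n i)|.
Qed.

Let part_itv n i : (i <= n.+1)%N -> 0 <= part_pt u v n i <= T.
Proof.
move=> ni; apply/andP; split.
  by apply: le_trans u0 _; rewrite -[leLHS](part_pt0 u v n) part_pt_le.
by apply: le_trans vT; rewrite -[leRHS](part_ptn u v n) part_pt_le.
Qed.

Lemma part_integral_cvg : {ae P, forall x,
  simple_integral B (part_process n) x @[n --> \oo] --> c * (W v x - W u x)}.
Proof.
apply: filterS (bm_ae hB) => x hx.
have cb := @continuous_bm _ _ _ _ hT B x.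
have cW := Wsum_cvg cb u0 uv.
have -> : (fun n => simple_integral B (part_process n) x) =
    (fun n => c * Wsum ((bm T B)^~ x) u v n).
  apply/funext => n; rewrite /simple_integral /Wsum mulr_sumr; apply: eq_bigr => i _ /=.
  by rewrite mulrA !hx// part_itv// ltnW.
by apply: cvgM => //; exact: cvg_cst.
Qed.

Lemma part_eval_close (e : R) : 0 < e -> \forall n \near \oo, forall s x,
  `|simple_eval (part_process n) s x - c * ginv s * (s \in `]u, v])%:R| <= e.
Proof.
move=> e0; have cg : continuous (fun s => c * ginv s).
  by move=> s; apply: cvgM; [exact: cvg_cst|exact: continuous_ginv].
by have := part_sum_close cg uv e0; apply: filterS => n hn s x; exact: hn.
Qed.

(** The simple integrals converge almost surely, and by the isometry they are close to each other
    once their integrands are uniformly close. Fatou's lemma, with [n] fixed and [m] growing, turns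
    this into a bound on the distance to the pathwise limit. *)
Lemma wiener_incr_l2 : sqint P setT (fun x => c * (W v x - W u x)) /\
  sqdist P setT (simple_integral B (part_process n)) (fun x => c * (W v x - W u x))
    @[n --> \oo] --> 0%E.
Proof.
have v0 : 0 <= v by exact: le_trans uv.
have uT : u <= T by exact: le_trans vT.
have hpp n := part_process_predictable n (lexx v).
have sS n := simple_integral_sqint hP hB vT (hpp n).
have sE n := simple_eval_sqint hP hB vT (hpp n).
have mW s : 0 <= s -> s <= T -> measurable_fun setT (W s).
  move=> s0 sT; apply: (sub_measurable_fun (filtration_measurable hP hB sT)).
  by apply: wiener_adapted => //; rewrite s0.
have mD : measurable_fun setT (fun x => c * (W v x - W u x)).
  by apply: measurable_funM => //; apply: measurable_funB; exact: mW.
have bound (e : R) : 0 < e -> \forall n \near \oo,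
    (sqdist P setT (simple_integral B (part_process n)) (fun x => c * (W v x - W u x))%R <=
     ((2 * e) ^+ 2 * v)%:E)%E.
  move=> e0; have [N _ hN] := part_eval_close e0.
  exists N => // n /= Nn; rewrite /sqdist.
  under eq_integral do rewrite -sqrrN opprB.
  apply: (@fatou_sqdist _ _ _ P (fun m => simple_integral B (part_process m))) => //.
  - by move=> m; case: (sS m).
  - by case: (sS n).
  - exact: part_integral_cvg.
  exists N => // m /= Nm; rewrite sqdistE// lee_fin.
  rewrite (simple_isometry hP hB vT (hpp m) (hpp n)).
  apply: ip_strip_le => //; first by rewrite mulr_ge0// ltW.
    by apply: sqintB => //; exact: measurable_strip.
  move=> p _; set a := simple_eval _ _ _; set b := simple_eval _ _ _.
  pose z := c * ginv p.1 * (p.1 \in `]u, v])%:R.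
  (* Both integrands are within [e] of their common limit, hence the factor 2 in [bound]. *)
  have -> : a - b = (a - z) - (b - z) by ring.
  apply: le_trans (ler_normB _ _) _; rewrite mulr_natl mulr2n.
  by apply: lerD; [exact: hN|exact: hN].
have sD : sqint P setT (fun x => c * (W v x - W u x)).
  have [N _ /(_ N (leqnn _))/= hN] := bound 1 ltr01.
  have hd : sqint P setT (fun x => simple_integral B (part_process N) x - c * (W v x - W u x)).
    have md : measurable_fun setT (fun x => simple_integral B (part_process N) x - c * (W v x - W u x)).
      by apply: measurable_funB => //; case: (sS N).
    split => //; apply/integrableP; split.
      by apply/measurable_EFinP; exact: measurable_funX.
    under eq_integral do rewrite gee0_abs ?lee_fin ?sqr_ge0//.
    exact: le_lt_trans hN (ltry _).
  by have := sqintB measurableT (sS N) hd; congr sqint; apply/funext => x /=; ring.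
split => //.
have e1 n := sqdistE measurableT (sS n) sD.
rewrite (funext e1); apply: cvg_EFin; first exact: nearW.
apply/cvgrPdist_le => e e0.
(* Chosen so that [(2 * k) ^+ 2 * v = e * v / (v + 1) <= e]; the added 1 covers [v = 0]. *)
pose k := Num.sqrt (e / (v + 1)) / 2.
have v1 : 0 < v + 1 by lra.
have k0 : 0 < k by rewrite divr_gt0// sqrtr_gt0 divr_gt0.
have := bound k k0; apply: filterS => n; rewrite e1 lee_fin /= => hn.
rewrite sub0r normrN ger0_norm ?ip_ge0//; apply: le_trans hn _.
have -> : (2 * k) ^+ 2 = e / (v + 1).
  by rewrite /k mulrCA divff// mulr1 sqr_sqrtr// divr_ge0// ltW.
by rewrite mulrAC ler_pdivrMr// ler_wpM2l ?ltW//; lra.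
Qed.

(** The martingale property of [W] in integrated form: each increment of [B] after [u] is orthogonal
    to an event of time [u], and this survives the mean-square limit. *)
Lemma wiener_incr_orth A : <<s F u >> A ->
  ip P setT (fun x => c * (W v x - W u x)) (\1_A) = 0.
Proof.
move=> hA; have uT : u <= T by exact: le_trans vT.
have [sD cD] := wiener_incr_l2.
have sS n := simple_integral_sqint hP hB vT (part_process_predictable n (lexx v)).
have bA t : u <= t -> bounded_adapted P B t (\1_A : Omega -> R).
  move=> ut; apply: (bounded_adapted_le ut); split.
    have mA : (@measurable _ (FT u)) A by exact: hA.
    exact: (measurable_indic (T := FT u) mA).
  by exists 1 => x; rewrite indicE; case: (_ \in _); rewrite ?normr1 ?normr0.
have sA : sqint P setT (\1_A : Omega -> R).
  have := bounded_sqint hP hB uT (bA u (lexx u)) (sqint_cst P 1).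
  by congr sqint; apply/funext => x; rewrite mulr1.
have cI := ip_cvg measurableT sS sD sA cD.
have z n : ip P setT (simple_integral B (part_process n)) (\1_A) = 0.
  have pT i : (i < n.+1)%N -> part_pt u v n i.+1 <= T.
    by move=> iN; case/andP: (part_itv iN).
  have p0 i : (i < n.+1)%N -> 0 <= part_pt u v n i.
    by move=> iN; case/andP: (part_itv (ltnW iN)).
  pose X (i : 'I_n.+1) x : R := c * ginv (part_pt u v n i) *
    (B (part_pt u v n i.+1) x - B (part_pt u v n i) x).
  have sX i : sqint P setT (X i).
    apply: sqintZ => //; apply: (sqint_incr hB); [exact: p0|exact: part_pt_le|exact: pT].
  rewrite [LHS](ip_suml measurableT _ sX sA); apply: big1 => i _.
  rewrite /X ipZl//; last by apply: (sqint_incr hB); [exact: p0|exact: part_pt_le|exact: pT].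
  rewrite ipC [X in _ * X](_ : _ = 0) ?mulr0//.
  apply: (mean_mul_incr hP hB); [exact: p0|exact: part_pt_le|exact: pT| |].
    by have [] := bA (part_pt u v n i) _; rewrite // -[leLHS](part_pt0 u v n) part_pt_le.
  exact: sqint_integrable.
rewrite (funext z) in cI.
by have := cvg_unique (@norm_hausdorff _ R) cI (cvg_cst _) => ->.
Qed.

End approximation.
End wiener_integral.


(** * The extended-real L2 norm expressed through the inner product *)

Section l2norm.
Context d (T : measurableType d) (R : realType) (P : probability T R).
Implicit Types f g : T -> R.

Lemma L2normE f : L2norm P f = ((\int[P]_x (f x ^+ 2)%:E) `^ 2^-1)%E.
Proof.
rewrite /L2norm unlock /Lnorm; congr (_ `^ _)%E; apply: eq_integral => x _.
by rewrite /= powR_mulrn// real_normK// num_real.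
Qed.

Lemma L2norm_ge0 f : (0 <= L2norm P f)%E.
Proof. exact: Lnorm_ge0. Qed.

Lemma sq_L2norm f : (\int[P]_x (f x ^+ 2)%:E)%E = ((L2norm P f) `^ 2)%E.
Proof.
have i0 : (0 <= \int[P]_x (f x ^+ 2)%:E)%E.
  by apply: integral_ge0 => x _; rewrite lee_fin sqr_ge0.
by rewrite L2normE -poweRrM mulVf// poweRe1.
Qed.

Lemma sqint_L2norm f : sqint P setT f -> L2norm P f = (Num.sqrt (ip P setT f f))%:E.
Proof.
move=> [mf sf]; rewrite L2normE.
have fin := integrable_fin_num measurableT sf.
have -> : (\int[P]_x (f x ^+ 2)%:E)%E = (ip P setT f f)%:E.
  by rewrite /ip /Rintegral; under [in RHS]eq_integral do rewrite -expr2; rewrite fineK.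
by rewrite poweR_EFin powR12_sqrt// ip_ge0.
Qed.

Lemma L2norm_sqint f : measurable_fun setT f -> (L2norm P f < +oo)%E -> sqint P setT f.
Proof.
move=> mf nf; split => //; apply/integrableP; split.
  by apply/measurable_EFinP; exact: measurable_funX.
under eq_integral do rewrite gee0_abs ?lee_fin ?sqr_ge0//.
by rewrite sq_L2norm poweR_lty.
Qed.

End l2norm.

Section wiener_ito.
Context {R : realType} {d : measure_display} {Omega : measurableType d}.
Context (P : probability Omega R) (hP : measure_is_complete P).
Context (T : R) (hT : 0 < T) (B : R -> Omega -> R) (hB : brownian_motion P T B).
Implicit Types (s t u v c : R).
Local Notation F t := (filtration P B t).
Local Notation FT t := (g_sigma_algebraType (filtration P B t)).
Notation leb := (@lebesgue_measure R).
Local Notation TR := (measurableTypeR R).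
Local Notation W := (wiener T B).

Lemma ae_fst (Q : R -> Prop) : {ae leb, forall s, Q s} ->
  {ae (leb \x P)%E, forall p : TR * Omega, Q p.1}.
Proof.
move=> [N [mN N0 hN]]; exists (N `*` setT); split.
- exact: measurableX.
- rewrite product_measure1E// [X in (X * _)%E](_ : _ = 0%E) ?mul0e//.
- by move=> p /= hp; split => //; exact: hN.
Qed.

Lemma ito_isometry t Z I : 0 <= t <= T -> ito_integral P B t Z I ->
  ip P setT I I = ip (leb \x P)%E (strip t) (fun p => Z p.1 p.2) (fun p => Z p.1 p.2).
Proof.
move=> t0T hI; have /andP[t0 tT] := t0T.
have [sZ sI] := ito_sqint hP hB t0T hI.
case: hI => [_ _ _ [H [hH cH cI]]].
have mS := measurable_strip (Omega := Omega) t.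
have sH n := simple_eval_sqint hP hB tT (hH n).
have siH n := simple_integral_sqint hP hB tT (hH n).
have c1 := sqnorm_cvg mS sH sZ cH.
have c2 := sqnorm_cvg measurableT siH sI cI.
rewrite (funext (fun n => simple_isometry1 hP hB tT (hH n))) in c2.
by have := cvg_unique (@norm_hausdorff _ R) c2 c1; apply.
Qed.

Lemma ginv_strip_sqint c t : 0 <= t ->
  sqint (leb \x P)%E (strip t) (fun p => c * ginv p.1).
Proof.
move=> t0; apply: (@bounded_sqint_strip _ _ _ P t _ (`|c| * ginv t)) => //.
  apply: measurable_funTS; apply: measurable_funM => //.
  exact: (measurableT_comp measurable_ginv measurable_fst).
move=> p [/= p1 _]; rewrite normrM ler_wpM2l//.
rewrite ger0_norm; last by apply: le_trans ler01 (ginv_ge1 _).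
by apply: ginv_le; move: p1; rewrite in_itv/= => /andP[].
Qed.

Lemma wiener_ito c t : 0 <= t <= T ->
  ito_integral P B t (fun s _ => c * ginv s) (fun x => c * W t x).
Proof.
move=> t0T; have /andP[t0 tT] := t0T.
have sZ := ginv_strip_sqint c t0.
have mS := measurable_strip (Omega := Omega) t.
split.
- apply: deterministic_progressive.
  by apply: measurable_funM => //; exact: measurable_ginv.
- have [_ /integrableP[_]] := sZ; congr (_ < _)%E; apply: eq_integral => p _.
  by rewrite subr0 gee0_abs ?lee_fin ?sqr_ge0.
- apply: measurable_funM => //; apply: (sub_measurable_fun (filtration_measurable hP hB tT)).
  exact: wiener_adapted.
pose H : nat -> @simple_process R d Omega := part_process c 0 t.
exists H; split.
- by move=> n; apply: part_process_predictable.
- have hpp n : simple_predictable P B t (H n) by exact: part_process_predictable.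
  have sE n := simple_eval_sqint hP hB tT (hpp n).
  (* The simple integrands vanish at [s = 0], so their uniform limit is [Z1]; it differs from the
     integrand only on the null set of time 0. *)
  pose Z1 (p : TR * Omega) := c * ginv p.1 * (p.1 \in `]0, t])%:R.
  have sZ1 : sqint (leb \x P)%E (strip t) Z1.
    apply: sqint_le sZ _ => //.
      apply: measurable_funTS; apply: measurable_funM.
        apply: measurable_funM => //.
        exact: (measurableT_comp measurable_ginv measurable_fst).
      have -> : (fun p : TR * Omega => (p.1 \in `]0, t])%:R : R) = (\1_(`]0, t]%classic) : TR -> R) \o fst.
        by apply/funext => p /=; rewrite indicE mem_setE.
      have m1 : measurable_fun setT (\1_(`]0, t]%classic) : TR -> R).
        by apply: measurable_indic; exact: measurable_itv.
      exact: (measurableT_comp m1 measurable_fst).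
    move=> p _; rewrite /Z1 normrM ler_piMr//.
    by case: (_ \in _); rewrite ?normr1 ?normr0.
  have e n : L2dist2 P t (simple_eval (H n)) (fun s _ => c * ginv s) =
    (ip (leb \x P)%E (strip t) (fun p => simple_eval (H n) p.1 p.2 - Z1 p)
     (fun p => simple_eval (H n) p.1 p.2 - Z1 p))%:E.
    rewrite -sqdistE//; apply: ae_eq_integral => //.
    + by apply/measurable_EFinP; apply: measurable_funX; apply: measurable_funB; [case: (sE n)|case: sZ].
    + by apply/measurable_EFinP; apply: measurable_funX; apply: measurable_funB; [case: (sE n)|case: sZ1].
    have ne0 : {ae leb, forall s : R, s <> 0}.
      exists [set 0]; split; [exact: measurable_set1|exact: lebesgue_measure_set1|].
      by move=> s /= /contrapT.
    apply: filterS (ae_fst ne0) => p p0 [/= p1 _].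
    rewrite /Z1; have -> : p.1 \in `]0, t]; last by rewrite mulr1.
    move: p1; rewrite !in_itv/= => /andP[p1 ->]; rewrite andbT lt_neqAle p1 andbT eq_sym.
    exact/eqP.
  rewrite (funext e); apply: cvg_EFin; first exact: nearW.
  apply/cvgrPdist_le => ep ep0.
  pose k := Num.sqrt (ep / (t + 1)).
  have t1 : 0 < t + 1 by lra.
  have k0 : 0 < k by rewrite sqrtr_gt0 divr_gt0.
  have hc : \forall n \near \oo, forall s (x : Omega),
      `|simple_eval (H n) s x - c * ginv s * (s \in `]0, t])%:R| <= k.
    exact: part_eval_close.
  apply: filterS hc => n hn.
  rewrite sub0r normrN ger0_norm ?ip_ge0//.
  apply: (@le_trans _ _ (k ^+ 2 * t)).
    exact: (ip_strip_le t0 (ltW k0) (sqintB mS (sE n) sZ1) (fun p _ => hn p.1 p.2)).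
  rewrite sqr_sqrtr; last by apply: divr_ge0; exact: ltW.
  rewrite mulrAC ler_pdivrMr//; apply: ler_wpM2l; first exact: ltW.
  by rewrite lerDl.
- have [_ h] := wiener_incr_l2 hP hT hB c (lexx 0) t0 tT.
  have e : (fun x => c * (W t x - W 0 x)) = (fun x => c * W t x).
    by apply/funext => x; rewrite (wiener0 hT) subr0.
  by move: h; rewrite e.
Qed.

Lemma ginv_sq_integral t : 0 < t ->
  (\int[leb]_(s in `[0%R, t]) (ginv s ^+ 2)%:E = ((ginv t - 1) ^+ 2 / (2 * theta))%:E)%E.
Proof.
(* The derivative of [G] is [(ginv s - 1) * gder s / theta], and
   [ginv s - 1 = (1 - wext s) / wext s] cancels the singular factor, leaving [ginv s ^+ 2]. *)
move=> t0; pose G s := (ginv s - 1) ^+ 2 / (2 * theta) : R.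
have G0 : G 0 = 0 by rewrite /G /ginv wext_le0// invr1 subrr expr0n mul0r.
rewrite (_ : (_ / _)%:E = (G t - G 0)%:E); last by rewrite G0 subr0.
apply: (@ge0_FTC2 _ G (fun s => ginv s ^+ 2) t t0).
- apply: cvg_at_right_filter; apply: cvgM; last exact: cvg_cst.
  have -> : (fun s => (ginv s - 1) ^+ 2) = (fun s : R => (ginv s - 1) * (ginv s - 1)).
    by apply/funext => s; rewrite expr2.
  rewrite expr2.
  by apply: cvgM; apply: cvgB; (exact: continuous_ginv || exact: cvg_cst).
- move=> s s0; have dg := is_derive_ginv s0.
  have th := @theta_gt0 R.
  have /andP[w0 _] := wext_bnd s; have w1 := wext_lt1 s0.
  rewrite /G; apply: is_derive_eq; rewrite /GRing.scale/= /gder /ginv.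
  by field; rewrite ?gt_eqF ?subr_gt0.
- have -> : (fun s => ginv s ^+ 2) = (fun s : R => ginv s * ginv s).
    by apply/funext => s; rewrite expr2.
  move=> s s0; rewrite /continuous_at.
  by apply: cvgM; exact: continuous_ginv.
- by move=> s _; exact: sqr_ge0.
Qed.

Lemma wiener_norm t : 0 <= t <= T ->
  ip P setT (W t) (W t) = (ginv t - 1) ^+ 2 / (2 * theta).
Proof.
move=> t0T; have /andP[t0 tT] := t0T.
have := ito_isometry t0T (wiener_ito 1 t0T).
rewrite (_ : (fun x => 1 * W t x) = W t); last by apply/funext => x; rewrite mul1r.
move=> ->; rewrite /ip /Rintegral.
rewrite tonelli_strip1//=; first last.
- move=> p _; rewrite lee_fin !mul1r -expr2; exact: sqr_ge0.
- apply/measurable_EFinP; have [m _] := ginv_strip_sqint 1 t0.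
  exact: measurable_funM.
under eq_integral => s _.
  rewrite [X in (\int[_]_(x in _) X x)%E](_ : _ = cst (ginv s ^+ 2)%:E); last first.
    by apply/funext => x; rewrite !mul1r expr2.
  rewrite integral_cst// [X in (_ * X)%E](_ : _ = 1%E) ?mule1; last exact: probability_setT.
  over.
move: t0; rewrite le_eqVlt => /predU1P[<-|t0]; last by rewrite /= ginv_sq_integral.
rewrite set_itv1 integral_set1 /ginv wext_le0// invr1 subrr expr0n mul0r//.
Qed.

Lemma wiener_sqint t : 0 <= t <= T -> sqint P setT (W t).
Proof.
move=> t0T; have [_] := ito_sqint hP hB t0T (wiener_ito 1 t0T).
by congr sqint; apply/funext => x; rewrite mul1r.
Qed.

(** Since [2 * theta = (2 * c0) ^+ 2], the variance in [wiener_norm] is a perfect square. *)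
Lemma wiener_scaled_norm c t : 0 <= t <= T -> 0 <= c ->
  L2norm P (fun x => c * W t x) = (c * (ginv t - 1) / (2 * c0))%:E.
Proof.
move=> t0T c_ge0; have sW := wiener_sqint t0T.
rewrite sqint_L2norm; last exact: sqintZ.
rewrite ipZl// ?(ipC _ _ (W t) (fun x => c * W t x)) ?ipZl//; last exact: sqintZ.
rewrite wiener_norm//; congr EFin.
have g1 : 0 <= ginv t - 1 by rewrite subr_ge0 ginv_ge1.
have c00 := @c0_gt0 R.
rewrite (_ : c * _ = (c * (ginv t - 1) / (2 * c0)) ^+ 2); last first.
  by rewrite /theta; field; rewrite gt_eqF.
by rewrite sqrtr_sqr ger0_norm// divr_ge0// ?mulr_ge0// ltW.
Qed.

End wiener_ito.


(** * Verification inequality *)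

Section normalization.
Context d (T : measurableType d) (R : realType) (P : probability T R).
Implicit Types f g : T -> R.

(** Valid for an infinite norm too, where both sides are 0. It gives measurability in time of the
    norm of a progressive process. *)
Lemma fine_L2norm f :
  fine (L2norm P f) = Num.sqrt (fine (\int[P]_x (f x ^+ 2)%:E)%E).
Proof.
rewrite L2normE.
have : (0 <= \int[P]_x (f x ^+ 2)%:E)%E.
  by apply: integral_ge0 => x _; rewrite lee_fin sqr_ge0.
case: (\int[P]_x _)%E => [r| |]//= r0; first by rewrite powR12_sqrt// -lee_fin.
by rewrite sqrtr0 invr_eq0 pnatr_eq0.
Qed.

Lemma L2norm_pos_sqint f : measurable_fun setT f -> (0 < L2norm P f < +oo)%E ->
  [/\ sqint P setT f, 0 < fine (L2norm P f) & ip P setT f f = fine (L2norm P f) ^+ 2].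
Proof.
move=> mf /andP[n0 n1]; have sf := L2norm_sqint mf n1.
split => //; first by apply: fine_gt0; rewrite n0.
by rewrite sqint_L2norm//= sqr_sqrtr// ip_ge0.
Qed.

Lemma L2norm_le_ip f c : 0 <= c -> measurable_fun setT f -> (L2norm P f <= c%:E)%E ->
  sqint P setT f /\ ip P setT f f <= c ^+ 2.
Proof.
move=> c_ge0 mf fc; have sf : sqint P setT f.
  by apply: L2norm_sqint => //; apply: le_lt_trans fc (ltry _).
split => //; move: fc; rewrite sqint_L2norm// lee_fin => fc.
by rewrite -[leLHS]sqr_sqrtr ?ip_ge0// lerXn2r ?nnegrE ?sqrtr_ge0.
Qed.

Lemma ip_normalized f : measurable_fun setT f -> (0 < L2norm P f < +oo)%E ->
  ip P setT (fun x => f x / fine (L2norm P f)) (fun x => f x / fine (L2norm P f)) = 1.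
Proof.
move=> mf nf; have [sf n0 ff] := L2norm_pos_sqint mf nf.
set n := fine _ in n0 ff *.
have -> : (fun x => f x / n) = (fun x => n^-1 * f x) by apply/funext => x; rewrite mulrC.
have sn : sqint P setT (fun x => n^-1 * f x) by exact: sqintZ.
by rewrite ipZl// ipC ipZl// ff; field; rewrite gt_eqF.
Qed.

(** If the norm is 0 or infinite, its [fine] is 0 and the quotient vanishes identically. The drift
    therefore satisfies the norm constraint at every time, exceptional ones included. *)
Lemma L2norm_normalized_le f : measurable_fun setT f ->
  (L2norm P (fun x => f x / fine (L2norm P f))%R <= 1)%E.
Proof.
move=> mf; case: (boolP (0 < L2norm P f < +oo)%E) => nf.
  have [sf n0 ff] := L2norm_pos_sqint mf nf.
  rewrite sqint_L2norm ?ip_normalized// ?sqrtr1//.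
  by under [X in sqint _ _ X]eq_fun do rewrite mulrC; exact: sqintZ.
have -> : fine (L2norm P f) = 0.
  move: nf; have := L2norm_ge0 P f; case: (L2norm P f) => [r| |]//=.
  rewrite ltry andbT lte_fin lee_fin -leNgt => r0 r1.
  by apply/eqP; rewrite eq_le r0 r1.
rewrite invr0; have -> : (fun x => f x * 0) = fun=> 0 by apply/funext => x; rewrite mulr0.
rewrite sqint_L2norm; last exact: sqint0.
by rewrite ip0l sqrtr0 lee_fin.
Qed.

End normalization.

Section verification.
Context {R : realType} {d : measure_display} {Omega : measurableType d}.
Context (P : probability Omega R) (hP : measure_is_complete P).
Context (T : R) (hT : 0 < T) (B : R -> Omega -> R) (hB : brownian_motion P T B).
Implicit Types (s t u v c : R) (X Y Z alpha : R -> Omega -> R).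
Local Notation F t := (filtration P B t).
Local Notation FT t := (g_sigma_algebraType (filtration P B t)).
Notation leb := (@lebesgue_measure R).
Local Notation TR := (measurableTypeR R).

Lemma progressive_fixed Y t : 0 <= t <= T -> progressive P B T Y -> measurable_fun setT (Y t).
Proof.
move=> t0T pY; have /andP[_ tT] := t0T.
apply: (sub_measurable_fun (filtration_measurable hP hB tT)).
exact: progressive_adapted pY.
Qed.

Lemma measurable_fine_L2norm Y t : 0 <= t <= T -> progressive P B T Y ->
  measurable_fun (`[0, t]%classic : set TR) (fun s => fine (L2norm P (Y s))).
Proof.
move=> t0T pY; have /andP[t0 tT] := t0T.
have mY : measurable_fun (strip t : set (TR * Omega)) (fun p => Y p.1 p.2).
  exact: (progressive_measurable hP hB tT t0T pY).
apply: (eq_measurable_fun (fun s => Num.sqrt (fine (\int[P]_x (Y s x ^+ 2)%:E)%E))).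
  by move=> s _; rewrite fine_L2norm.
have m2 : measurable_fun (`[0, t]%classic : set TR) (fun s => \int[P]_x (Y s x ^+ 2)%:E)%E.
  apply: (@measurable_strip_integral1 _ _ _ P t (fun p => (Y p.1 p.2 ^+ 2)%:E)).
    by apply/measurable_EFinP; exact: measurable_funX.
  by move=> p _; rewrite lee_fin sqr_ge0.
have ms : measurable_fun setT (@Num.sqrt R).
  by apply: continuous_measurable_fun; exact: sqrt_continuous.
apply: (measurableT_comp ms); apply: measurableT_comp m2.
exact: fine_measurable.
Qed.

Lemma normalized_progressive Y : progressive P B T Y -> progressive P B T (normalized P Y).
Proof.
move=> pY t t0T; rewrite /normalized.
apply: measurable_funM; first exact: pY.
have mi : measurable_fun (`[0, t]%classic : set TR) (fun s => (fine (L2norm P (Y s)))^-1).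
  (* The inverse is written as the power -1, which is measurable and agrees with it also at 0. *)
  apply: (eq_measurable_fun (fun s => (fine (L2norm P (Y s))) `^ (-1))).
    by move=> s _; rewrite powR_inv1// fine_ge0// L2norm_ge0.
  have mp := @measurable_powR R (-1).
  exact: (measurableT_comp mp (measurable_fine_L2norm t0T pY)).
apply: (measurable_comp _ _ mi) => //; first by move=> s [p /= [p1 _] <-].
exact: measurable_funTS.
Qed.

Lemma drift_admissible Y : progressive P B T Y -> admissible P T B (drift P Y).
Proof.
move=> pY; split.
  move=> t t0T; rewrite /drift; apply: measurable_funM => //.
  exact: (normalized_progressive pY).
move=> t t0T; have mY := progressive_fixed t0T pY.
have c00 := @c0_gt0 R.
have /(L2norm_le_ip ler01) n1 := L2norm_normalized_le P mY.
have mn : measurable_fun setT (fun x => Y t x / fine (L2norm P (Y t))).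
  exact: measurable_funM.
have [sn in1] := n1 mn.
rewrite sqint_L2norm; last exact: sqintZ.
have sn' : sqint P setT (fun x => - c0 * normalized P Y t x) by exact: sqintZ.
rewrite lee_fin /drift ipZl// ipC ipZl// mulrA mulrNN -expr2.
rewrite sqrtrM ?sqr_ge0// sqrtr_sqr gtr0_norm// ler_piMr ?(ltW c00)//.
by rewrite -[leRHS]sqrtr1 ler_wsqrtr// -(expr1n _ 2).
Qed.

Lemma measurable_strip_integral t (f : TR * Omega -> \bar R) :
  measurable_fun (strip t) f ->
  measurable_fun setT (fun x => \int[leb]_(s in `[0%R, t]) f (s, x))%E.
Proof.
move=> mf; under eq_fun do rewrite integralE.
apply: emeasurable_funB.
  apply: eq_measurable_fun (measurable_strip_integral2 (measurable_funepos mf) (fun p _ => funepos_ge0 f p)).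
  by move=> x _; apply: eq_integral => s _; rewrite !funeposE.
apply: eq_measurable_fun (measurable_strip_integral2 (measurable_funeneg mf) (fun p _ => funeneg_ge0 f p)).
by move=> x _; apply: eq_integral => s _; rewrite !funenegE.
Qed.

Lemma measurable_strip_mean t (f : TR * Omega -> \bar R) :
  measurable_fun (strip t) f ->
  measurable_fun (`[0, t]%classic : set TR) (fun s => \int[P]_x f (s, x))%E.
Proof.
move=> mf; under [X in measurable_fun _ X]eq_fun do rewrite integralE.
apply: emeasurable_funB.
  apply: eq_measurable_fun (measurable_strip_integral1 P (measurable_funepos mf) (fun p _ => funepos_ge0 f p)).
  by move=> x _; apply: eq_integral => s _; rewrite !funeposE.
apply: eq_measurable_fun (measurable_strip_integral1 P (measurable_funeneg mf) (fun p _ => funeneg_ge0 f p)).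
by move=> x _; apply: eq_integral => s _; rewrite !funenegE.
Qed.

Section control.
Variable alpha : R -> Omega -> R.
Hypothesis ha : admissible P T B alpha.

Lemma admissible_section t : 0 <= t <= T ->
  sqint P setT (alpha t) /\ ip P setT (alpha t) (alpha t) <= c0 ^+ 2.
Proof.
case: ha => pa na t0T; apply: L2norm_le_ip (na _ t0T); first exact/ltW/c0_gt0.
exact: progressive_fixed pa.
Qed.

Lemma admissible_sqint : sqint (leb \x P)%E (strip T) (fun p => alpha p.1 p.2).
Proof.
have mS := measurable_strip (Omega := Omega) T.
have T0T : 0 <= T <= T by rewrite lexx ltW.
have ma : measurable_fun (strip T : set (TR * Omega)) (fun p => alpha p.1 p.2).
  by case: ha => pa _; exact: (progressive_measurable hP hB (lexx T) T0T pa).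
split => //; apply/integrableP; split.
  by apply/measurable_EFinP; exact: measurable_funX.
under eq_integral do rewrite gee0_abs ?lee_fin ?sqr_ge0//.
rewrite tonelli_strip1//=; first last.
- by move=> p _; rewrite lee_fin sqr_ge0.
- by apply/measurable_EFinP; exact: measurable_funX.
apply: (@le_lt_trans _ _ (\int[leb]_(s in `[0%R, T]) (cst (c0 ^+ 2)%:E s))%E); last first.
  rewrite integral_cst//= [X in (_ * X)%E](_ : _ = T%:E); first by rewrite -EFinM ltry.
  exact: (leb_segment (ltW hT)).
apply: ge0_le_integral => //.
- by move=> s _; apply: integral_ge0 => x _; rewrite lee_fin sqr_ge0.
- apply: (@measurable_strip_integral1 _ _ _ P T (fun p => (alpha p.1 p.2 ^+ 2)%:E)).
    by apply/measurable_EFinP; exact: measurable_funX.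
  by move=> p _; rewrite lee_fin sqr_ge0.
- move=> s; rewrite /= in_itv/= => s0T.
  have [[_ si] ai] := admissible_section s0T.
  have -> : (\int[P]_x (alpha s x ^+ 2)%:E)%E = (ip P setT (alpha s) (alpha s))%:E.
    rewrite /ip /Rintegral; under [in RHS]eq_integral do rewrite -expr2.
    by rewrite fineK//; apply: integrable_fin_num si.
  by rewrite lee_fin.
Qed.

Lemma admissible_integrable : (leb \x P)%E.-integrable (strip T) (EFin \o (fun p => alpha p.1 p.2)).
Proof.
have mS := measurable_strip (Omega := Omega) T.
have s1 : sqint (leb \x P)%E (strip T) (fun=> 1).
  by apply: (@bounded_sqint_strip _ _ _ P T _ 1) => //; [exact: ltW|move=> p _; rewrite normr1].
have := sqint_mul mS admissible_sqint s1.
by congr (_.-integrable _ (EFin \o _)); apply/funext => p; rewrite mulr1.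
Qed.

Lemma admissible_integrable_path :
  {ae P, forall x, leb.-integrable `[0, T] (fun s => (alpha s x)%:E)}.
Proof. exact: (ae_integrable_strip admissible_integrable). Qed.

Lemma measurable_state : measurable_fun setT (state B alpha T).
Proof.
have T0T : 0 <= T <= T by rewrite lexx ltW.
have ma : measurable_fun (strip T : set (TR * Omega)) (fun p => alpha p.1 p.2).
  by case: ha => pa _; exact: (progressive_measurable hP hB (lexx T) T0T pa).
apply: measurable_funD; last exact: (measurable_brownian hB).
apply: measurableT_comp; first exact: fine_measurable.
apply: (@measurable_strip_integral T (fun p : TR * Omega => (alpha p.1 p.2)%:E)).
exact/measurable_EFinP.
Qed.

End control.

Lemma ip_ae (f f' g g' : Omega -> R) :
  measurable_fun setT f -> measurable_fun setT f' ->
  measurable_fun setT g -> measurable_fun setT g' ->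
  {ae P, forall x, f x = f' x} -> {ae P, forall x, g x = g' x} ->
  ip P setT f g = ip P setT f' g'.
Proof.
move=> mf mf' mg mg' ff gg; congr fine; apply: ae_eq_integral => //.
- by apply/measurable_EFinP; exact: measurable_funM.
- by apply/measurable_EFinP; exact: measurable_funM.
by apply: filterS2 ff gg => x -> -> _.
Qed.

Lemma L2norm_ae (f f' : Omega -> R) : measurable_fun setT f -> measurable_fun setT f' ->
  {ae P, forall x, f x = f' x} -> L2norm P f = L2norm P f'.
Proof.
move=> mf mf' ff; rewrite !L2normE; congr (_ `^ _)%E; apply: ae_eq_integral => //.
- by apply/measurable_EFinP; exact: measurable_funX.
- by apply/measurable_EFinP; exact: measurable_funX.
by apply: filterS ff => x -> _.
Qed.

Section gap.
Variables X Y Z : R -> Omega -> R.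
Hypothesis sol : fbsde_solution P T B X Y Z.
Local Notation a := (drift P Y).

Let T0T : 0 <= T <= T. Proof. by rewrite lexx ltW. Qed.
Let pX : progressive P B T X. Proof. by case: sol => -[]. Qed.
Let pY : progressive P B T Y. Proof. by case: sol => -[]. Qed.
Let aa : admissible P T B a. Proof. exact: drift_admissible. Qed.
Let mXT : measurable_fun setT (X T). Proof. exact: progressive_fixed. Qed.
Let mYT : measurable_fun setT (Y T). Proof. exact: progressive_fixed. Qed.
Let msa : measurable_fun setT (state B a T). Proof. exact: measurable_state. Qed.

Lemma solution_terminal : {ae P, forall x, X T x = state B a T x}.
Proof. by case: sol => _ [_ _ h] _ _; apply: filterS h => x; exact. Qed.

Lemma solution_cost : cost P T B a = L2norm P (X T).
Proof. by rewrite /cost; apply: L2norm_ae => //; apply: filterS solution_terminal => x ->. Qed.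

Lemma solution_cost_fin : (0 < cost P T B a < +oo)%E.
Proof. by rewrite solution_cost; case: sol => _ _ _ []. Qed.

(** [Y T] is the unit vector along the terminal state, so pairing with it returns the cost: it is
    the dual certificate of optimality. *)
Lemma solution_terminal_ip : [/\ sqint P setT (Y T), ip P setT (Y T) (Y T) = 1 &
  ip P setT (Y T) (state B a T) = fine (cost P T B a)].
Proof.
have [_ _ _ [nX YX]] := sol.
have [sX n0 XX] := L2norm_pos_sqint mXT nX.
have mN : measurable_fun setT (normalized P X T) by exact: measurable_funM.
have YY : ip P setT (Y T) (Y T) = 1 by rewrite -(ip_normalized mXT nX); exact: ip_ae.
have eN : normalized P X T = (fun x => (fine (L2norm P (X T)))^-1 * X T x).
  by apply/funext => x; rewrite /normalized mulrC.
have sN : sqint P setT (normalized P X T) by rewrite eN; exact: sqintZ.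
split => //.
  by apply: L2norm_sqint => //; rewrite (L2norm_ae mYT mN YX) sqint_L2norm// ltry.
rewrite solution_cost (@ip_ae _ (normalized P X T) _ (X T))//; last first.
  by apply: filterS solution_terminal => x ->.
by rewrite eN ipZl// XX; field; rewrite gt_eqF.
Qed.

Let sY : sqint P setT (Y T). Proof. by case: solution_terminal_ip. Qed.

Variable alpha : R -> Omega -> R.
Hypothesis ha : admissible P T B alpha.

Let delta s x := alpha s x - a s x.
(** The pairing is with [Y T], fixed in [s]: Fubini turns its time integral into the pairing with
    the gap between the two terminal states, in which [B T] cancels. *)
Let phi s := (\int[P]_x (Y T x * delta s x)%:E)%E.

Let mS : measurable (strip T : set (TR * Omega)).
Proof. exact: measurable_strip. Qed.

Let sdelta : sqint (leb \x P)%E (strip T) (fun p => delta p.1 p.2).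
Proof. by apply: sqintB => //; exact: admissible_sqint. Qed.

Let sdelta_section s : 0 <= s <= T -> sqint P setT (delta s).
Proof.
by move=> s0T; apply: sqintB => //; [case: (admissible_section ha s0T)|case: (admissible_section aa s0T)].
Qed.

Let sYstrip : sqint (leb \x P)%E (strip T) (fun p => Y T p.2).
Proof.
have [_ iY] := sY.
have mY2 : measurable_fun (strip T : set (TR * Omega)) (fun p => Y T p.2).
  by apply: measurable_funTS; exact: measurableT_comp mYT measurable_snd.
split => //; apply/integrableP; split.
  by apply/measurable_EFinP; exact: measurable_funX.
under eq_integral do rewrite gee0_abs ?lee_fin ?sqr_ge0//.
rewrite tonelli_strip1//=; first last.
- by move=> p _; rewrite lee_fin sqr_ge0.
- by apply/measurable_EFinP; exact: measurable_funX.
have ek : (\int[P]_x (Y T x ^+ 2)%:E)%E = (fine (\int[P]_x (Y T x ^+ 2)%:E)%E)%:E.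
  by rewrite fineK//; exact: integrable_fin_num iY.
under eq_integral do rewrite ek.
rewrite integral_cst// [X in (_ * X)%E](_ : _ = T%:E); first by rewrite -EFinM ltry.
exact: (leb_segment (ltW hT)).
Qed.

Let iprod : (leb \x P)%E.-integrable (strip T) (EFin \o (fun p => Y T p.2 * delta p.1 p.2)).
Proof. exact: sqint_mul. Qed.

Let phi_integral : (cost P T B alpha < +oo)%E ->
  (\int[leb]_(s in `[0%R, T]) phi s)%E =
  (ip P setT (Y T) (fun x => state B alpha T x - state B a T x))%:E.
Proof.
move=> fa; rewrite /phi -(fubini_strip1 iprod) (fubini_strip2 iprod)/=.
have sd : sqint P setT (fun x => state B alpha T x - state B a T x).
  apply: sqintB => //.
    by apply: L2norm_sqint => //; exact: measurable_state.
  by apply: L2norm_sqint => //; case/andP: solution_cost_fin.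
rewrite /ip /Rintegral fineK; last first.
  exact: integrable_fin_num (sqint_mul measurableT sY sd).
apply: ae_eq_integral => //.
- apply: (@measurable_strip_integral T (fun p : TR * Omega => (Y T p.2 * delta p.1 p.2)%:E)).
  by case/integrableP: iprod.
- by apply/measurable_EFinP; apply: measurable_funM => //; case: sd.
apply: filterS2 (admissible_integrable_path ha) (admissible_integrable_path aa).
move=> x ia ib _ /=.
have mI : measurable (`[0, T]%classic : set TR) by exact: measurable_itv.
have id : leb.-integrable `[0, T] (fun s => (delta s x)%:E).
  exact: (integrableB mI ia ib).
under eq_integral do rewrite EFinM.
rewrite (integralZl mI id) -(fineK (integrable_fin_num mI id)) -EFinM; congr (_ * _)%:E.
by apply: (etrans (RintegralB mI ia ib)); rewrite /state; ring.
Qed.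

(* [delta] is tested against [Y T]; since [alpha s] has norm at most [c0] and
   [a s] is [- c0 * Y s] normalised, [2 * ip (a s) (a s - alpha s)] is at least
   [ip (delta s) (delta s)]. *)
Let phi_ge : {ae leb, forall s, 0 <= s <= T -> 0 < fine (L2norm P (Y s)) /\
  ((fine (L2norm P (Y s)) / (2 * c0) * ip P setT (delta s) (delta s))%:E <= phi s)%E}.
Proof.
have [_ [nY _ _] [_ cY _] _] := sol.
apply: (@filterS _ _ (ae_filter_ringOfSetsType leb) _ _ _ nY) => s {}nY s0T; have /andP[s0 sT] := s0T.
have mYs := progressive_fixed s0T pY.
have [sYs n0 _] := L2norm_pos_sqint mYs (nY s0T).
split=> //; have sds := sdelta_section s0T.
have [sal al] := admissible_section ha s0T.
have [sa _] := admissible_section aa s0T.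
have c00 := @c0_gt0 R.
have aE x : a s x = - c0 / fine (L2norm P (Y s)) * Y s x.
  by rewrite /drift /normalized mulrAC -mulrA.
have eN : a s = (fun x => - c0 * normalized P Y s x) by [].
have sN : sqint P setT (normalized P Y s).
  by rewrite /normalized; under [X in sqint _ _ X]eq_fun do rewrite mulrC; exact: sqintZ.
have a2 : ip P setT (a s) (a s) = c0 ^+ 2.
  rewrite {1}eN ipZl// ipC eN ipZl// [X in _ * (_ * X)](ip_normalized mYs (nY s0T)).
  by rewrite mulr1 mulrNN -expr2.
have iD : P.-integrable setT (EFin \o (fun x => Y T x - Y s x)).
  by apply: sqint_integrable; exact: sqintB.
have D0 A : <<s F s >> A -> (\int[P]_(x in A) (Y T x - Y s x)%:E = 0)%E.
  move=> hA; have mA := filtration_measurable hP hB sT hA.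
  have [_ iYT iYs eA] := cY _ s0T.
  under eq_integral do rewrite EFinB.
  rewrite integralB//; [|exact: integrableS iYT|exact: integrableS iYs].
  rewrite eA// subee// integrable_fin_num//; exact: integrableS iYT.
(* [delta s] is known at time [s], so the martingale property allows [Y s] in place of [Y T]. *)
have orthD : ip P setT (delta s) (fun x => Y T x - Y s x) = 0.
  apply: (orth (filtration_measurable hP hB sT) iD D0).
    apply: measurable_funB; [case: ha|case: aa] => p _; exact: progressive_adapted p.
  by apply: sqint_mul => //; exact: sqintB.
have phiE : phi s = (ip P setT (Y s) (delta s))%:E.
  rewrite /phi; have iYd := sqint_mul measurableT sY sds.
  rewrite -(fineK (integrable_fin_num measurableT iYd)); congr EFin.
  move: orthD; rewrite ipC ipBl// => /eqP; rewrite subr_eq0 => /eqP <-.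
  by [].
rewrite phiE lee_fin.
set n := fine (L2norm P (Y s)) in n0 aE *.
have YE : Y s = (fun x => (- (n / c0)) * a s x).
  by apply/funext => x; rewrite aE; field; rewrite !gt_eqF.
have -> : ip P setT (Y s) (delta s) = n / c0 * (ip P setT (a s) (a s) - ip P setT (alpha s) (a s)).
  by rewrite [in LHS]YE ipZl// [ip _ _ (a s) _]ipC ipBl//; ring.
have -> : n / (2 * c0) * ip P setT (delta s) (delta s) = n / c0 * (ip P setT (delta s) (delta s) / 2).
  by field; rewrite gt_eqF.
rewrite ler_wpM2l ?divr_ge0 ?(ltW n0) ?(ltW c00)//.
by rewrite /delta ipBB// a2; lra.
Qed.

Let phi_measurable : measurable_fun (`[0, T]%classic : set TR) phi.
Proof.
apply: (@measurable_strip_mean T (fun p : TR * Omega => (Y T p.2 * delta p.1 p.2)%:E)).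
by case/integrableP: iprod.
Qed.

(** The pairing of [Y T] with the first state is at most its norm by Cauchy-Schwarz, as [Y T] has
    norm 1; with the second it equals the norm. *)
Let ip_gap : (cost P T B alpha < +oo)%E ->
  ip P setT (Y T) (fun x => state B alpha T x - state B a T x) <=
  fine (cost P T B alpha) - fine (cost P T B a).
Proof.
move=> fa; have [_ YY YN] := solution_terminal_ip.
have ss : sqint P setT (state B alpha T).
  by apply: L2norm_sqint => //; exact: measurable_state.
have sa : sqint P setT (state B a T).
  by apply: L2norm_sqint => //; case/andP: solution_cost_fin.
rewrite ipC ipBl// [ip _ _ _ (Y T)]ipC [X in _ - X]ipC YN lerB// /cost.
rewrite sqint_L2norm//=; apply: le_trans (ler_norm _) _.
rewrite -sqrtr_sqr ler_wsqrtr//.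
by have := Cauchy_Schwarz measurableT sY ss; rewrite YY mul1r.
Qed.

(** [phi] is nonnegative only almost everywhere; its positive part is so everywhere. *)
Let phi_pos : (\int[leb]_(s in `[0%R, T]) phi s)%E = (\int[leb]_(s in `[0%R, T]) (phi^\+)%E s)%E.
Proof.
apply: ae_eq_integral => //; first exact: measurable_funepos.
apply: (@filterS _ _ (ae_filter_ringOfSetsType leb) _ _ _ phi_ge) => s h s0T.
have [|n0 le_phi] := h; first by move: s0T; rewrite /= in_itv.
rewrite funeposE; apply/esym/max_idPl; apply: le_trans le_phi.
by rewrite lee_fin mulr_ge0 ?ip_ge0// divr_ge0 ?(ltW n0)// mulr_ge0// ltW// c0_gt0.
Qed.

Lemma solution_cost_le : (cost P T B a <= cost P T B alpha)%E.
Proof.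
have [fa|] := ltP (cost P T B alpha) +oo%E; last by rewrite leye_eq => /eqP ->; rewrite leey.
have /andP[_ fa0] := solution_cost_fin.
have fE : forall b, (cost P T B b < +oo)%E -> cost P T B b = (fine (cost P T B b))%:E.
  by move=> b fb; rewrite fineK// ge0_fin_numE// L2norm_ge0.
rewrite fE// [leRHS]fE// lee_fin -subr_ge0; apply: le_trans (ip_gap fa).
rewrite -lee_fin -(phi_integral fa) phi_pos.
by apply: integral_ge0 => s _; exact: funepos_ge0.
Qed.

(** A zero gap forces [phi] to vanish for almost every [s]; the weight in [phi_ge] is positive, so
    [delta s] has norm 0, and Tonelli assembles the sections. *)
Lemma solution_cost_eq : cost P T B alpha = cost P T B a -> dtP_ae_eq P T alpha a.
Proof.
move=> eN; have /andP[_ fa0] := solution_cost_fin.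
have fa : (cost P T B alpha < +oo)%E by rewrite eN.
have pp0 s : (0 <= (phi^\+)%E s)%E by exact: funepos_ge0.
have i0 : (\int[leb]_(s in `[0%R, T]) (phi^\+)%E s = 0)%E.
  apply/eqP; rewrite eq_le integral_ge0// andbT -phi_pos (phi_integral fa) lee_fin.
  by apply: le_trans (ip_gap fa) _; rewrite eN subrr.
have mpp := measurable_funepos phi_measurable.
have /(ae_eq_integral_abs leb (measurable_itv _) mpp) p0 : (\int[leb]_(s in `[0%R, T]) `|(phi^\+)%E s| = 0)%E.
  by rewrite -[RHS]i0; apply: eq_integral => s _; rewrite gee0_abs.
have c00 := @c0_gt0 R.
have m2 : measurable_fun (strip T) (fun p : TR * Omega => (delta p.1 p.2 ^+ 2)%:E).
  by apply/measurable_EFinP; apply: measurable_funX; case: sdelta.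
have d0 : ip (leb \x P)%E (strip T) (fun p => delta p.1 p.2) (fun p => delta p.1 p.2) = 0.
  rewrite /ip /Rintegral.
  have -> : (\int[leb \x P]_(p in strip T) (delta p.1 p.2 * delta p.1 p.2)%:E = 0)%E; last by [].
  under eq_integral do rewrite -expr2.
  rewrite tonelli_strip1//=; last by move=> p _; rewrite lee_fin sqr_ge0.
  transitivity (\int[leb]_(s in `[0%R, T]) (cst 0%E s))%E; last by rewrite integral0.
  apply: ae_eq_integral => //.
    apply: (@measurable_strip_mean T (fun p : TR * Omega => (delta p.1 p.2 ^+ 2)%:E)).
    exact: m2.
  apply: (@filterS2 _ _ (ae_filter_ringOfSetsType leb) _ _ _ _ phi_ge p0) => s h k s0T.
  have s0T' : 0 <= s <= T by move: s0T; rewrite /= in_itv.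
  have [n0 le_phi] := h s0T'.
  have sds := sdelta_section s0T'.
  suff dd : ip P setT (delta s) (delta s) = 0.
    rewrite /= -[RHS]/(0%:E) -dd /ip /Rintegral fineK; last first.
      exact: integrable_fin_num (sqint_mul measurableT sds sds).
    by apply: eq_integral => x _; rewrite expr2.
  have w0 : 0 < fine (L2norm P (Y s)) / (2 * c0) by rewrite divr_gt0// mulr_gt0.
  have : ((fine (L2norm P (Y s)) / (2 * c0) * ip P setT (delta s) (delta s))%:E <= 0)%E.
    by apply: le_trans le_phi _; rewrite -[leRHS](k s0T) funeposE le_max lexx.
  rewrite lee_fin pmulr_rle0// => dd.
  by apply/eqP; rewrite eq_le dd ip_ge0.
apply: filterS (ip0_ae mS sdelta d0) => p h p0T; apply/eqP; rewrite -subr_eq0; apply/eqP.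
by apply: h; split => //=; rewrite in_itv.
Qed.

End gap.

End verification.


Lemma continuous_eq_rat (R : realType) (f g : R -> R) : continuous f -> continuous g ->
  (forall q : rat, f (ratr q) = g (ratr q)) -> f = g.
Proof.
move=> cf cg fg; apply/funext => t; apply/eqP; rewrite -subr_eq0; apply/negPn/negP => h.
have oO : open [set s | f s - g s != 0].
  apply: (@open_comp _ _ (fun s => f s - g s) [set x | x != 0]).
    by move=> x _; apply: cvgB; [exact: cf|exact: cg].
  exact: open_neq.
have [s [/= fgq [q _ qs]]] := @dense_rat R _ (ex_intro _ t h) oO.
by move: fgq; rewrite -qs fg subrr eqxx.
Qed.

(** * Uniqueness *)

Section uniqueness.
Context {R : realType} {d : measure_display} {Omega : measurableType d}.
Context (P : probability Omega R) (hP : measure_is_complete P).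
Context (T : R) (hT : 0 < T) (B : R -> Omega -> R) (hB : brownian_motion P T B).
Implicit Types (s t u v c : R) (X Y Z alpha : R -> Omega -> R).
Local Notation F t := (filtration P B t).
Local Notation FT t := (g_sigma_algebraType (filtration P B t)).
Notation leb := (@lebesgue_measure R).
Local Notation TR := (measurableTypeR R).

Lemma cond_expectation_ae t (Y1 Y2 xi1 xi2 : Omega -> R) : t <= T ->
  cond_expectation P B t Y1 xi1 -> cond_expectation P B t Y2 xi2 ->
  {ae P, forall x, xi1 x = xi2 x} -> {ae P, forall x, Y1 x = Y2 x}.
Proof.
move=> tT [m1 ix1 i1 e1] [m2 ix2 i2 e2] xx.
have mF := filtration_measurable hP hB tT.
pose D x := Y1 x - Y2 x.
have mD : measurable_fun setT (D : FT t -> R) by exact: measurable_funB.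
have iD : P.-integrable setT (EFin \o D) by exact: (integrableB measurableT i1 i2).
have D0 A : <<s F t >> A -> (\int[P]_(x in A) (D x)%:E = 0)%E.
  move=> hA; have mA := mF _ hA.
  under eq_integral do rewrite EFinB.
  rewrite integralB//; [|exact: integrableS i1|exact: integrableS i2].
  rewrite e1// e2//.
  have -> : (\int[P]_(x in A) (xi1 x)%:E = \int[P]_(x in A) (xi2 x)%:E)%E.
    apply: ae_eq_integral => //.
    - by apply: (measurable_funS _ (@subsetT _ A)) => //; case/integrableP: ix1.
    - by apply: (measurable_funS _ (@subsetT _ A)) => //; case/integrableP: ix2.
    by apply: filterS xx => x -> _.
  rewrite subee// integrable_fin_num//; exact: integrableS ix2.
(* [D] is tested against its own sign, which is known at time [t]; the result is the mean of
   [|D|]. *)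
pose f x : R := if 0 <= D x then 1 else -1.
have mf : measurable_fun setT (f : FT t -> R).
  apply: measurable_fun_ifT => //.
  exact: (measurable_fun_ler (measurable_cst _) mD).
have fD : (fun x => f x * D x) = (fun x => `|D x|).
  apply/funext => x; rewrite /f; case: ifPn => h; first by rewrite mul1r ger0_norm.
  by rewrite mulN1r ltr0_norm// ltNge.
have ifD : P.-integrable setT (EFin \o (fun x => f x * D x)).
  by rewrite fD; exact: (integrable_norm iD).
have h := orth mF iD D0 mf ifD.
have mD' : measurable_fun setT (EFin \o D) by case/integrableP: iD.
have /(ae_eq_integral_abs P measurableT mD') k : (\int[P]_x `|(EFin \o D) x| = 0)%E.
  rewrite -(fineK (integrable_fin_num measurableT (integrable_abse iD))).
  congr EFin; rewrite -[RHS]h; congr fine; apply: eq_integral => x _.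
  by rewrite /= -[_ * _]/((fun x => f x * D x) x) fD.
apply: filterS k => x /(_ I) [] /eqP; rewrite subr_eq0 => /eqP.
exact.
Qed.

(** One null set serves all [t]: almost surely the integral of [|alpha - alpha'|] over [[0, T]]
    vanishes, and it dominates the difference of the integrals over each [[0, t]]. *)
Lemma dtP_ae_path alpha alpha' : admissible P T B alpha -> admissible P T B alpha' ->
  dtP_ae_eq P T alpha alpha' ->
  {ae P, forall x, forall t, 0 <= t <= T ->
    \int[leb]_(s in `[0, t]) alpha s x = \int[leb]_(s in `[0, t]) alpha' s x}.
Proof.
move=> ha ha' aa.
have ia := admissible_integrable hP hT hB ha.
have ia' := admissible_integrable hP hT hB ha'.
have mS : measurable (strip T : set (TR * Omega)) by exact: measurable_strip.
pose f (p : TR * Omega) := (`|alpha p.1 p.2 - alpha' p.1 p.2|%R)%:E.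
have mf : measurable_fun (strip T) f.
  apply/measurable_EFinP; apply: measurableT_comp => //.
  by apply: measurable_funB; apply/measurable_EFinP; [case/integrableP: ia|case/integrableP: ia'].
have f0 p : strip T p -> (0 <= f p)%E by rewrite lee_fin.
have : (\int[leb \x P]_(p in strip T) f p = 0)%E.
  transitivity (\int[leb \x P]_(p in strip T) (cst 0%E p))%E; last by rewrite integral0.
  apply: ae_eq_integral => //; apply: (@filterS _ _ (ae_filter_ringOfSetsType (leb \x P)%E) _ _ _ aa) => p h [/= p1 _].
  by rewrite /f h ?subrr ?normr0//; move: p1; rewrite in_itv.
rewrite tonelli_strip2// => i0.
have mg := measurable_strip_integral2 mf f0.
have /(ae_eq_integral_abs P measurableT mg) g0 : (\int[P]_x `|\int[leb]_(s in `[0%R, T]) f (s, x)| = 0)%E.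
  rewrite -[RHS]i0; apply: eq_integral => x _; rewrite gee0_abs//.
  by apply: integral_ge0 => s _; rewrite lee_fin.
have := admissible_integrable_path hP hT hB ha'.
apply: filterS3 g0 (admissible_integrable_path hP hT hB ha) => x g0 ib ib' t /andP[t0 tT].
have mI : measurable (`[0, t]%classic : set TR) by exact: measurable_itv.
have tTs : `[0, t]%classic `<=` (`[0, T]%classic : set TR).
  by move=> s; rewrite /= !in_itv/= => /andP[-> st]; exact: le_trans st tT.
have jb : leb.-integrable `[0, t] (fun s => (alpha s x)%:E).
  by apply: integrableS ib => //; exact: measurable_itv.
have jb' : leb.-integrable `[0, t] (fun s => (alpha' s x)%:E).
  by apply: integrableS ib' => //; exact: measurable_itv.
have iD : leb.-integrable `[0, t] (EFin \o (fun s => alpha s x - alpha' s x)).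
  exact: (integrableB mI jb jb').
apply/eqP; rewrite -subr_eq0 -normr_le0 -(RintegralB mI jb jb').
apply: le_trans (le_normr_Rintegral mI iD) _.
rewrite -lee_fin /Rintegral fineK; last first.
  exact: (integrable_fin_num mI (integrable_norm iD)).
have -> : 0%:E = (\int[leb]_(s in `[0%R, T]) f (s, x))%E by rewrite g0.
apply: ge0_subset_integral => //.
  have mIT : measurable (`[0, T]%classic : set TR) by exact: measurable_itv.
  have iDT : leb.-integrable `[0, T] (EFin \o (fun s => alpha s x - alpha' s x)).
    exact: (integrableB mIT ib ib').
  by case/integrableP: (integrable_norm iDT).
Qed.

Lemma continuous_indistinguishable Y Y' :
  {ae P, forall x, {within `[0, T], continuous (Y^~ x)}} ->
  {ae P, forall x, {within `[0, T], continuous (Y'^~ x)}} ->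
  (forall t, 0 <= t <= T -> {ae P, forall x, Y t x = Y' t x}) ->
  indistinguishable P T Y Y'.
Proof.
move=> cY cY' YY.
(* Countably many times suffice: the clamped rationals, enumerated through [unpickle], with 0 for
   the integers that code no rational. *)
have hq : {ae P, forall x, forall n : nat,
    let q : R := clamp T (ratr (odflt 0%Q (unpickle n))) in Y q x = Y' q x}.
  by apply: ae_foralln => n; apply: YY; exact: clamp_itv.
have cc (h : R -> R) : {within `[0, T], continuous h} -> continuous (h \o clamp T).
  move=> /subspace_continuousP c t.
  have ct : `[0, T]%classic (clamp T t) by rewrite /= in_itv/= clamp_itv.
  have := c _ ct; apply: cvg_comp => A; rewrite /within/= => hA.
  have k : nbhs t [set s | `[0, T]%classic (clamp T s) -> A (clamp T s)] := continuous_clamp hA.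
  apply: (@filterS _ (nbhs t) _ _ _ _ k) => s /= hs; apply: hs.
  by have := clamp_itv hT s; rewrite /= in_itv.
apply: filterS3 cY cY' hq => x /cc c1 /cc c2 eq t t0T.
have : Y^~ x \o clamp T = Y'^~ x \o clamp T.
  by apply: continuous_eq_rat => // q; have := eq (pickle q); rewrite pickleK.
by move/(congr1 (@^~ t)); rewrite /= clampE.
Qed.

Lemma solution_unique X Y Z X' Y' Z' :
  fbsde_solution P T B X Y Z -> fbsde_solution P T B X' Y' Z' ->
  [/\ indistinguishable P T X' X, indistinguishable P T Y' Y & dtP_ae_eq P T Z' Z].
Proof.
move=> sol sol'.
have T0T : 0 <= T <= T by rewrite lexx ltW.
have [[pX pY pZ] [nY iY sX] [cY eY zY] [nX YX]] := sol.
have [[pX' pY' pZ'] [nY' iY' sX'] [cY' eY' zY'] [nX' YX']] := sol'.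
have aa := drift_admissible hP hB pY.
have aa' := drift_admissible hP hB pY'.
have cc : cost P T B (drift P Y') = cost P T B (drift P Y).
  by apply/le_anti; rewrite (solution_cost_le hP hT hB sol aa') (solution_cost_le hP hT hB sol' aa).
have dd := solution_cost_eq hP hT hB sol aa' cc.
have XX : indistinguishable P T X' X.
  rewrite /indistinguishable; apply: filterS3 sX sX' (dtP_ae_path aa' aa dd).
  by move=> x h h' e t t0T; rewrite h// h'// /state e.
have XT : {ae P, forall x, X' T x = X T x} by apply: filterS XX => x; exact.
have mX := progressive_fixed hP hB T0T pX.
have mX' := progressive_fixed hP hB T0T pX'.
have YT : {ae P, forall x, Y' T x = Y T x}.
  have nXX := L2norm_ae mX' mX XT.
  apply: filterS3 YX YX' XT => x -> -> e.
  by rewrite /normalized e nXX.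
have Yt t : 0 <= t <= T -> {ae P, forall x, Y' t x = Y t x}.
  by move=> t0T; have /andP[_ tT] := t0T; exact: cond_expectation_ae tT (eY' _ t0T) (eY _ t0T) YT.
split => //; first exact: continuous_indistinguishable.
apply: (ito_unique hP hB T0T (zY' _ T0T) (zY _ T0T)).
have Y0 : {ae P, forall x, Y' 0 x = Y 0 x} by apply: Yt; rewrite lexx ltW.
by apply: filterS2 YT Y0 => x -> ->.
Qed.

End uniqueness.


(** * Existence *)

Section existence.
Context {R : realType} {d : measure_display} {Omega : measurableType d}.
Context (P : probability Omega R) (hP : measure_is_complete P).
Context (T : R) (hT : 0 < T) (B : R -> Omega -> R) (hB : brownian_motion P T B).
Implicit Types (s t u v c : R) (X Y Z alpha : R -> Omega -> R).
Local Notation F t := (filtration P B t).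
Local Notation FT t := (g_sigma_algebraType (filtration P B t)).
Notation leb := (@lebesgue_measure R).
Local Notation TR := (measurableTypeR R).
Local Notation W := (wiener T B).

Let T0T : 0 <= T <= T. Proof. by rewrite lexx ltW. Qed.

Lemma ito_integral_eq t Z Z' I : (forall s x, 0 <= s <= t -> Z s x = Z' s x) ->
  ito_integral P B t Z I -> ito_integral P B t Z' I.
Proof.
move=> ZZ [pZ fZ mI [H [hH cH cI]]].
have LE (V : R -> Omega -> R) : L2dist2 P t Z V = L2dist2 P t Z' V.
  apply: eq_integral => -[s x]; rewrite inE => -[/= s0t _].
  by rewrite ZZ//; move: s0t; rewrite in_itv.
have LE' (V : R -> Omega -> R) : L2dist2 P t V Z = L2dist2 P t V Z'.
  apply: eq_integral => -[s x]; rewrite inE => -[/= s0t _].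
  by rewrite ZZ//; move: s0t; rewrite in_itv.
split => //; last by exists H; split => //; move: cH; rewrite (funext (fun n => LE' _)).
  move=> s s0t; apply: eq_measurable_fun (pZ s s0t) => -[u x]; rewrite inE => -[/= us _].
  rewrite ZZ//; move: us; rewrite in_itv/= => /andP[-> us]; apply: le_trans us _.
  by case/andP: s0t.
by rewrite -LE.
Qed.

(** The product of [wfun T] and [2 * c0 / (1 - wfun T)], the reciprocal of the norm of [Xsol T]. *)
Definition ampl : R := 2 * c0 * wfun T / (1 - wfun T).
Definition Xsol t x := wext t * W t x.
Definition Ysol t x := ampl * W t x.
Definition Zsol t (x : Omega) := ampl * ginv t.

Let w_lt1 : wfun T < 1. Proof. exact: wfun_lt1. Qed.
Let w_gt0 : 0 < wfun T. Proof. by have [] := wfunP (ltW hT). Qed.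

Lemma ampl_gt0 : 0 < ampl.
Proof.
by rewrite divr_gt0 ?subr_gt0// mulr_gt0// mulr_gt0// c0_gt0.
Qed.

Lemma Xsol_norm t : 0 <= t <= T -> L2norm P (Xsol t) = ((1 - wfun t) / (2 * c0))%:E.
Proof.
move=> t0T; have /andP[t0 _] := t0T; have /andP[w0 _] := wext_bnd t.
rewrite (wiener_scaled_norm hP hT hB t0T (ltW w0)) -(wextE t0); congr EFin.
by rewrite /ginv; field; rewrite !gt_eqF// c0_gt0.
Qed.

Lemma Ysol_norm t : 0 <= t <= T -> L2norm P (Ysol t) = (ampl * (ginv t - 1) / (2 * c0))%:E.
Proof. by move=> t0T; rewrite (wiener_scaled_norm hP hT hB t0T (ltW ampl_gt0)). Qed.

Lemma Ysol_norm_pos t : 0 < t <= T -> (0 < L2norm P (Ysol t) < +oo)%E.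
Proof.
move=> /andP[t0 tT]; rewrite Ysol_norm ?(ltW t0)// ltry andbT lte_fin.
have /andP[w0 _] := wext_bnd t.
have g1 : 0 < ginv t - 1 by rewrite subr_gt0 /ginv invf_gt1 ?wext_lt1.
by rewrite divr_gt0 ?(mulr_gt0 ampl_gt0 g1)// mulr_gt0// c0_gt0.
Qed.

Lemma normalized_XsolE t x : 0 <= t <= T ->
  normalized P Xsol t x = 2 * c0 / (1 - wext t) * Xsol t x.
Proof.
move=> t0T; have /andP[t0 _] := t0T.
by rewrite /normalized Xsol_norm//= -(wextE t0) invf_div mulrC.
Qed.

(** At positive times both processes are positive multiples of [W t], which normalisation forgets;
    at time 0 both sides are 0. *)
Lemma normalized_YsolE t x : 0 <= t <= T -> normalized P Ysol t x = normalized P Xsol t x.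
Proof.
move=> t0T; have /andP[t0 _] := t0T; rewrite normalized_XsolE// /normalized Ysol_norm//=.
move: t0; rewrite le_eqVlt => /predU1P[<-|t0].
  by rewrite /Ysol /Xsol (wiener0 hT) !(mulr0, mul0r).
have /andP[w0 _] := wext_bnd t; have w1 := wext_lt1 t0.
rewrite /Ysol /Xsol /ginv; have := ampl_gt0 => a0; have := @c0_gt0 R => c00.
field; rewrite !gt_eqF ?subr_gt0//.
Qed.

Lemma drift_YsolE t x : 0 <= t <= T -> drift P Ysol t x = - (Xpath (bm T B ^~ x) t * krate t).
Proof.
move=> t0T; rewrite /drift normalized_YsolE// normalized_XsolE// /Xsol -XpathW.
by rewrite /krate /theta; ring.
Qed.

Lemma solution_exists : fbsde_solution P T B Xsol Ysol Zsol.
Proof.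
have cW x : continuous (W^~ x) by exact: continuous_wiener.
have sWt t : 0 <= t <= T -> sqint P setT (W t) by exact: wiener_sqint.
split.
- split.
  + exact: (scaled_wiener_progressive hT hB continuous_wext).
  + by apply: (scaled_wiener_progressive hT hB (k := fun=> ampl)) => t; exact: cvg_cst.
  + apply: deterministic_progressive; apply: measurable_funM => //; exact: measurable_ginv.
(* The norm of [Ysol t] vanishes at [t = 0], so positivity is claimed off this null set. *)
- have ae0 : {ae leb, forall s : R, s <> 0}.
    exists [set 0]; split; [exact: measurable_set1|exact: lebesgue_measure_set1|].
    by move=> s /= /contrapT.
  split.
  + apply: (@filterS _ _ (ae_filter_ringOfSetsType leb) _ _ _ ae0) => t t0 /andP[t1 tT].
    apply: Ysol_norm_pos; rewrite tT andbT lt_neqAle t1 andbT eq_sym; exact/eqP.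
  + apply: aeW => x.
    have := integrableN (integrable_krate_Xpath T (continuous_bm hT (B := B) (x := x))).
    apply: eq_integrable => //.
    by move=> t; rewrite inE/= in_itv/= => t0T; rewrite drift_YsolE.
  + rewrite /indistinguishable; apply: filterS (bm_ae hB) => x bB t t0T.
    have /andP[t0 tT] := t0T.
    have cb := continuous_bm hT (B := B) (x := x).
    rewrite /state /Xsol -XpathW XpathE// bB// addrC; congr (_ + _).
    rewrite -mulN1r -RintegralZl//; last exact: integrable_krate_Xpath.
    apply: eq_Rintegral => s; rewrite inE/= in_itv/= => /andP[s0 st].
    by rewrite drift_YsolE ?s0 ?(le_trans st)// mulN1r.
- have iY t : 0 <= t <= T -> P.-integrable setT (EFin \o Ysol t).
    by move=> t0T; apply: sqint_integrable; apply: sqintZ => //; exact: sWt.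
  split.
  + apply: aeW => x; apply: continuous_subspaceT => t.
    by apply: cvgM; [exact: cvg_cst|exact: cW].
  + move=> t t0T; have /andP[t0 tT] := t0T; split.
    * by apply: measurable_funM => //; exact: wiener_adapted.
    * exact: iY.
    * exact: iY.
    move=> A hA; have mA := filtration_measurable hP hB tT hA.
    have iYA u : 0 <= u <= T -> P.-integrable A (EFin \o Ysol u).
      by move=> u0T; apply: integrableS (iY _ u0T).
    rewrite -(fineK (integrable_fin_num mA (iYA _ t0T))) -(fineK (integrable_fin_num mA (iYA _ T0T))).
    (* The integral over [A] is the pairing with its indicator, to which orthogonality of the later
       increment applies. *)
    have e0 : \int[P]_(x in A) (Ysol T x - Ysol t x) = 0.
      rewrite -(wiener_incr_orth hP hT hB ampl t0 tT (lexx T) hA) Rintegral_mkcond /ip.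
      by apply: eq_Rintegral => x _; rewrite patch_indic/= mulrBr.
    have e1 := subr0_eq (etrans (esym (RintegralB mA (iYA _ T0T) (iYA _ t0T))) e0).
    exact: (congr1 EFin (esym e1)).
  + move=> t t0T; have := wiener_ito hP hT hB ampl t0T.
    congr ito_integral; apply/funext => x.
    by rewrite /Ysol (wiener0 hT) mulr0 subr0.
- split.
    by rewrite Xsol_norm// lte_fin ltry andbT divr_gt0 ?subr_gt0// mulr_gt0// c0_gt0.
  apply: aeW => x; rewrite normalized_XsolE// /Xsol wextE ?(ltW hT)// /Ysol /ampl.
  by ring.
Qed.

(** The control to be shown optimal is built from [X], whereas the verification inequality concerns
    the drift built from [Y]. *)
Lemma drift_XsolE t x : 0 <= t <= T -> drift P Xsol t x = drift P Ysol t x.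
Proof. by move=> t0T; rewrite /drift normalized_YsolE. Qed.

Lemma cost_drift_Xsol : cost P T B (drift P Xsol) = cost P T B (drift P Ysol).
Proof.
congr (L2norm P _); apply/funext => x; rewrite /state; congr (_ + _).
by apply: eq_Rintegral => s; rewrite inE/= in_itv/= => s0T; exact: drift_XsolE.
Qed.

Lemma drift_Xsol_admissible : admissible P T B (drift P Xsol).
Proof. by have [[pX _ _] _ _ _] := solution_exists; exact: drift_admissible. Qed.

Lemma value_cost : value P T B = cost P T B (drift P Ysol).
Proof.
apply/le_anti/andP; split.
  rewrite -cost_drift_Xsol; apply: ereal_inf_lbound; exists (drift P Xsol) => //.
  exact: drift_Xsol_admissible.
apply/ereal_infP => _ [alpha ha <-].
exact: (solution_cost_le hP hT hB solution_exists).
Qed.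

Lemma ito_Xsol t : 0 <= t <= T -> ito_integral P B t (fun s _ => wfun t / wfun s) (Xsol t).
Proof.
move=> t0T; have /andP[t0 _] := t0T.
apply: ito_integral_eq (wiener_ito hP hT hB (wext t) t0T) => s _ /andP[s0 _].
by rewrite /ginv !wextE.
Qed.

End existence.

Theorem proposition7p1 (R : realType) (d : measure_display)
    (Omega : measurableType d) (P : probability Omega R)
    (hP : measure_is_complete P) (T : R) (hT : 0 < T)
    (B : R -> Omega -> R) (hB : brownian_motion P T B) :
  (forall t : R, 0 <= t <= T -> 0 < wfun t <= 1) /\
  exists X Y Z : R -> Omega -> R,
    (* existence and uniqueness *)
    [/\ fbsde_solution P T B X Y Z,
        forall X' Y' Z' : R -> Omega -> R, fbsde_solution P T B X' Y' Z' ->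
          [/\ indistinguishable P T X' X,
              indistinguishable P T Y' Y
            & dtP_ae_eq P T Z' Z],
    (* explicit formulas *)
        [/\ forall t, 0 <= t <= T ->
              ito_integral P B t (fun s _ => wfun t / wfun s) (X t),
            forall t, 0 <= t <= T -> ito_integral P B t Z (Y t)
          & forall t omega, 0 <= t <= T ->
              Z t omega = 2 * c0 * wfun T / (wfun t * (1 - wfun T))],
    (* norms *)
        (forall t, 0 < t <= T ->
           L2norm P (X t) = ((1 - wfun t) / (2 * c0))%:E) /\
        (forall t, 0 < t <= T -> (0 < L2norm P (Y t) < +oo)%E) /\
        {ae P, forall omega, forall t, 0 < t <= T ->
           normalized P Y t omega = normalized P X t omega}
    (* the optimal control; its value at time 0 is 0, by 0^-1 = 0 *)
      & optimal P T B (fun t omega => - c0 * normalized P X t omega) /\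
        forall alpha, optimal P T B alpha ->
          dtP_ae_eq P T alpha (fun t omega => - c0 * normalized P X t omega)].
Proof.
have w_bnd (t : R) : 0 <= t -> 0 < wfun t <= 1 by move=> /wfunP[-> ->].
split; first by move=> t /andP[/w_bnd].
exists (Xsol T B), (Ysol T B), (Zsol T); split.
- exact: solution_exists.
- by move=> X' Y' Z'; exact: (solution_unique hP hT hB (solution_exists hP hT hB)).
- split; [exact: ito_Xsol|exact: wiener_ito|move=> t x /andP[t0 _]].
  have /andP[w0 _] := w_bnd t t0; rewrite /Zsol /ginv wextE// /ampl.
  by field; rewrite !gt_eqF ?subr_gt0 ?wfun_lt1.
- split; [|split].
  + by move=> t /andP[t0 tT]; rewrite (Xsol_norm hP hT hB)// ltW.
  + by move=> t; exact: Ysol_norm_pos.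
  + apply: aeW => x t /andP[t0 tT].
    by rewrite (normalized_YsolE hP hT hB)// ltW.
split; first split.
- exact: (drift_Xsol_admissible hP hT hB).
- by rewrite (value_cost hP hT hB) -(cost_drift_Xsol hP hT hB).
move=> alpha [ha ca].
have cE : cost P T B alpha = cost P T B (drift P (Ysol T B)) by rewrite ca (value_cost hP hT hB).
have := solution_cost_eq hP hT hB (solution_exists hP hT hB) ha cE.
rewrite /dtP_ae_eq => h.
apply: (@filterS _ _ (ae_filter_ringOfSetsType (lebesgue_measure \x P)%E) _ _ _ h) => p e p0T.
by rewrite e// -(drift_XsolE hP hT hB).
Qed.
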